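(* Assume that $V \in H^2_{\mathrm{per}}(\Omega)$ is real-valued, that $\sigma \geq 1$, and that the exact solution $\psi$ of the nonlinear Schrödinger equation (NLSE) given in the context satisfies $\psi \in C([0, T]; H^4_{\mathrm{per}}(\Omega)) \cap C^1([0, T]; H^2(\Omega)) \cap C^2([0, T]; L^2(\Omega))$. Let $\psi_N^n$ ($n\ge0$) be the fully discrete sEWI-FS approximations with time step $\tau$ and mesh size $h$ defined in the context. Then there exist $\tau_0>0$ and $h_0>0$ sufficiently small and a constant $C>0$ independent of $\tau$, $h$ and $n$ such that for all $0<\tau<\tau_0$, all $0<h<h_0$ and all integers $n$ with $0 \leq n \leq T/\tau$, $$\| \psi(\cdot, t_n) - \psi_N^n \|_{L^2} \leq C( \tau^2+h^4), \qquad \| \psi(\cdot, t_n) - \psi_N^n \|_{H^1} \leq C( \tau^{3/2}+h^3).$$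
   Context: Let $\Omega=(a,b)\subset\mathbb{R}$ be a bounded interval. For integers $m\ge1$, $H^m_{\mathrm{per}}(\Omega)=\{\phi\in H^m(\Omega): \phi^{(k)}(a)=\phi^{(k)}(b),\ k=0,\dots,m-1\}$. All functions are complex-valued unless said otherwise. NLSE: with periodic boundary conditions on $\Omega$, $i\partial_t\psi = -\Delta\psi + V\psi + f(|\psi|^2)\psi$ for $x\in\Omega$, $t>0$, and $\psi(\cdot,0)=\psi_0$, where $\Delta=\partial_{xx}$, $V$ is a given real-valued potential, and $f(\rho)=\beta\rho^\sigma$ for $\rho\ge0$ with fixed $\beta\in\mathbb{R}$ and $\sigma>0$. Let $T_{\max}$ be the maximal existence time of the solution and fix $0<T<T_{\max}$. Define $B(v)=Vv+f(|v|^2)v$. Fourier coefficients: $\widehat u_l=\frac1{b-a}\int_a^b u(x)e^{-i\mu_l(x-a)}\,dx$, $\mu_l=\frac{2\pi l}{b-a}$, $l\in\mathbb{Z}$. Operators that are functions of $\Delta$ are Fourier multipliers obtained by replacing $\Delta$ by $-\mu_l^2$. Let $\varphi_{\mathrm s}(\theta)=\frac{\sin\theta}{\theta}$ (value $1$ at $0$) and $\varphi_1(z)=\frac{e^z-1}{z}$ (value $1$ at $0$). Mesh size: $h=(b-a)/N$ with $N$ a positive even integer; $\mathcal T_N=\{-N/2,\dots,N/2-1\}$; $X_N=\mathrm{span}\{e^{i\mu_l(x-a)}:l\in\mathcal T_N\}$; $P_N:L^2(\Omega)\to X_N$ is the $L^2$-projection $(P_Nu)(x)=\sum_{l\in\mathcal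 T_N}\widehat u_l e^{i\mu_l(x-a)}$. Fully discrete sEWI-FS: for a time step $\tau>0$ and $t_n=n\tau$, $\psi_N^0=P_N\psi_0$, $\ \psi_N^1=e^{i\tau\Delta}\psi_N^0-i\tau\varphi_1(i\tau\Delta)P_NB(\psi_N^0)$, and $\psi_N^{n+1}=e^{2i\tau\Delta}\psi_N^{n-1}-2i\tau e^{i\tau\Delta}\varphi_{\mathrm s}(\tau\Delta)P_NB(\psi_N^n)$ for $n\ge1$. *)

(* Defs.v *)
From HB Require Import structures.
From mathcomp Require Import all_boot all_order all_algebra.
From mathcomp Require Import complex.
From mathcomp Require Import all_classical all_reals all_analysis.
Import Order.TTheory GRing.Theory Num.Theory.
Import numFieldNormedType.Exports.
Set Implicit Arguments.
Unset Strict Implicit.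
Unset Printing Implicit Defensive.
Local Open Scope classical_set_scope.
Local Open Scope complex_scope.
Local Open Scope ring_scope.

(* Complex-valued functions on Omega = ]a, b[ are represented by total functions
   R -> R[i] of which only the values on Omega, up to almost everywhere
   equality, matter. *)

Definition cexp {R : realType} (z : R[i]) : R[i] :=
  (expR (complex.Re z))%:C *
  (cos (complex.Im z) +i* sin (complex.Im z)).

Definition cmod {R : realType} (z : R[i]) : R := ComplexField.Normc.normc z.

Definition cint {R : realType} (a b : R) (f : R -> R[i]) : R[i] :=
  (\int[lebesgue_measure]_(x in `]a, b[) complex.Re (f x)) +i*
  (\int[lebesgue_measure]_(x in `]a, b[) complex.Im (f x)).

Definition ae_eq_on {R : realType} (a b : R) (u v : R -> R[i]) : Prop :=
  {ae @lebesgue_measure R, forall x, x \in `]a, b[ -> u x = v x}.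

Definition L2norm {R : realType} (a b : R) (u : R -> R[i]) : \bar R :=
  sqrte (\int[lebesgue_measure]_(x in `]a, b[) (cmod (u x) ^+ 2)%:E)%E.

Definition L2 {R : realType} (a b : R) : set (R -> R[i]) :=
  [set u | [/\ measurable_fun `]a, b[ (fun x => complex.Re (u x)),
               measurable_fun `]a, b[ (fun x => complex.Im (u x)) &
               (L2norm a b u < +oo)%E]].

Definition test_function {R : realType} (a b : R) (phi : R -> R) : Prop :=
  (forall n x, derivable (derive1n n phi) x 1) /\
  (exists c d, [/\ a < c, d < b & forall x, x \notin `[c, d] -> phi x = 0]).

(* Weak derivative within L^2, so that both integrals below are of integrable
   functions; cint is a total function. *)
Definition is_wderiv {R : realType} (a b : R) (k : nat)
    (u g : R -> R[i]) : Prop :=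
  [/\ L2 a b u, L2 a b g &
      forall phi : R -> R, test_function a b phi ->
        cint a b (fun x => u x * (derive1n k phi x)%:C) =
        (-1) ^+ k * cint a b (fun x => g x * (phi x)%:C)].

Definition Hm {R : realType} (a b : R) (m : nat) : set (R -> R[i]) :=
  [set u | forall k, (k <= m)%N -> exists g, is_wderiv a b k u g].

(* The boundary values of the k-th derivative, k < m, are those of its
   representative g that is continuous up to the boundary. *)
Definition Hper {R : realType} (a b : R) (m : nat) : set (R -> R[i]) :=
  [set u | Hm a b m u /\
    forall k, (k < m)%N -> exists g : R -> R[i],
      [/\ is_wderiv a b k u g,
          {within `[a, b], continuous (fun x => complex.Re (g x))},
          {within `[a, b], continuous (fun x => complex.Im (g x))} &
          g a = g b]].

(* Weak derivatives being unique almost everywhere, the infimum is over a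
   singleton when u is in H^m, and over the empty set (hence +oo) otherwise. *)
Definition Hnorm {R : realType} (a b : R) (m : nat) (u : R -> R[i]) : \bar R :=
  ereal_inf [set sqrte (\sum_(k < m.+1) L2norm a b (d k) ^+ 2)%E
    | d in [set d : nat -> R -> R[i] |
             forall k, (k <= m)%N -> is_wderiv a b k u (d k)]].

Definition time_deriv {R : realType} (nrm : (R -> R[i]) -> \bar R)
    (I : set R) (u v : R -> R -> R[i]) : Prop :=
  forall t, I t ->
    nrm (fun x => (s - t)^-1%:C * (u s x - u t x) - v t x)
      @[s --> within I t^'] --> 0%E.

Definition C0_in {R : realType} (X : set (R -> R[i]))
    (nrm : (R -> R[i]) -> \bar R) (I : set R) (u : R -> R -> R[i]) : Prop :=
  forall t, I t ->
    X (u t) /\ nrm (fun x => u s x - u t x) @[s --> within I (nbhs t)] --> 0%E.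

Fixpoint Ck_in {R : realType} (X : set (R -> R[i]))
    (nrm : (R -> R[i]) -> \bar R) (I : set R) (k : nat)
    (u : R -> R -> R[i]) : Prop :=
  C0_in X nrm I u /\
  if k is k'.+1 then
    exists v, time_deriv nrm I u v /\ Ck_in X nrm I k' v
  else True.

Definition nonlin {R : realType} (beta sigma rho : R) : R := beta * rho `^ sigma.

Definition Bop {R : realType} (V : R -> R) (beta sigma : R)
    (v : R -> R[i]) : R -> R[i] :=
  fun x => (V x)%:C * v x + (nonlin beta sigma (cmod (v x) ^+ 2))%:C * v x.

Definition nlse_solution {R : realType} (a b : R) (V : R -> R)
    (beta sigma : R) (psi0 : R -> R[i]) (I : set R)
    (psi : R -> R -> R[i]) : Prop :=
  [/\ Ck_in (Hper a b 2) (Hnorm a b 2) I 0 psi,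
      exists dpsi, [/\ time_deriv (L2norm a b) I psi dpsi,
        Ck_in (L2 a b) (L2norm a b) I 0 dpsi &
        forall t, I t -> 0 < t -> exists lap,
          is_wderiv a b 2 (psi t) lap /\
          ae_eq_on a b (fun x => 'i * dpsi t x)
            (fun x => - lap x + Bop V beta sigma (psi t) x)] &
      ae_eq_on a b (psi 0) psi0].

Definition life_span {R : realType} (S : \bar R) : set R :=
  [set t | 0 <= t /\ (t%:E < S)%E].

Definition maximal_nlse_solution {R : realType} (a b : R) (V : R -> R)
    (beta sigma : R) (psi0 : R -> R[i]) (Tmax : \bar R)
    (psi : R -> R -> R[i]) : Prop :=
  nlse_solution a b V beta sigma psi0 (life_span Tmax) psi /\
  forall (S : \bar R) (chi : R -> R -> R[i]),
    nlse_solution a b V beta sigma psi0 (life_span S) chi -> (S <= Tmax)%E.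

Definition mu {R : realType} (a b : R) (l : int) : R := 2 * pi * l%:~R / (b - a).

Definition fmode {R : realType} (a b : R) (l : int) (x : R) : R[i] :=
  cexp ('i * (mu a b l * (x - a))%:C).

Definition fcoef {R : realType} (a b : R) (u : R -> R[i]) (l : int) : R[i] :=
  (b - a)^-1%:C *
  cint a b (fun x => u x * cexp (- ('i * (mu a b l * (x - a))%:C))).

(* j < N enumerates the frequencies -N/2, ..., N/2 - 1 (N is even) *)
Definition freq (N j : nat) : int := j%:Z - (N./2)%:Z.

Definition PN {R : realType} (a b : R) (N : nat) (u : R -> R[i]) : R -> R[i] :=
  fun x => \sum_(j < N) fcoef a b u (freq N j) * fmode a b (freq N j) x.

(* The multiplier m(Delta), meant for u in X_N: its series is then finite. *)
Definition fmult {R : realType} (a b : R) (N : nat) (m : R -> R[i])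
    (u : R -> R[i]) : R -> R[i] :=
  fun x => \sum_(j < N) m (- mu a b (freq N j) ^+ 2) *
    fcoef a b u (freq N j) * fmode a b (freq N j) x.

Definition phi_s {R : realType} (theta : R) : R :=
  if theta == 0 then 1 else sin theta / theta.

Definition phi_1 {R : realType} (z : R[i]) : R[i] :=
  if z == 0 then 1 else (cexp z - 1) / z.

Section Scheme.
Context {R : realType} (a b : R) (V : R -> R) (beta sigma : R)
  (psi0 : R -> R[i]) (tau : R) (N : nat).

Let expD (c : R) := fmult a b N (fun d => cexp ('i * (c * d)%:C)).
Let PNB (v : R -> R[i]) := PN a b N (Bop V beta sigma v).

Definition sEWI_init : R -> R[i] := PN a b N psi0.

Definition sEWI_first : R -> R[i] := fun x =>
  expD tau sEWI_init x -
  'i * tau%:C *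
    fmult a b N (fun d => phi_1 ('i * (tau * d)%:C)) (PNB sEWI_init) x.

Definition sEWI_step (vprev v : R -> R[i]) : R -> R[i] := fun x =>
  expD (2 * tau) vprev x -
  2 * 'i * tau%:C *
    expD tau (fmult a b N (fun d => (phi_s (tau * d))%:C) (PNB v)) x.

Fixpoint sEWI_pair (n : nat) : (R -> R[i]) * (R -> R[i]) :=
  if n is n'.+1 then
    let p := sEWI_pair n' in (p.2, sEWI_step p.1 p.2)
  else (sEWI_init, sEWI_first).

Definition sEWI_FS (n : nat) : R -> R[i] := (sEWI_pair n).1.

End Scheme.

(* Main.v *)
Require Import Defs.
From HB Require Import structures.
From mathcomp Require Import all_boot all_order all_algebra.
From mathcomp Require Import complex.
From mathcomp Require Import all_classical all_reals all_analysis.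
From mathcomp Require Import measurable_realfun.
From mathcomp Require Import ring lra zify.
Import Order.TTheory GRing.Theory Num.Theory.
Import numFieldNormedType.Exports.
Set Implicit Arguments.
Unset Strict Implicit.
Unset Printing Implicit Defensive.
Local Open Scope classical_set_scope.
Local Open Scope complex_scope.
Local Open Scope ring_scope.

(** Everything happens on the Fourier side. Write [m l = mu l ^ 2] and let
    [c t l], [g t l] be the coefficients of the solution and of the field
    [F u = V u + f(|u|^2) u] along it, so that [c' = - i (m c + g)].

    Local error. The two-step formula is exact but for its replacement of [g] on
    [t - r, t + r] by [g t]. As a function of the step [r], the defect vanishes
    at [0], and its derivative contains no stiff term [m c]: it is
      - i (cos (r m) (g (t + r) + g (t - r) - 2 g t)
           + i sin (r m) (g (t + r) - g (t - r))).
    The second difference is O(r^2) in L^2 when the solution is C^2 in time with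
    values in L^2. The first difference is only O(r), but
    [|sin (r m)| <= r m] turns a Lipschitz bound of [F] along the solution in H^2
    into a second factor [r]. Integrating in [r], the defect is O(tau^3) in
    L^2 ([defect2_bound]); without trading the sine for [m] it is O(tau^2) in H^2
    ([mdefect2_bound]); hence O(tau^(5/2)) in H^1 ([interpolation]). The first
    step is taken once, and costs O(tau^2) in L^2 and in H^2.

    Nonlinearity. [f(|z|^2) z] and the factors in its derivatives are multiples of
    the homogeneous functions [(z conj z)^q z^m (conj z)^n], whose size and
    Lipschitz constants follow from polar coordinates ([Phi_lip], [cder_Phi]); for
    [sigma >= 1] the second derivative of [x |-> F (u x)] is still a locally
    Lipschitz function of [u], [u'] and [u'']. This gives Lipschitz bounds of [F]
    in L^2, H^1 and H^2 ([field_lip], [field2_lip]), and its second differences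
    ([field_second_diff]).

    Regularity. Weak derivatives tested against smooth plateaus show that a
    continuous representative of a derivative is the integral of the next one
    ([weak_increment], [wderiv_H1]). From this follow the Sobolev bound of the sup
    norm ([sup_le_H1]), the product rule, and, for periodic functions, the
    multiplication of Fourier coefficients by [i mu l] under differentiation
    ([fcoef_deriv]). The hypotheses on the solution become bounds on its
    derivatives, their increments and a second difference ([solution_data]).

    Projection. The partial sums of a C^1 function converge pointwise in the open
    interval ([fourier_cvg]), so Fatou's lemma bounds the L^2 norm of the remainder
    by the tail of the coefficients. Beyond the cut-off [|mu l| h >= 1], and Bessel's
    inequality for the fourth derivative gives h^4 for the function and h^3 for its
    derivative ([proj_err], [proj_U]).

    Stability. The error coefficients obey the recursion of the scheme, whose
    multipliers have modulus one in front of the error and at most [2 tau] in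
    front of the field. The Lipschitz constant of [F] depends on a bound of the
    numerical solution, which the H^1 error controls as long as it is small;
    a discrete Gronwall lemma closes the induction ([stability], [convergence]). *)

(** * Complex numbers and complex-valued functions of a real variable *)

Section ComplexBasics.
Context {R : realType}.
Implicit Types (z w : R[i]) (r s t : R).
Local Notation RE := complex.Re.
Local Notation IM := complex.Im.

Lemma cReD z w : RE (z + w) = RE z + RE w. Proof. by case: z w => ? ? []. Qed.
Lemma cImD z w : IM (z + w) = IM z + IM w. Proof. by case: z w => ? ? []. Qed.
Lemma cReN z : RE (- z) = - RE z. Proof. by case: z. Qed.
Lemma cImN z : IM (- z) = - IM z. Proof. by case: z. Qed.
Lemma cReB z w : RE (z - w) = RE z - RE w. Proof. by rewrite cReD cReN. Qed.
Lemma cImB z w : IM (z - w) = IM z - IM w. Proof. by rewrite cImD cImN. Qed.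
Lemma cReM z w : RE (z * w) = RE z * RE w - IM z * IM w.
Proof. by case: z w => ? ? []. Qed.
Lemma cImM z w : IM (z * w) = RE z * IM w + IM z * RE w.
Proof. by case: z w => ? ? []. Qed.
Lemma cRe_conj z : RE (conjc z) = RE z. Proof. by case: z. Qed.
Lemma cIm_conj z : IM (conjc z) = - IM z. Proof. by case: z. Qed.
Lemma cRe_real r : RE r%:C = r. Proof. by []. Qed.
Lemma cIm_real r : IM r%:C = 0. Proof. by []. Qed.
Lemma cRe0 : RE (0 : R[i]) = 0. Proof. by []. Qed.
Lemma cIm0 : IM (0 : R[i]) = 0. Proof. by []. Qed.
Lemma cRe1 : RE (1 : R[i]) = 1. Proof. by []. Qed.
Lemma cIm1 : IM (1 : R[i]) = 0. Proof. by []. Qed.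

Lemma cRe_i : RE ('i : R[i]) = 0. Proof. by []. Qed.
Lemma cIm_i : IM ('i : R[i]) = 1. Proof. by []. Qed.

Definition ReImE :=
  (cRe_i, cIm_i, cReB, cImB, cReD, cImD, cReN, cImN, cReM, cImM, cRe_conj, cIm_conj, cRe_real, cIm_real,
   cRe0, cIm0, cRe1, cIm1).

Lemma cRe_sum I (s : seq I) (P : pred I) (F : I -> R[i]) :
  RE (\sum_(i <- s | P i) F i) = \sum_(i <- s | P i) RE (F i).
Proof. by elim/big_rec2: _ => [|i x y _ <-]; rewrite ?cReD. Qed.

Lemma complex_ext z w : RE z = RE w -> IM z = IM w -> z = w.
Proof. by case: z w => ? ? [? ?] /= -> ->. Qed.

Lemma imagE : ('i : R[i]) = Complex 0 1. Proof. by []. Qed.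

Lemma sqr_cmod z : cmod z ^+ 2 = RE z ^+ 2 + IM z ^+ 2.
Proof. by case: z => x y /=; rewrite sqr_sqrtr// addr_ge0// sqr_ge0. Qed.

Lemma cmod_ge0 z : 0 <= cmod z. Proof. by case: z => x y; exact: sqrtr_ge0. Qed.

Lemma cmodM z w : cmod (z * w) = cmod z * cmod w.
Proof. exact: ComplexField.Normc.normcM. Qed.

Lemma cmodD z w : cmod (z + w) <= cmod z + cmod w.
Proof. exact: le_normcD. Qed.

Lemma cmodN z : cmod (- z) = cmod z. Proof. exact: normcN. Qed.

Lemma cmodB z w : cmod (z - w) <= cmod z + cmod w.
Proof. by rewrite -(cmodN w) cmodD. Qed.

Lemma cmod_distC z w : cmod (z - w) = cmod (w - z).
Proof. by rewrite -cmodN opprB. Qed.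

Lemma cmod0 : cmod (0 : R[i]) = 0. Proof. exact: ComplexField.Normc.normc0. Qed.
Lemma cmod1 : cmod (1 : R[i]) = 1. Proof. exact: ComplexField.Normc.normc1. Qed.

Lemma cmodV z : cmod z^-1 = (cmod z)^-1.
Proof. exact: ComplexField.Normc.normcV. Qed.

Lemma cmod_eq0 z : (cmod z == 0) = (z == 0).
Proof.
apply/eqP/eqP => [|->]; last exact: cmod0.
exact: ComplexField.Normc.eq0_normc.
Qed.

Lemma cmod_gt0 z : (0 < cmod z) = (z != 0).
Proof. by rewrite lt_def cmod_eq0 cmod_ge0 andbT. Qed.

Lemma cmod_real r : cmod r%:C = `|r|.
Proof. by rewrite /cmod /= expr0n /= addr0 sqrtr_sqr. Qed.

Lemma cmod_conj z : cmod (conjc z) = cmod z.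
Proof. by case: z => x y /=; rewrite sqrrN. Qed.

Lemma cmodX z n : cmod (z ^+ n) = cmod z ^+ n.
Proof. by elim: n => [|n IH]; rewrite ?expr0 ?cmod1// !exprS cmodM IH. Qed.

Lemma cmod_i : cmod ('i : R[i]) = 1.
Proof. by rewrite imagE /cmod /= expr0n expr1n /= add0r sqrtr1. Qed.

Lemma Re_le_cmod z : `|RE z| <= cmod z.
Proof.
rewrite -(@ler_sqr _ `|_|) ?nnegrE ?cmod_ge0// sqr_cmod real_normK ?num_real//.
by rewrite lerDl sqr_ge0.
Qed.

Lemma Im_le_cmod z : `|IM z| <= cmod z.
Proof.
rewrite -(@ler_sqr _ `|_|) ?nnegrE ?cmod_ge0// sqr_cmod real_normK ?num_real//.
by rewrite lerDr sqr_ge0.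
Qed.

Lemma cmod_le_ReIm z : cmod z <= `|RE z| + `|IM z|.
Proof.
have -> : z = (RE z)%:C + 'i * (IM z)%:C by rewrite {1}[z]complexE.
rewrite (le_trans (cmodD _ _))// cmodM cmod_i mul1r !cmod_real !ReImE.
by rewrite !(mul0r, mulr0, mul1r, subr0, addr0, add0r).
Qed.

Lemma cmod_dist_le z w : `|cmod z - cmod w| <= cmod (z - w).
Proof.
have h1 : cmod z <= cmod (z - w) + cmod w.
  by rewrite -{1}(subrK w z) cmodD.
have h2 : cmod w <= cmod (z - w) + cmod z.
  by rewrite cmod_distC -{1}(subrK z w) cmodD.
by rewrite ler_norml; lra.
Qed.

Lemma mul_conj z : z * conjc z = (cmod z ^+ 2)%:C.
Proof. by apply: complex_ext; rewrite !ReImE ?sqr_cmod; ring. Qed.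

Lemma conjD z w : conjc (z + w) = conjc z + conjc w.
Proof. exact: rmorphD. Qed.
Lemma conjM z w : conjc (z * w) = conjc z * conjc w.
Proof. exact: rmorphM. Qed.
Lemma conjB z w : conjc (z - w) = conjc z - conjc w.
Proof. exact: rmorphB. Qed.

Lemma rcD r s : (r + s)%:C = r%:C + s%:C :> R[i]. Proof. exact: rmorphD. Qed.
Lemma rcB r s : (r - s)%:C = r%:C - s%:C :> R[i]. Proof. exact: rmorphB. Qed.
Lemma rcM r s : (r * s)%:C = r%:C * s%:C :> R[i]. Proof. exact: rmorphM. Qed.
Lemma rcN r : (- r)%:C = - r%:C :> R[i]. Proof. exact: rmorphN. Qed.
Lemma rcV r : (r^-1)%:C = r%:C^-1 :> R[i]. Proof. exact: fmorphV. Qed.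
Lemma rcX r n : (r ^+ n)%:C = r%:C ^+ n :> R[i]. Proof. exact: rmorphXn. Qed.
Lemma rc_nat n : (n%:R)%:C = n%:R :> R[i]. Proof. exact: rmorph_nat. Qed.

Definition eit (t : R) : R[i] := cos t +i* sin t.

Lemma cexp_i t : cexp ('i * t%:C) = eit t.
Proof.
by rewrite /cexp !ReImE !(mul0r, mulr0, mul1r, subr0, add0r) expR0 mul1r.
Qed.

Lemma eitD s t : eit (s + t) = eit s * eit t.
Proof. by apply: complex_ext; rewrite !ReImE /= ?cosD ?sinD//; ring. Qed.

Lemma eit0 : eit 0 = 1. Proof. by rewrite /eit cos0 sin0. Qed.

Lemma eitN t : eit (- t) = conjc (eit t).
Proof. by rewrite /eit cosN sinN. Qed.

Lemma cmod_eit t : cmod (eit t) = 1.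
Proof. by rewrite /eit /cmod /= cos2Dsin2 sqrtr1. Qed.

Lemma eit_conj t : eit t * conjc (eit t) = 1.
Proof. by rewrite mul_conj cmod_eit expr1n. Qed.

Lemma eitM_nat (n : nat) t : eit (n%:R * t) = eit t ^+ n.
Proof.
elim: n => [|n IH]; first by rewrite mul0r eit0.
by rewrite exprS -IH -eitD -nat1r mulrDl mul1r.
Qed.

End ComplexBasics.

Section Calculus.
Context {R : realType}.
Local Notation RE := complex.Re.
Local Notation IM := complex.Im.
Implicit Types (f g : R -> R[i]) (x : R) (c l m : R[i]).

(** Continuity and differentiability are taken componentwise, which reduces them to
    real functions and requires no topology on [R[i]]. *)
Definition ccont f := continuous (fun x => RE (f x)) /\ continuous (fun x => IM (f x)).

Definition cder f x l :=
  is_derive x (1 : R) (fun x => RE (f x)) (RE l) /\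
  is_derive x (1 : R) (fun x => IM (f x)) (IM l).

Lemma ccont_cst c : ccont (fun=> c).
Proof. by split=> x; exact: cvg_cst. Qed.

Lemma ccontD f g : ccont f -> ccont g -> ccont (fun x => f x + g x).
Proof.
move=> [f1 f2] [g1 g2]; split=> x.
  have -> : (fun x => RE (f x + g x)) = (fun x => RE (f x)) \+ (fun x => RE (g x)).
    by apply/funext => y /=; rewrite cReD.
  by apply: cvgD; [exact: f1|exact: g1].
have -> : (fun x => IM (f x + g x)) = (fun x => IM (f x)) \+ (fun x => IM (g x)).
  by apply/funext => y /=; rewrite cImD.
by apply: cvgD; [exact: f2|exact: g2].
Qed.

Lemma ccontM f g : ccont f -> ccont g -> ccont (fun x => f x * g x).
Proof.
move=> [f1 f2] [g1 g2]; split.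
  under eq_fun do rewrite cReM.
  by move=> x; apply: cvgB; apply: cvgM;
     first [exact: f1|exact: f2|exact: g1|exact: g2].
under eq_fun do rewrite cImM.
by move=> x; apply: cvgD; apply: cvgM;
     first [exact: f1|exact: f2|exact: g1|exact: g2].
Qed.

Lemma ccont_conj f : ccont f -> ccont (fun x => conjc (f x)).
Proof.
move=> [f1 f2]; split.
  by under eq_fun do rewrite cRe_conj.
by under eq_fun do rewrite cIm_conj; move=> x; apply: cvgN; exact: f2.
Qed.

Lemma ccontN f : ccont f -> ccont (fun x => - f x).
Proof.
move=> h; have -> : (fun x => - f x) = (fun x => (-1) * f x).
  by apply/funext => x; rewrite mulN1r.
by apply: ccontM => //; exact: ccont_cst.
Qed.

Lemma ccontB f g : ccont f -> ccont g -> ccont (fun x => f x - g x).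
Proof. by move=> ? ?; apply: ccontD => //; exact: ccontN. Qed.

Lemma ccont_sum I (s : seq I) (F : I -> R -> R[i]) :
  (forall i, ccont (F i)) -> ccont (fun x => \sum_(i <- s) F i x).
Proof.
move=> H; elim: s => [|i s IH].
  by under eq_fun do rewrite big_nil; exact: ccont_cst.
by under eq_fun do rewrite big_cons; apply: ccontD.
Qed.

Lemma ccont_cmod f : ccont f -> continuous (fun x => cmod (f x)).
Proof.
move=> [f1 f2] x.
have -> : (fun x => cmod (f x)) =
    (fun x => Num.sqrt (RE (f x) * RE (f x) + IM (f x) * IM (f x))).
  by apply/funext => y; rewrite /cmod; case: (f y) => u v /=; rewrite !expr2.
apply: (@continuous_comp _ _ _ (fun x => RE (f x) * RE (f x) + IM (f x) * IM (f x))
   (@Num.sqrt R)); last exact: sqrt_continuous.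
by apply: cvgD; apply: cvgM; first [exact: f1|exact: f2].
Qed.

Lemma cder_cst c x : cder (fun=> c) x 0.
Proof. by split; apply: is_derive_cst. Qed.

Lemma cderD f g x l m : cder f x l -> cder g x m -> cder (fun x => f x + g x) x (l + m).
Proof.
move=> [f1 f2] [g1 g2]; split.
  by under eq_fun do rewrite cReD; rewrite cReD; exact: is_deriveD.
by under eq_fun do rewrite cImD; rewrite cImD; exact: is_deriveD.
Qed.

Lemma cderM f g x l m : cder f x l -> cder g x m ->
  cder (fun x => f x * g x) x (l * g x + f x * m).
Proof.
move=> [f1 f2] [g1 g2]; split.
  under eq_fun do rewrite cReM.
  apply: is_derive_eq.
  by rewrite !ReImE /GRing.scale /=; ring.
under eq_fun do rewrite cImM.
apply: is_derive_eq.
by rewrite !ReImE /GRing.scale /=; ring.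
Qed.

Lemma cder_conj f x l : cder f x l -> cder (fun x => conjc (f x)) x (conjc l).
Proof.
move=> [f1 f2]; split.
  by under eq_fun do rewrite cRe_conj; rewrite cRe_conj.
by under eq_fun do rewrite cIm_conj; rewrite cIm_conj; exact: is_deriveN.
Qed.

Lemma cderZ c f x l : cder f x l -> cder (fun x => c * f x) x (c * l).
Proof.
move=> h; have := cderM (cder_cst c x) h.
by rewrite mul0r add0r.
Qed.

Lemma cderN f x l : cder f x l -> cder (fun x => - f x) x (- l).
Proof.
move=> h; have := cderZ (-1) h; rewrite mulN1r.
by under eq_fun do rewrite mulN1r.
Qed.

Lemma cderB f g x l m : cder f x l -> cder g x m -> cder (fun x => f x - g x) x (l - m).
Proof. by move=> hf hg; apply: cderD => //; exact: cderN. Qed.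

Lemma cder_sum I (s : seq I) (F : I -> R -> R[i]) x (L : I -> R[i]) :
  (forall i, cder (F i) x (L i)) ->
  cder (fun x => \sum_(i <- s) F i x) x (\sum_(i <- s) L i).
Proof.
move=> H; elim: s => [|i s IH].
  by under eq_fun do rewrite big_nil; rewrite big_nil; exact: cder_cst.
by under eq_fun do rewrite big_cons; rewrite big_cons; apply: cderD.
Qed.

Lemma cder_real (f : R -> R) x (l : R) :
  is_derive x (1 : R) f l -> cder (fun x => (f x)%:C) x l%:C.
Proof. by move=> h; split => //=; exact: is_derive_cst. Qed.

Lemma cder_eit (k d x : R) : cder (fun x => eit (k * (x - d))) x ('i * k%:C * eit (k * (x - d))).
Proof.
have h : is_derive x 1 (fun x : R => k * (x - d)) k.
  by apply: is_derive_eq; rewrite /GRing.scale /=; ring.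
have hc := @is_derive1_comp R (@cos R) (fun x => k * (x - d)) x _ _ (is_derive_cos _) h.
have hs := @is_derive1_comp R (@sin R) (fun x => k * (x - d)) x _ _ (is_derive_sin _) h.
split.
  by apply: (is_derive_eq hc); rewrite !ReImE /=; ring.
by apply: (is_derive_eq hs); rewrite !ReImE /=; ring.
Qed.

Lemma cder_ext f g x l : (forall x, f x = g x) -> cder f x l -> cder g x l.
Proof. by move=> /funext ->. Qed.

Lemma ccont_ext f g : (forall x, f x = g x) -> ccont f -> ccont g.
Proof. by move=> /funext ->. Qed.

Lemma ccont_eit (k d : R) : ccont (fun x => eit (k * (x - d))).
Proof.
have h x : {for x, continuous (fun x : R => k * (x - d))}.
  by apply: cvgM; [exact: cvg_cst|apply: cvgB; [exact: cvg_id|exact: cvg_cst]].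
split=> x /=.
  by apply: (continuous_comp (h x)); exact: continuous_cos.
by apply: (continuous_comp (h x)); exact: continuous_sin.
Qed.

End Calculus.

(** * Integrals of functions that agree almost everywhere *)

Section NonMeasurable.
Import HBNNSimple.
Local Open Scope ereal_scope.

(** The integral of an arbitrary nonnegative function is a supremum over the simple
    functions below it. Cutting a simple function below [F] off on a null set puts it
    below [G] and keeps its integral. [F] and [G] being arbitrary
    functions, an integrand may be replaced by any that agrees with it almost
    everywhere, such as the initial datum by the solution at time [0]. *)
Lemma sup_sintegral_ae_le (d : measure_display) (T : measurableType d) (R : realType)
    (mu : {measure set T -> \bar R}) (F G : T -> \bar R) :
  (forall x, 0 <= G x) -> {ae mu, forall x, F x <= G x} ->
  ereal_sup [set sintegral mu h | h in [set h : {nnsfun T >-> R} | forall x, (h x)%:E <= F x]] <=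
  ereal_sup [set sintegral mu h | h in [set h : {nnsfun T >-> R} | forall x, (h x)%:E <= G x]].
Proof.
move=> G0 [Z [mZ Z0 FG]]; apply: ge_ereal_sup => _ [h /= hF <-].
have mC : measurable (setT `\` Z) by exact: measurableD.
apply: ereal_sup_ubound; exists (proj_nnsfun h mC) => /=.
  move=> x; have := congr1 (fun q => q x) (mrestrict h mC) => /= <-; rewrite patchE; case: ifPn => [|_]; last exact: G0.
  rewrite inE => -[_ xZ]; apply: le_trans (hF x) _.
  by apply: contrapT => nFG; apply: xZ; exact: FG.
rewrite -mrestrict -integral_nnsfun// -ge0_negligible_integral//.
- by rewrite integralT_nnsfun.
- by apply/measurable_EFinP; exact: measurable_funP.
- by move=> x _; rewrite lee_fin fun_ge0.
Qed.

Lemma integral_ae_eq (d : measure_display) (T : measurableType d) (R : realType)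
    (mu : {measure set T -> \bar R}) (D : set T) (f g : T -> \bar R) :
  {ae mu, forall x, D x -> f x = g x} ->
  \int[mu]_(x in D) f x = \int[mu]_(x in D) g x.
Proof.
move=> fg; have fgD : {ae mu, forall x, (f \_ D) x = (g \_ D) x}.
  by move: fg; apply: filterS => x h; rewrite /patch; case: ifPn => //; rewrite inE => /h.
have le (u v : T -> \bar R) : {ae mu, forall x, u x = v x} ->
    {ae mu, forall x, u^\+ x <= v^\+ x} /\ {ae mu, forall x, u^\- x <= v^\- x}.
  move=> uv; split; by move: uv; apply: filterS => x h; rewrite ?funeposE ?funenegE h.
have [p1 n1] := le _ _ fgD.
have [p2 n2] := le (g \_ D) (f \_ D) (filterS (fun x h => esym h) fgD).
rewrite /integral; congr (_ - _); apply/eqP; rewrite eq_le; apply/andP; split.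
all: apply: sup_sintegral_ae_le => // x; exact: funepos_ge0 || exact: funeneg_ge0.
Qed.

End NonMeasurable.

(** * Integration on an interval *)

Section RealIntegral.
Context {R : realType}.
Implicit Types (c d : R) (f g : R -> R).
Local Notation mu := (@lebesgue_measure R).

Lemma aeS (P Q : R -> Prop) : (forall x, P x -> Q x) ->
  {ae mu, forall x, P x} -> {ae mu, forall x, Q x}.
Proof. move=> PQ; apply: filterS PQ; exact: (ae_filter_ringOfSetsType mu). Qed.

Lemma aeS2 (P Q S : R -> Prop) : (forall x, P x -> Q x -> S x) ->
  {ae mu, forall x, P x} -> {ae mu, forall x, Q x} -> {ae mu, forall x, S x}.
Proof. move=> PQ; apply: filterS2 PQ; exact: (ae_filter_ringOfSetsType mu). Qed.

Definition ri c d f : R := \int[mu]_(x in `]c, d[) f x.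
Definition rint c d f : Prop := mu.-integrable `]c, d[ (EFin \o f).

Lemma meas_oo c d : measurable (`]c, d[ : set (measurableTypeR R)).
Proof. exact: measurable_itv. Qed.

Lemma mu_oo c d : c <= d -> mu `]c, d[ = (d - c)%:E.
Proof.
move=> cd; rewrite lebesgue_measure_itv /= lte_fin.
case: ltP => // dc; have -> : d = c by apply/eqP; rewrite eq_le dc cd.
by rewrite subrr.
Qed.

Lemma mu_oo_fin c d : (mu `]c, d[ < +oo)%E.
Proof.
have [cd|dc] := leP c d; first by rewrite mu_oo// ltry.
by rewrite set_itv_ge ?measure0// bnd_simp -leNgt ltW.
Qed.

Lemma rint_meas c d f : rint c d f -> measurable_fun (`]c, d[ : set (measurableTypeR R)) f.
Proof. by move=> /measurable_int /measurable_EFinP. Qed.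

Lemma rint_dom c d f g : measurable_fun (`]c, d[ : set (measurableTypeR R)) f ->
  (forall x, c < x < d -> `|f x| <= g x) -> rint c d g -> rint c d f.
Proof.
move=> mf fg; apply: le_integrable => //; first exact/measurable_EFinP.
move=> x /=; rewrite in_itv /= => xcd; rewrite lee_fin (le_trans (fg _ xcd))//.
exact: ler_norm.
Qed.

Lemma rint_eq c d f g : (forall x, c < x < d -> f x = g x) -> rint c d f -> rint c d g.
Proof.
move=> fg; apply: eq_integrable => // x; rewrite inE /= in_itv /= => xcd.
by rewrite fg.
Qed.

Lemma ri_eq c d f g : (forall x, c < x < d -> f x = g x) -> ri c d f = ri c d g.
Proof.
move=> fg; apply: eq_Rintegral => x; rewrite inE /= in_itv /= => xcd.
by rewrite fg.
Qed.

Lemma rintD c d f g : rint c d f -> rint c d g -> rint c d (fun x => f x + g x).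
Proof. by move=> hf hg; apply: (integrableD _ hf hg); exact: meas_oo. Qed.

Lemma rintZ c d r f : rint c d f -> rint c d (fun x => r * f x).
Proof. by move=> hf; apply: (integrableZl _ _ hf); exact: meas_oo. Qed.

Lemma rintN c d f : rint c d f -> rint c d (fun x => - f x).
Proof.
move=> /(@rintZ _ _ (-1)); apply: rint_eq => x _.
by rewrite mulN1r.
Qed.

Lemma rintB c d f g : rint c d f -> rint c d g -> rint c d (fun x => f x - g x).
Proof. by move=> hf hg; apply: rintD => //; exact: rintN. Qed.

Lemma rint_abs c d f : rint c d f -> rint c d (fun x => `|f x|).
Proof. exact: integrable_norm. Qed.

Lemma rint_cst c d r : rint c d (fun=> r).
Proof.
apply: measurable_bounded_integrable; [exact: meas_oo|exact: mu_oo_fin|by []|].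
by exists `|r|; split; [exact: num_real|move=> M rM x _ /=; exact: ltW].
Qed.

Lemma rint_sub c d c' d' f : c' <= c -> d <= d' -> rint c' d' f -> rint c d f.
Proof.
move=> cc dd; apply: integrableS; try exact: meas_oo.
by apply: subset_itvW; rewrite ?bnd_simp.
Qed.

Lemma riD c d f g : rint c d f -> rint c d g ->
  ri c d (fun x => f x + g x) = ri c d f + ri c d g.
Proof. by move=> *; apply: RintegralD => //; exact: meas_oo. Qed.

Lemma riB c d f g : rint c d f -> rint c d g ->
  ri c d (fun x => f x - g x) = ri c d f - ri c d g.
Proof. by move=> *; apply: RintegralB => //; exact: meas_oo. Qed.

Lemma riZ c d r f : rint c d f -> ri c d (fun x => r * f x) = r * ri c d f.
Proof. by move=> *; apply: RintegralZl => //; exact: meas_oo. Qed.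

Lemma riN c d f : rint c d f -> ri c d (fun x => - f x) = - ri c d f.
Proof.
move=> hf; rewrite -mulN1r -riZ//; apply: ri_eq => x _.
by rewrite mulN1r.
Qed.

Lemma ri_cst c d r : c <= d -> ri c d (fun=> r) = r * (d - c).
Proof.
move=> cd; rewrite /ri (Rintegral_cst _ (meas_oo c d)); congr (_ * _).
exact: (congr1 fine (mu_oo cd)).
Qed.

Lemma ri_ge0 c d f : (forall x, c < x < d -> 0 <= f x) -> 0 <= ri c d f.
Proof. by move=> h; apply: Rintegral_ge0 => x /=; rewrite in_itv /=; exact: h. Qed.

Lemma ri_le c d f g : rint c d f -> rint c d g ->
  (forall x, c < x < d -> f x <= g x) -> ri c d f <= ri c d g.
Proof. by move=> hf hg h; apply: le_Rintegral. Qed.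

Lemma ri_abs c d f : rint c d f -> `|ri c d f| <= ri c d (fun x => `|f x|).
Proof. by move=> hf; apply: le_normr_Rintegral. Qed.

Lemma ri_abs_le c d f g : rint c d f -> rint c d g ->
  (forall x, c < x < d -> `|f x| <= g x) -> `|ri c d f| <= ri c d g.
Proof.
move=> hf hg h; apply: (le_trans (ri_abs hf)).
by apply: ri_le => //; exact: rint_abs.
Qed.

Lemma ri_ae c d f g :
  {ae mu, forall x, x \in `]c, d[ -> f x = g x} -> ri c d f = ri c d g.
Proof.
move=> fg; congr fine; apply: integral_ae_eq.
by apply: aeS fg => x h /h ->.
Qed.

Lemma ri_zero c d : ri c d (fun=> 0) = 0.
Proof.
rewrite -[RHS](mul0r (ri c d (fun=> 0))) -(riZ 0 (rint_cst c d 0)).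
by apply: ri_eq => x _; rewrite mul0r.
Qed.

Lemma ri_nil c f : ri c c f = 0.
Proof. by rewrite /ri set_itv_ge ?Rintegral_set0// bnd_simp ltxx. Qed.

Lemma ri_chasles c e d f : c <= e -> e <= d -> rint c d f ->
  ri c d f = ri c e f + ri e d f.
Proof.
rewrite le_eqVlt => /predU1P[<- _ _|ce]; first by rewrite ri_nil add0r.
rewrite le_eqVlt => /predU1P[<- _|ed hf]; first by rewrite ri_nil addr0.
have h := @Rintegral_itvB R f (BRight c) (BLeft d) e hf.
rewrite /ri -h ?bnd_simp ?(ltW ce)// addrC.
rewrite [X in _ + X]Rintegral_itv_bndo_bndc ?subrK//.
by apply: (rint_sub (lexx c) (ltW ed) hf).
Qed.

Lemma meas_cont c d f : continuous f -> measurable_fun (`]c, d[ : set (measurableTypeR R)) f.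
Proof.
move=> cf; apply: (measurable_funS measurableT) => //.
exact: continuous_measurable_fun.
Qed.

Lemma cont_bounded c d f : continuous f -> exists2 K : R, 0 <= K & forall x, c <= x <= d -> `|f x| <= K.
Proof.
move=> cf; have [cd|dc] := leP c d; last first.
  by exists 0 => // x /andP[cx xd]; move: (le_trans cx xd); rewrite leNgt dc.
have h : {within `[c, d], continuous (fun x => `|f x|)}.
  apply: continuous_subspaceT => x; apply: (@continuous_comp _ _ _ f Num.norm).
    exact: cf.
  exact: norm_continuous.
have [m mcd hm] := EVT_max cd h.
by exists `|f m| => // x xcd; apply: hm; rewrite in_itv.
Qed.

Lemma rint_cont c d f : continuous f -> rint c d f.
Proof.
move=> cf; have [K K0 hK] := cont_bounded c d cf.
apply: (@rint_dom _ _ _ (fun=> K)); [exact: meas_cont| |exact: rint_cst].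
by move=> x /andP[cx xd]; apply: hK; rewrite !ltW.
Qed.

End RealIntegral.

Section ComplexIntegral.
Context {R : realType}.
Implicit Types (c d : R) (f g u w : R -> R[i]).
Local Notation RE := complex.Re.
Local Notation IM := complex.Im.
Local Notation mu := (@lebesgue_measure R).

Definition cmeas c d u :=
  measurable_fun (`]c, d[ : set (measurableTypeR R)) (fun x => RE (u x)) /\
  measurable_fun (`]c, d[ : set (measurableTypeR R)) (fun x => IM (u x)).
Definition cintg c d f := rint c d (fun x => RE (f x)) /\ rint c d (fun x => IM (f x)).

Lemma cintE c d f : cint c d f = ri c d (fun x => RE (f x)) +i* ri c d (fun x => IM (f x)).
Proof. by []. Qed.

Lemma Re_cint c d f : RE (cint c d f) = ri c d (fun x => RE (f x)).
Proof. by []. Qed.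
Lemma Im_cint c d f : IM (cint c d f) = ri c d (fun x => IM (f x)).
Proof. by []. Qed.

Lemma cint_eq c d f g : (forall x, c < x < d -> f x = g x) -> cint c d f = cint c d g.
Proof. by move=> fg; rewrite !cintE; congr Complex; apply: ri_eq => x /fg ->. Qed.

Lemma cint_ae c d f g : ae_eq_on c d f g -> cint c d f = cint c d g.
Proof.
by move=> h; rewrite !cintE; congr Complex; apply: ri_ae; apply: aeS h => x hx /hx ->.
Qed.

Lemma cintg_eq c d f g : (forall x, c < x < d -> f x = g x) -> cintg c d f -> cintg c d g.
Proof.
move=> fg [f1 f2]; split; [apply: rint_eq f1|apply: rint_eq f2] => x /fg ->//.
Qed.

Lemma cintgD c d f g : cintg c d f -> cintg c d g -> cintg c d (fun x => f x + g x).
Proof.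
move=> [f1 f2] [g1 g2]; split.
  by under eq_fun do rewrite cReD; exact: rintD.
by under eq_fun do rewrite cImD; exact: rintD.
Qed.

Lemma cintgZ c d z f : cintg c d f -> cintg c d (fun x => z * f x).
Proof.
move=> [f1 f2]; split.
  by under eq_fun do rewrite cReM; apply: rintB; exact: rintZ.
by under eq_fun do rewrite cImM; apply: rintD; exact: rintZ.
Qed.

Lemma cintgN c d f : cintg c d f -> cintg c d (fun x => - f x).
Proof. by move=> /(cintgZ (-1)); under eq_fun do rewrite mulN1r. Qed.

Lemma cintD c d f g : cintg c d f -> cintg c d g ->
  cint c d (fun x => f x + g x) = cint c d f + cint c d g.
Proof.
move=> [f1 f2] [g1 g2]; apply: complex_ext; rewrite ?(cReD, cImD) !(Re_cint, Im_cint) -riD//.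
  by apply: ri_eq => x _; rewrite cReD.
by apply: ri_eq => x _; rewrite cImD.
Qed.

Lemma cintZ c d z f : cintg c d f -> cint c d (fun x => z * f x) = z * cint c d f.
Proof.
move=> [f1 f2]; apply: complex_ext; rewrite ?(cReM, cImM) !(Re_cint, Im_cint).
  rewrite -!riZ// -riB; try exact: rintZ.
  by apply: ri_eq => x _; rewrite cReM.
rewrite -!riZ// -riD; try exact: rintZ.
by apply: ri_eq => x _; rewrite cImM.
Qed.

Lemma cintN c d f : cintg c d f -> cint c d (fun x => - f x) = - cint c d f.
Proof.
by move=> h; rewrite -mulN1r -cintZ//; apply: cint_eq => x _; rewrite mulN1r.
Qed.

Lemma cintB c d f g : cintg c d f -> cintg c d g ->
  cint c d (fun x => f x - g x) = cint c d f - cint c d g.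
Proof. by move=> hf hg; rewrite cintD ?cintN//; exact: cintgN. Qed.

Lemma cint_sum c d I (s : seq I) (F : I -> R -> R[i]) : (forall i, cintg c d (F i)) ->
  cint c d (fun x => \sum_(i <- s) F i x) = \sum_(i <- s) cint c d (F i) /\
  cintg c d (fun x => \sum_(i <- s) F i x).
Proof.
move=> H; elim: s => [|i s [IH1 IH2]].
  under eq_fun do rewrite big_nil; rewrite big_nil; split; last first.
    by split; exact: rint_cst.
  by apply: complex_ext; rewrite ?Re_cint ?Im_cint (ri_eq (g := fun=> 0))// ri_zero.
under eq_fun do rewrite big_cons; rewrite big_cons; split.
  by rewrite cintD// IH1.
exact: cintgD.
Qed.

Lemma cint_conj c d f : cintg c d f -> cint c d (fun x => conjc (f x)) = conjc (cint c d f).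
Proof.
move=> [f1 f2]; apply: complex_ext; rewrite ?(cRe_conj, cIm_conj) !(Re_cint, Im_cint).
  by apply: ri_eq => x _; rewrite cRe_conj.
by rewrite -riN//; apply: ri_eq => x _; rewrite cIm_conj.
Qed.

Lemma cintg_sub c d c' d' f : c' <= c -> d <= d' -> cintg c' d' f -> cintg c d f.
Proof. by move=> cc dd [f1 f2]; split; [apply: rint_sub f1|apply: rint_sub f2]. Qed.

Lemma cmeas_ccont c d f : ccont f -> cmeas c d f.
Proof. by move=> [f1 f2]; split; exact: meas_cont. Qed.

Lemma cmeasD c d f g : cmeas c d f -> cmeas c d g -> cmeas c d (fun x => f x + g x).
Proof.
move=> [f1 f2] [g1 g2]; split.
  by under [X in measurable_fun _ X]eq_fun do rewrite cReD; exact: measurable_funD.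
by under [X in measurable_fun _ X]eq_fun do rewrite cImD; exact: measurable_funD.
Qed.

Lemma cmeasM c d f g : cmeas c d f -> cmeas c d g -> cmeas c d (fun x => f x * g x).
Proof.
move=> [f1 f2] [g1 g2]; split.
  by under [X in measurable_fun _ X]eq_fun do rewrite cReM; apply: measurable_funB; exact: measurable_funM.
by under [X in measurable_fun _ X]eq_fun do rewrite cImM; apply: measurable_funD; exact: measurable_funM.
Qed.

Lemma cmeas_cst c d z : cmeas c d (fun=> z).
Proof. by split. Qed.

Lemma cmeas_conj c d f : cmeas c d f -> cmeas c d (fun x => conjc (f x)).
Proof.
move=> [f1 f2]; split.
  by under [X in measurable_fun _ X]eq_fun do rewrite cRe_conj.
by under [X in measurable_fun _ X]eq_fun do rewrite cIm_conj; exact: measurableT_comp.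
Qed.

Lemma meas_cmod2 c d f : cmeas c d f ->
  measurable_fun (`]c, d[ : set (measurableTypeR R)) (fun x => cmod (f x) ^+ 2).
Proof.
move=> [f1 f2]; under [X in measurable_fun _ X]eq_fun do rewrite sqr_cmod.
by apply: measurable_funD; apply: measurable_funX.
Qed.

Lemma meas_cmod c d f : cmeas c d f ->
  measurable_fun (`]c, d[ : set (measurableTypeR R)) (fun x => cmod (f x)).
Proof.
move=> h; have -> : (fun x => cmod (f x)) = Num.sqrt \o (fun x => cmod (f x) ^+ 2).
  by apply/funext => x /=; rewrite sqrtr_sqr ger0_norm// cmod_ge0.
apply: measurableT_comp; last exact: meas_cmod2.
by apply: continuous_measurable_fun => x; exact: sqrt_continuous.
Qed.

Lemma cintg_dom c d f (g : R -> R) : cmeas c d f -> rint c d g ->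
  (forall x, c < x < d -> cmod (f x) <= g x) -> cintg c d f.
Proof.
move=> [f1 f2] hg h; split; apply: (rint_dom _ _ hg) => // x /h; apply: le_trans.
  exact: Re_le_cmod.
exact: Im_le_cmod.
Qed.

Lemma cintg_cmod c d f : cintg c d f -> rint c d (fun x => cmod (f x)).
Proof.
move=> [f1 f2]; apply: (@rint_dom _ _ _ _ (fun x => `|RE (f x)| + `|IM (f x)|)).
- by apply: meas_cmod; split; exact: rint_meas.
- by move=> x _; rewrite ger0_norm ?cmod_ge0// cmod_le_ReIm.
- by apply: rintD; exact: rint_abs.
Qed.

(** Rotating the integral onto the positive half line avoids the factor two of
    the estimate by real and imaginary parts. *)
Lemma cmod_cint c d f : cintg c d f -> cmod (cint c d f) <= ri c d (fun x => cmod (f x)).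
Proof.
move=> hf; have [->|nz] := eqVneq (cint c d f) 0.
  by rewrite cmod0; apply: ri_ge0 => x _; exact: cmod_ge0.
set z := cint c d f in nz *.
have cz : 0 < cmod z by rewrite cmod_gt0.
pose q := (cmod z)^-1%:C * conjc z.
have cq : cmod q = 1.
  by rewrite cmodM cmod_real cmod_conj ger0_norm ?invr_ge0 ?cmod_ge0// mulVf ?gt_eqF.
have -> : cmod z = RE (cint c d (fun x => q * f x)).
  rewrite cintZ// -/z /q -mulrA (mulrC (conjc z)) mul_conj cReM !ReImE mul0r subr0.
  by rewrite expr2 mulrA mulVf ?mul1r// gt_eqF.
have [h1 h2] := cintgZ q hf.
rewrite Re_cint; apply: ri_le => //; first exact: cintg_cmod.
move=> x _; apply: (le_trans (ler_norm _)); apply: (le_trans (Re_le_cmod _)).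
by rewrite cmodM cq mul1r.
Qed.

End ComplexIntegral.

(** * The L^2 norm and inner product *)

Section L2Space.
Context {R : realType} (a b : R).
Implicit Types (u w q : R -> R[i]).
Local Notation RE := complex.Re.
Local Notation IM := complex.Im.
Local Notation mu := (@lebesgue_measure R).

Definition nrm u : R := Num.sqrt (ri a b (fun x => cmod (u x) ^+ 2)).
Definition cip u w : R[i] := cint a b (fun x => u x * conjc (w x)).

Lemma nrm_ge0 u : 0 <= nrm u. Proof. exact: sqrtr_ge0. Qed.

Lemma sqr_nrm u : nrm u ^+ 2 = ri a b (fun x => cmod (u x) ^+ 2).
Proof. by rewrite sqr_sqrtr// ri_ge0// => x _; rewrite exprn_ge0// cmod_ge0. Qed.

Lemma L2P u : L2 a b u <-> cmeas a b u /\ rint a b (fun x => cmod (u x) ^+ 2).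
Proof.
split=> [[m1 m2 fin]|[[m1 m2] h]].
  have cm : cmeas a b u by [].
  split=> //; apply/integrableP; split.
    by apply/measurable_EFinP; exact: (meas_cmod2 cm).
  under eq_integral do rewrite /= ger0_norm ?exprn_ge0 ?cmod_ge0//.
  move: fin; rewrite /L2norm.
  have : (0 <= \int[mu]_(x in `]a, b[) (cmod (u x) ^+ 2)%:E)%E.
    by apply: integral_ge0 => x _; rewrite lee_fin exprn_ge0// cmod_ge0.
  by case: (\int[mu]_(x in _) _)%E => //= r; rewrite !ltry.
split=> //; rewrite /L2norm.
move/integrableP : h => [_].
under eq_integral do rewrite /= ger0_norm ?exprn_ge0 ?cmod_ge0//.
by case: (\int[mu]_(x in _) _)%E => //= r; rewrite ?ltry.
Qed.

Lemma L2_meas u : L2 a b u -> cmeas a b u. Proof. by move=> /L2P[]. Qed.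
Lemma L2_int2 u : L2 a b u -> rint a b (fun x => cmod (u x) ^+ 2).
Proof. by move=> /L2P[]. Qed.

Lemma L2normE u : L2 a b u -> L2norm a b u = (nrm u)%:E.
Proof.
move=> /L2_int2 h; rewrite /L2norm /nrm /ri /Rintegral.
have := integrable_fin_num (meas_oo a b) h.
by move=> /fineK <-.
Qed.

Lemma L2_intro u (g : R -> R) : cmeas a b u -> rint a b g ->
  (forall x, a < x < b -> cmod (u x) ^+ 2 <= g x) -> L2 a b u.
Proof.
move=> mu1 hg h; apply/L2P; split=> //.
apply: (rint_dom _ _ hg); first exact: meas_cmod2.
by move=> x xab; rewrite ger0_norm ?exprn_ge0 ?cmod_ge0// h.
Qed.

Lemma L2_dom u w : cmeas a b u -> L2 a b w ->
  (forall x, a < x < b -> cmod (u x) <= cmod (w x)) -> L2 a b u.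
Proof.
move=> mu1 hw h; apply: (L2_intro mu1 (L2_int2 hw)) => x /h xab.
by rewrite ler_sqr ?nnegrE ?cmod_ge0.
Qed.

Lemma cmod_sqrD (z w : R[i]) : cmod (z + w) ^+ 2 <= 2 * cmod z ^+ 2 + 2 * cmod w ^+ 2.
Proof.
have h : cmod (z + w) ^+ 2 <= (cmod z + cmod w) ^+ 2.
  by rewrite ler_sqr ?nnegrE ?addr_ge0 ?cmod_ge0// cmodD.
by apply: (le_trans h); have := sqr_ge0 (cmod z - cmod w); nra.
Qed.

Lemma L2D u w : L2 a b u -> L2 a b w -> L2 a b (fun x => u x + w x).
Proof.
move=> hu hw.
apply: (@L2_intro _ (fun x => 2 * cmod (u x) ^+ 2 + 2 * cmod (w x) ^+ 2)).
- by apply: cmeasD; exact: L2_meas.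
- by apply: rintD; apply: rintZ; exact: L2_int2.
- by move=> x _; exact: cmod_sqrD.
Qed.

Lemma L2M_bnd q u K : cmeas a b q -> (forall x, a < x < b -> cmod (q x) <= K) ->
  L2 a b u -> L2 a b (fun x => q x * u x).
Proof.
move=> mq hq hu; apply: (@L2_intro _ (fun x => K ^+ 2 * cmod (u x) ^+ 2)).
- by apply: cmeasM => //; exact: L2_meas.
- by apply: rintZ; exact: L2_int2.
- move=> x xab; rewrite cmodM exprMn ler_wpM2r ?exprn_ge0 ?cmod_ge0//.
  by rewrite ler_sqr ?nnegrE ?cmod_ge0// ?hq// (le_trans (cmod_ge0 _) (hq x xab)).
Qed.

Lemma L2Z z u : L2 a b u -> L2 a b (fun x => z * u x).
Proof. by apply: (@L2M_bnd (fun=> z) u (cmod z)) => //; exact: cmeas_cst. Qed.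

Lemma L2N u : L2 a b u -> L2 a b (fun x => - u x).
Proof. by move=> /(L2Z (-1)); under eq_fun do rewrite mulN1r. Qed.

Lemma L2B u w : L2 a b u -> L2 a b w -> L2 a b (fun x => u x - w x).
Proof. by move=> hu hw; apply: L2D => //; exact: L2N. Qed.

Lemma L2_cst z : L2 a b (fun=> z).
Proof.
apply: (@L2_intro _ (fun=> cmod z ^+ 2)) => //; exact: rint_cst.
Qed.

Lemma L2_bnd u K : cmeas a b u -> (forall x, a < x < b -> cmod (u x) <= K) -> L2 a b u.
Proof.
move=> mu1 h; have := @L2M_bnd u (fun=> 1) K mu1 h (L2_cst 1).
by under eq_fun do rewrite mulr1.
Qed.

Lemma ccont_bounded u : ccont u -> exists2 K : R, 0 <= K & forall x, a <= x <= b -> cmod (u x) <= K.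
Proof.
move=> /ccont_cmod /(cont_bounded a b)[K K0 hK]; exists K => // x /hK.
by rewrite ger0_norm ?cmod_ge0.
Qed.

Lemma L2_ccont u : ccont u -> L2 a b u.
Proof.
move=> cu; have [K _ hK] := ccont_bounded cu.
apply: (@L2_bnd _ K); first exact: cmeas_ccont.
by move=> x /andP[ax xb]; apply: hK; rewrite !ltW.
Qed.

Lemma L2M_ccont q u : ccont q -> L2 a b u -> L2 a b (fun x => q x * u x).
Proof.
move=> cq; have [K _ hK] := ccont_bounded cq.
apply: (@L2M_bnd _ _ K); first exact: cmeas_ccont.
by move=> x /andP[ax xb]; apply: hK; rewrite !ltW.
Qed.

Lemma L2_conj u : L2 a b u -> L2 a b (fun x => conjc (u x)).
Proof.
move=> hu; apply: (L2_dom _ hu) => [|x _]; last by rewrite cmod_conj.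
exact/cmeas_conj/L2_meas.
Qed.

Lemma L2_sum I (s : seq I) (F : I -> R -> R[i]) : (forall i, L2 a b (F i)) ->
  L2 a b (fun x => \sum_(i <- s) F i x).
Proof.
move=> H; elim: s => [|i s IH].
  by under eq_fun do rewrite big_nil; exact: L2_cst.
by under eq_fun do rewrite big_cons; exact: L2D.
Qed.

Lemma L2M_intg u w : L2 a b u -> L2 a b w -> cintg a b (fun x => u x * w x).
Proof.
move=> hu hw; apply: (@cintg_dom _ _ _ _ (fun x => cmod (u x) ^+ 2 + cmod (w x) ^+ 2)).
- by apply: cmeasM; exact: L2_meas.
- by apply: rintD; exact: L2_int2.
- move=> x _; rewrite cmodM; have := cmod_ge0 (u x); have := cmod_ge0 (w x).
  move: (cmod _) (cmod _) => s t; nra.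
Qed.

Lemma L2_intg u : L2 a b u -> cintg a b u.
Proof.
move=> hu; have := L2M_intg hu (L2_cst 1).
by apply: cintg_eq => x _; rewrite mulr1.
Qed.

Lemma cip_intg u w : L2 a b u -> L2 a b w -> cintg a b (fun x => u x * conjc (w x)).
Proof. by move=> hu hw; apply: L2M_intg => //; exact: L2_conj. Qed.

Lemma cipDl u u' w : L2 a b u -> L2 a b u' -> L2 a b w ->
  cip (fun x => u x + u' x) w = cip u w + cip u' w.
Proof.
move=> *; rewrite /cip -cintD; try exact: cip_intg.
by apply: cint_eq => x _; rewrite mulrDl.
Qed.

Lemma cipZl z u w : L2 a b u -> L2 a b w -> cip (fun x => z * u x) w = z * cip u w.
Proof.
move=> *; rewrite /cip -cintZ; try exact: cip_intg.
by apply: cint_eq => x _; rewrite mulrA.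
Qed.

Lemma cip_conj u w : L2 a b u -> L2 a b w -> conjc (cip u w) = cip w u.
Proof.
move=> *; rewrite /cip -cint_conj; try exact: cip_intg.
by apply: cint_eq => x _; rewrite conjM conjcK mulrC.
Qed.

Lemma cipBl u u' w : L2 a b u -> L2 a b u' -> L2 a b w ->
  cip (fun x => u x - u' x) w = cip u w - cip u' w.
Proof.
move=> *; rewrite /cip -cintB; try exact: cip_intg.
by apply: cint_eq => x _; rewrite mulrBl.
Qed.

Lemma cip_suml I (s : seq I) (F : I -> R -> R[i]) w :
  (forall i, L2 a b (F i)) -> L2 a b w ->
  cip (fun x => \sum_(i <- s) F i x) w = \sum_(i <- s) cip (F i) w.
Proof.
move=> H hw.
have [<- _] := @cint_sum _ a b I s (fun i x => F i x * conjc (w x)) (fun i => cip_intg (H i) hw).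
by apply: cint_eq => x _; rewrite mulr_suml.
Qed.

Lemma cip_self u : L2 a b u -> cip u u = (nrm u ^+ 2)%:C.
Proof.
move=> hu; rewrite sqr_nrm /cip; apply: complex_ext; rewrite ?Re_cint ?Im_cint /=.
  by apply: ri_eq => x _; rewrite mul_conj.
by rewrite -[RHS](ri_zero a b); apply: ri_eq => x _; rewrite mul_conj.
Qed.

Lemma sqr_nrmD u w : L2 a b u -> L2 a b w ->
  nrm (fun x => u x + w x) ^+ 2 = nrm u ^+ 2 + 2 * RE (cip u w) + nrm w ^+ 2.
Proof.
move=> hu hw; apply: complexI; rewrite -cip_self; last exact: L2D.
rewrite cipDl//; last exact: L2D.
have E v : L2 a b v -> cip v (fun x => u x + w x) = cip v u + cip v w.
  move=> hv; rewrite -cip_conj//; last exact: L2D.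
  by rewrite cipDl// conjD !cip_conj.
rewrite !E// !cip_self// -(cip_conj hu hw).
rewrite !rcD rcM rc_nat -addcJ.
by ring.
Qed.

Lemma nrmZ z u : L2 a b u -> nrm (fun x => z * u x) = cmod z * nrm u.
Proof.
move=> hu; rewrite /nrm -[cmod z](ger0_norm (cmod_ge0 _)) -sqrtr_sqr -sqrtrM ?sqr_ge0//.
congr Num.sqrt; rewrite -riZ; last exact: L2_int2.
by apply: ri_eq => x _; rewrite cmodM exprMn.
Qed.

Lemma nrm_eq u w : (forall x, a < x < b -> u x = w x) -> nrm u = nrm w.
Proof. by move=> h; congr Num.sqrt; apply: ri_eq => x /h ->. Qed.

Lemma nrm_ae u w : ae_eq_on a b u w -> nrm u = nrm w.
Proof. by move=> h; congr Num.sqrt; apply: ri_ae; apply: aeS h => x hx /hx ->. Qed.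

Lemma nrmN u : nrm (fun x => - u x) = nrm u.
Proof. by congr Num.sqrt; apply: ri_eq => x _; rewrite cmodN. Qed.

Lemma nrm_distC u w : nrm (fun x => u x - w x) = nrm (fun x => w x - u x).
Proof. by congr Num.sqrt; apply: ri_eq => x _; rewrite cmod_distC. Qed.

Lemma nrm_le u w : L2 a b u -> L2 a b w ->
  (forall x, a < x < b -> cmod (u x) <= cmod (w x)) -> nrm u <= nrm w.
Proof.
move=> hu hw h; apply: ler_wsqrtr; apply: ri_le; try exact: L2_int2.
by move=> x /h xab; rewrite ler_sqr ?nnegrE ?cmod_ge0.
Qed.

(** The square norm of [s u + t w] is nonnegative for [s = - nrm w], [t = nrm u]; if one of
    these is zero, a large multiple of the other function is taken instead. *)
Lemma cauchy_schwarz_re u w : L2 a b u -> L2 a b w -> RE (cip u w) <= nrm u * nrm w.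
Proof.
move=> hu hw.
have key (s t : R) : 0 <= s ^+ 2 * nrm u ^+ 2 + 2 * (s * t) * RE (cip u w) + t ^+ 2 * nrm w ^+ 2.
  have := sqr_ge0 (nrm (fun x => s%:C * u x + t%:C * w x)).
  rewrite sqr_nrmD; try exact: L2Z.
  rewrite !nrmZ// !exprMn !cmod_real !real_normK ?num_real// cipZl//; last exact: L2Z.
  rewrite -(cip_conj (L2Z t%:C hw) hu) cipZl// conjM cip_conj//.
  have -> : RE (s%:C * (conjc t%:C * cip u w)) = s * t * RE (cip u w).
    by rewrite !ReImE; ring.
  by rewrite mulrA.
move: (nrm_ge0 u) (nrm_ge0 w) key.
move: (nrm u) (nrm w) (RE _) => A B x A0 B0 key.
have [A1|A1] := ltP 0 A; last first.
  have {A0 A1}A00 : A = 0 by apply/eqP; rewrite eq_le A0 A1.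
  rewrite A00 mul0r leNgt; apply/negP => x0.
  have := key (- (1 + B ^+ 2) / (2 * x)) 1; rewrite A00 expr0n /= mulr0 add0r.
  have -> : 2 * (- (1 + B ^+ 2) / (2 * x) * 1) * x = - (1 + B ^+ 2).
    by field; rewrite gt_eqF.
  by nra.
have [B1|B1] := ltP 0 B; last first.
  have {B0 B1}B00 : B = 0 by apply/eqP; rewrite eq_le B0 B1.
  rewrite B00 mulr0 leNgt; apply/negP => x0.
  have := key 1 (- (1 + A ^+ 2) / (2 * x)); rewrite B00 expr0n /= mulr0 addr0.
  have -> : 2 * (1 * (- (1 + A ^+ 2) / (2 * x))) * x = - (1 + A ^+ 2).
    by field; rewrite gt_eqF.
  by nra.
have := key (- B) A.
have -> : (- B) ^+ 2 * A ^+ 2 + 2 * (- B * A) * x + A ^+ 2 * B ^+ 2 =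
  2 * (A * B) * (A * B - x) by ring.
by rewrite pmulr_rge0 ?subr_ge0// mulr_gt0// mulr_gt0.
Qed.

Lemma cauchy_schwarz u w : L2 a b u -> L2 a b w -> cmod (cip u w) <= nrm u * nrm w.
Proof.
move=> hu hw; have [->|nz] := eqVneq (cip u w) 0.
  by rewrite cmod0 mulr_ge0 ?nrm_ge0.
set z := cip u w in nz *.
have cz : 0 < cmod z by rewrite cmod_gt0.
pose q := (cmod z)^-1%:C * conjc z.
have cq : cmod q = 1.
  by rewrite cmodM cmod_real cmod_conj ger0_norm ?invr_ge0 ?cmod_ge0// mulVf ?gt_eqF.
have -> : cmod z = RE (cip (fun x => q * u x) w).
  rewrite cipZl// -/z /q -mulrA (mulrC (conjc z)) mul_conj cReM !ReImE mul0r subr0.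
  by rewrite expr2 mulrA mulVf ?mul1r// gt_eqF.
apply: (le_trans (cauchy_schwarz_re (L2Z q hu) hw)).
by rewrite nrmZ// cq mul1r.
Qed.

Lemma nrmD u w : L2 a b u -> L2 a b w -> nrm (fun x => u x + w x) <= nrm u + nrm w.
Proof.
move=> hu hw; rewrite -ler_sqr ?nnegrE ?addr_ge0 ?nrm_ge0// sqr_nrmD//.
by have := cauchy_schwarz_re hu hw; nra.
Qed.

Lemma nrmB u w : L2 a b u -> L2 a b w -> nrm (fun x => u x - w x) <= nrm u + nrm w.
Proof. by move=> hu hw; rewrite -(nrmN w); apply: nrmD => //; exact: L2N. Qed.

Lemma nrm_dist u w : L2 a b u -> L2 a b w -> `|nrm u - nrm w| <= nrm (fun x => u x - w x).
Proof.
move=> hu hw.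
have h1 : nrm u <= nrm (fun x => u x - w x) + nrm w.
  rewrite -(@nrm_eq (fun x => u x - w x + w x)) => [|x _]; last by rewrite subrK.
  by apply: nrmD => //; exact: L2B.
have h2 : nrm w <= nrm (fun x => u x - w x) + nrm u.
  rewrite nrm_distC -(@nrm_eq (fun x => w x - u x + u x)) => [|x _]; last by rewrite subrK.
  by apply: nrmD => //; exact: L2B.
by rewrite ler_norml; lra.
Qed.

Lemma nrmM_bnd q u K : cmeas a b q -> 0 <= K -> (forall x, a < x < b -> cmod (q x) <= K) ->
  L2 a b u -> nrm (fun x => q x * u x) <= K * nrm u.
Proof.
move=> mq K0 hq hu; rewrite -[K]ger0_norm// -cmod_real -nrmZ//.
apply: nrm_le; [exact: L2M_bnd mq hq hu|exact: L2Z|].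
move=> x /hq xab; rewrite !cmodM cmod_real (ger0_norm K0).
by rewrite ler_wpM2r ?cmod_ge0.
Qed.

Lemma nrm_dom2 u w1 w2 (c1 c2 : R) : L2 a b u -> L2 a b w1 -> L2 a b w2 ->
  0 <= c1 -> 0 <= c2 ->
  (forall x, a < x < b -> cmod (u x) <= c1 * cmod (w1 x) + c2 * cmod (w2 x)) ->
  nrm u <= c1 * nrm w1 + c2 * nrm w2.
Proof.
move=> hu h1 h2 c10 c20 h.
have E (w : R -> R[i]) (c : R) : L2 a b w -> 0 <= c ->
    L2 a b (fun x => (c * cmod (w x))%:C) /\ nrm (fun x => (c * cmod (w x))%:C) = c * nrm w.
  move=> hw c0.
  have H (x : R) : cmod (c * cmod (w x))%:C = cmod (c%:C * w x).
    by rewrite cmodM !cmod_real normrM (ger0_norm (cmod_ge0 _)).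
  split.
    apply: (L2_dom _ (L2Z c%:C hw)) => [|x _]; last by rewrite H.
    split=> //=; apply: measurable_funM => //.
    exact: (meas_cmod (L2_meas hw)).
  rewrite -[X in X * _](ger0_norm c0) -cmod_real -nrmZ//.
  by congr Num.sqrt; apply: ri_eq => x _; rewrite H.
have [L1 <-] := E _ _ h1 c10; have [L2' <-] := E _ _ h2 c20.
apply: le_trans (nrmD L1 L2'); apply: nrm_le => //; first exact: L2D.
move=> x /h xab; rewrite -rcD cmod_real ger0_norm//.
by rewrite addr_ge0// mulr_ge0// cmod_ge0.
Qed.

End L2Space.

(** * Smooth plateaus and weak derivatives *)

Section DeriveEps.
Context {R : realType}.
Implicit Types (f : R -> R) (x d : R).

Lemma is_derive_eps f x d :
  (forall e : R, 0 < e -> exists2 r : R, 0 < r &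
     forall y, `|y - x| < r -> `|f y - f x - (y - x) * d| <= e * `|y - x|) ->
  is_derive x (1 : R) f d.
Proof.
move=> H.
have cv : h^-1 *: ((f \o shift x) (h *: (1 : R)) - f x) @[h --> 0^'] --> d.
  apply/cvgrPdist_le => e e0; have [r r0 hr] := H _ e0.
  exists r => // h hb h0; have hr' : `|h| < r by have := hb; rewrite /ball_ /= sub0r normrN.
  have := hr (h * 1 + x); rewrite mulr1 addrK => /(_ hr') hh.
  rewrite /GRing.scale /= mulr1.
  have -> : d - h^-1 * (f (h + x) - f x) = - (h^-1 * (f (h + x) - f x - h * d)).
    by rewrite [X in _ = - X]mulrBr mulrA mulVf// mul1r opprB.
  by rewrite normrN normrM normfV ler_pdivrMl ?normr_gt0// [leRHS]mulrC.
apply: DeriveDef; first by apply/cvg_ex; exists d.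
exact: (cvg_lim _ cv).
Qed.

Lemma eps_is_derive f x d : is_derive x (1 : R) f d ->
  forall e : R, 0 < e -> exists2 r : R, 0 < r &
     forall y, `|y - x| < r -> `|f y - f x - (y - x) * d| <= e * `|y - x|.
Proof.
move=> [df <-] e e0.
have cv : h^-1 *: ((f \o shift x) (h *: (1 : R)) - f x) @[h --> 0^'] --> 'D_1 f x by exact: df.
move/cvgrPdist_le : cv => /(_ _ e0)[r /= r0 hr]; exists r => // y yr.
have [->|yx] := eqVneq y x; first by rewrite !subrr mul0r subrr normr0 mulr0.
have h0 : y - x != 0 by rewrite subr_eq0.
have := hr (y - x); rewrite /= sub0r normrN => /(_ yr h0).
rewrite /GRing.scale /= mulr1 subrK.
set D := 'D_1 f x.
have -> : D - (y - x)^-1 * (f y - f x) = - ((y - x)^-1 * (f y - f x - (y - x) * D)).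
  by rewrite [X in _ = - X]mulrBr mulrA mulVf// mul1r opprB.
by rewrite normrN normrM normfV ler_pdivrMl ?normr_gt0// [leRHS]mulrC.
Qed.

End DeriveEps.

Section Plateau.
Context {R : realType}.
Implicit Types (f g : R -> R) (k : nat) (x s t : R).

(** The functions [x^(-k) exp (-1/x)], extended by [0]: the derivative of each one is a
    combination of two others, so differentiability of all of them gives smoothness. *)
Definition flat k x : R := if 0 < x then x^-1 ^+ k * expR (- x^-1) else 0.

Lemma flat_ge0 k x : 0 <= flat k x.
Proof.
rewrite /flat; case: ifPn => // x0.
by rewrite mulr_ge0 ?expR_ge0// exprn_ge0// invr_ge0 ltW.
Qed.

(** The exponential beats every power, here with the explicit constant coming from
    [exp y = (exp (y / n)) ^ n >= (y / n) ^ n]. *)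
Lemma flat_le k x : flat k x <= (k.+2)%:R ^+ k.+2 * x ^+ 2.
Proof.
rewrite /flat; case: ifPn => x0; last first.
  by rewrite mulr_ge0 ?sqr_ge0 ?exprn_ge0// ler0n.
set y := x^-1; have y0 : 0 < y by rewrite invr_gt0.
have n0 : (0 : R) < k.+2%:R by rewrite ltr0n.
have h : (y / k.+2%:R) ^+ k.+2 <= expR y.
  have -> : y = k.+2%:R * (y / k.+2%:R) by field; rewrite gt_eqF.
  rewrite expRM_natl lerXn2r ?nnegrE ?expR_ge0 ?divr_ge0 ?mulr_ge0 ?ltW// ?divr_gt0//.
  rewrite mulrAC divff ?gt_eqF// mul1r.
  by apply: lt_le_trans (expR_ge1Dx _); rewrite ltrDr.
have -> : x = y^-1 by rewrite invrK.
rewrite expRN ler_pdivrMr ?expR_gt0// -mulrA.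
have -> : y ^+ k = k.+2%:R ^+ k.+2 * (y^-1 ^+ 2 * (y / k.+2%:R) ^+ k.+2).
  rewrite expr_div_n !exprS !expr0; field.
  by rewrite !gt_eqF// exprn_gt0.
by rewrite ler_pM2l ?exprn_gt0// ler_wpM2l// exprn_ge0// invr_ge0 ltW.
Qed.

Lemma is_derive_flat k x : is_derive x 1 (flat k) (flat k.+2 x - k%:R * flat k.+1 x).
Proof.
have [x0|x0|->] := ltgtP x 0.
- have -> : flat k.+2 x - k%:R * flat k.+1 x = 0.
    by rewrite /flat ltNge (ltW x0) /= mulr0 subr0.
  apply: (@near_eq_is_derive _ _ _ (fun=> 0)).
  near=> y; rewrite /flat ltNge ltW//=; near: y.
  exact: lt_nbhsl.
- have -> : flat k.+2 x - k%:R * flat k.+1 x =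
      x^-1 ^+ k.+2 * expR (- x^-1) - k%:R * (x^-1 ^+ k.+1 * expR (- x^-1)).
    by rewrite /flat x0.
  apply: (@near_eq_is_derive R R R^o (fun y : R => y^-1 ^+ k * expR (- y^-1)) (flat k) x 1).
    near=> y; rewrite /flat ifT//; near: y.
    exact: lt_nbhsr.
  have xn0 : x != 0 by rewrite gt_eqF.
  have h1 : is_derive x 1 (fun y : R => y^-1) (- x^-1 ^+ 2).
    apply: is_derive_eq; first exact: (@is_deriveV _ id).
    by rewrite /GRing.scale /= mulr1 exprVn.
  have h2 : is_derive x 1 (fun y : R => expR (- y^-1)) (x^-1 ^+ 2 * expR (- x^-1)).
    have h3 := @is_derive1_comp R expR (fun y => - y^-1) x _ _ (is_derive_expR _) (is_deriveN h1).
    by apply: (is_derive_eq h3); ring.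
  have h4 : is_derive x 1 (fun y : R => y^-1 ^+ k) (k%:R * x^-1 ^+ k.-1 * - x^-1 ^+ 2).
    have := is_deriveX k h1; rewrite fctE => h5.
    by apply: (is_derive_eq h5); rewrite /GRing.scale /=; ring.
  apply: (is_derive_eq (is_deriveM h4 h2)); rewrite /GRing.scale /=.
  case: k h4 => [|k] _; first by rewrite !expr0 !exprS; ring.
  by rewrite /= !exprS; ring.
- have -> : flat k.+2 0 - k%:R * flat k.+1 0 = 0 :> R.
    by rewrite /flat ltxx mulr0 subr0.
  apply: is_derive_eps => e e0.
  set K : R := k.+2%:R ^+ k.+2.
  have K0 : 0 < K by rewrite exprn_gt0// ltr0n.
  exists (e / K); first by rewrite divr_gt0.
  move=> y; rewrite subr0 mulr0 subr0 {2}/flat ltxx subr0 => yr.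
  rewrite ger0_norm ?flat_ge0// (le_trans (flat_le k y))// -/K.
  rewrite -[y ^+ 2]real_normK ?num_real// expr2 mulrA ler_wpM2r ?normr_ge0//.
  by rewrite mulrC -ler_pdivlMr// ltW.
Unshelve. all: by end_near. Qed.

(** A class of functions stable under differentiation: every function in it is
    therefore infinitely differentiable. *)
Inductive smooth_class : (R -> R) -> Prop :=
| sc_flat k s t : smooth_class (fun x => flat k (s * x + t))
| sc_cst c : smooth_class (fun=> c)
| sc_add f g : smooth_class f -> smooth_class g -> smooth_class (fun x => f x + g x)
| sc_mul f g : smooth_class f -> smooth_class g -> smooth_class (fun x => f x * g x)
| sc_inv f : (forall x, f x != 0) -> smooth_class f -> smooth_class (fun x => (f x)^-1).

Lemma smooth_class_derive f : smooth_class f ->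
  exists2 f', smooth_class f' & forall x, is_derive x 1 f (f' x).
Proof.
elim=> {f} [k s t|c|f g _ [f' sf' df] _ [g' sg' dg]|f g sf [f' sf' df] sg [g' sg' dg]|f f0 sf [f' sf' df]].
- exists (fun x => s * (flat k.+2 (s * x + t) + (- k%:R) * flat k.+1 (s * x + t))).
    do ![exact: sc_flat|exact: sc_cst|apply: sc_mul|apply: sc_add].
  move=> x.
  have h : is_derive x 1 (fun x : R => s * x + t) s.
    by apply: is_derive_eq; rewrite /GRing.scale /=; ring.
  have := @is_derive1_comp R (flat k) (fun x => s * x + t) x _ _ (is_derive_flat k _) h.
  by move=> h1; apply: (is_derive_eq h1); ring.
- by exists (fun=> 0); [exact: sc_cst|move=> x; exact: is_derive_cst].
- by exists (fun x => f' x + g' x); [exact: sc_add|move=> x; exact: is_deriveD].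
- exists (fun x => f x * g' x + g x * f' x).
    by apply: sc_add; exact: sc_mul.
  by move=> x; apply: is_derive_eq; rewrite /GRing.scale.
- exists (fun x => (-1) * ((f x)^-1 * (f x)^-1) * f' x).
    by do ![exact: sc_cst|apply: sc_mul|apply: sc_inv].
  move=> x; have h := @is_deriveV _ f x _ 1 (f0 x) (df x); apply: (is_derive_eq h).
  by rewrite /GRing.scale /= exprS expr1 invfM; ring.
Qed.

Lemma smooth_class_derivable f : smooth_class f -> forall n x, derivable (derive1n n f) x 1.
Proof.
move=> sf n; suff : smooth_class (derive1n n f).
  by move=> /smooth_class_derive[f' _ h] x; exact: ex_derive.
elim: n => //= n /smooth_class_derive[f' sf' h].
have -> // : derive1 (derive1n n f) = f'.
by apply/funext => x; rewrite derive1E; exact: derive_val.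
Qed.

Definition step x : R := flat 0 x / (flat 0 x + flat 0 (1 - x)).

Lemma step_den_gt0 x : 0 < flat 0 x + flat 0 (1 - x).
Proof.
have [x0|x0] := ltP 0 x.
  by rewrite ltr_wpDr ?flat_ge0// /flat x0 expr0 mul1r expR_gt0.
by rewrite ltr_wpDl ?flat_ge0// /flat ifT ?expr0 ?mul1r ?expR_gt0//; lra.
Qed.

Lemma step_smooth (s t : R) : smooth_class (fun x => step (s * x + t)).
Proof.
apply: sc_mul; first exact: sc_flat.
apply: sc_inv => [x|]; first by rewrite gt_eqF ?step_den_gt0.
apply: sc_add; first exact: sc_flat.
have -> : (fun x => flat 0 (1 - (s * x + t))) = (fun x => flat 0 (- s * x + (1 - t))).
  by apply/funext => x; congr flat; ring.
exact: sc_flat.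
Qed.

Lemma step_le0 x : x <= 0 -> step x = 0.
Proof. by move=> x0; rewrite /step {1}/flat ltNge x0 /= mul0r. Qed.

Lemma step_ge1 x : 1 <= x -> step x = 1.
Proof.
move=> x1; rewrite /step.
have -> : flat 0 (1 - x) = 0 by rewrite /flat ifN// -leNgt; lra.
by rewrite addr0 divff// gt_eqF// /flat ifT ?expr0 ?mul1r ?expR_gt0//; lra.
Qed.

Lemma step_ge0 x : 0 <= step x.
Proof. by rewrite divr_ge0 ?flat_ge0// ltW ?step_den_gt0. Qed.

Lemma step_le1 x : step x <= 1.
Proof. by rewrite ler_pdivrMr ?step_den_gt0// mul1r lerDl flat_ge0. Qed.

End Plateau.


Section WeakDerivative.
Context {R : realType}.
Implicit Types (f g h : R -> R) (a b c d e x : R).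
Local Notation mu := (@lebesgue_measure R).

Lemma ri_dominated a b (f_ : nat -> R -> R) f g :
  (forall n, measurable_fun (`]a, b[ : set (measurableTypeR R)) (f_ n)) ->
  measurable_fun (`]a, b[ : set (measurableTypeR R)) f ->
  (forall x, a < x < b -> f_ n x @[n --> \oo] --> f x) ->
  rint a b g -> (forall n x, a < x < b -> `|f_ n x| <= g x) ->
  ri a b (f_ n) @[n --> \oo] --> ri a b f.
Proof.
move=> mf_ mf cv ig dom.
have [|||||fint _ lim] := @dominated_convergence _ _ R mu `]a, b[ (meas_oo a b)
  (fun n => EFin \o f_ n) (EFin \o f) (EFin \o g).
- by move=> n; apply/measurable_EFinP; exact: mf_.
- by apply/measurable_EFinP; exact: mf.
- apply: aeW => x /=; rewrite in_itv /= => xab.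
  by apply: cvg_EFin; [exact: nearW|exact: cv].
- exact: ig.
- by apply: aeW => x n /=; rewrite in_itv /= => xab; rewrite lee_fin dom.
apply: fine_cvg; rewrite fineK//.
by apply: integrable_fin_num => //; exact: meas_oo.
Qed.

(** A smooth function that rises from [0] to [1] on [[c, c + e]] and falls back on
    [[d, d + e]]; as [e] tends to [0] it tends to the indicator of [(c, d]], and its
    derivative to the difference of point masses at [c] and [d]. *)
Definition plateau c d e x : R := step (e^-1 * x + - (e^-1 * c)) + (-1) * step (e^-1 * x + - (e^-1 * d)).

Lemma plateau_smooth c d e : smooth_class (plateau c d e).
Proof.
by do ![exact: step_smooth|exact: sc_cst|apply: sc_mul|apply: sc_add].
Qed.

Lemma plateau_out c d e x : 0 < e -> c <= d -> x <= c \/ d + e <= x -> plateau c d e x = 0.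
Proof.
move=> e0 cd [xc|xd]; rewrite /plateau.
  rewrite !step_le0 ?mulr0 ?addr0// -mulrBr pmulr_rle0 ?invr_gt0//; lra.
have ei : e^-1 * e = 1 by rewrite mulVf// gt_eqF.
rewrite !step_ge1 ?mulN1r ?subrr// -mulrBr -{1}ei ler_pM2l ?invr_gt0//; lra.
Qed.

Lemma plateau_in c d e x : 0 < e -> c + e <= x -> x <= d -> plateau c d e x = 1.
Proof.
move=> e0 cx xd; rewrite /plateau.
have ei : e^-1 * e = 1 by rewrite mulVf// gt_eqF.
rewrite step_ge1; last by rewrite -mulrBr -{1}ei ler_pM2l ?invr_gt0//; lra.
rewrite step_le0 ?mulr0 ?addr0// -mulrBr pmulr_rle0 ?invr_gt0//; lra.
Qed.

Lemma plateau_bnd c d e x : `|plateau c d e x| <= 1.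
Proof.
rewrite /plateau mulN1r.
move: (e^-1 * x - _) (e^-1 * x - _) => s t.
have := step_ge0 s; have := step_le1 s; have := step_ge0 t; have := step_le1 t.
by rewrite ler_norml; lra.
Qed.

Lemma plateau_test a b c d e : 0 < e -> a < c -> c <= d -> d + e < b ->
  test_function a b (plateau c d e).
Proof.
move=> e0 ac cd db; split.
  exact/smooth_class_derivable/plateau_smooth.
exists c, (d + e); split=> // x; rewrite in_itv /= negb_and -!ltNge => H.
by apply: plateau_out => //; case/orP: H => /ltW; [left|right].
Qed.

Lemma smooth_cont f : smooth_class f -> continuous f.
Proof.
move=> /smooth_class_derive[f' _ df] x.
apply: differentiable_continuous; apply/derivable1_diffP.
exact: ex_derive.
Qed.

Lemma test_cont a b (phi : R -> R) : test_function a b phi -> continuous phi.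
Proof.
move=> [h _] x; apply: differentiable_continuous; apply/derivable1_diffP.
exact: (h 0%N x).
Qed.

Lemma test_derive a b (phi : R -> R) : test_function a b phi -> test_function a b (derive1 phi).
Proof.
move=> [h [c [d [ac db out]]]]; split.
  move=> n x; have := h n.+1 x; rewrite /derive1n iterSr; exact.
exists c, d; split=> // x xcd.
have : \forall y \near x, phi y = 0.
  move: xcd; rewrite in_itv /= negb_and -!ltNge => /orP[xc|dx].
    near=> y; apply: out; rewrite in_itv /= negb_and -!ltNge; apply/orP; left.
    by near: y; exact: lt_nbhsl.
  near=> y; apply: out; rewrite in_itv /= negb_and -!ltNge; apply/orP; right.
  by near: y; exact: lt_nbhsr.
move=> hx; rewrite derive1E (near_eq_derive (g := fun=> 0 : R)) ?derive_cst//.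
Unshelve. all: by end_near. Qed.

Lemma test_derive_cont a b (phi : R -> R) : test_function a b phi -> continuous (derive1 phi).
Proof. by move=> /test_derive; exact: test_cont. Qed.

Lemma ri_plateau a b c d h : a < c -> c < d -> d < b -> rint a b h ->
  forall r : R, 0 < r ->
    exists e, [/\ 0 < e, d + e < b, e < r & `|ri a b (fun x => h x * plateau c d e x) - ri c d h| <= r].
Proof.
move=> ac cd db hi r r0.
pose m : R := Num.min (b - d) r; have m0 : 0 < m by rewrite lt_min subr_gt0 db.
pose e_ n : R := m / n.+2%:R.
have e_gt0 n : 0 < e_ n by rewrite divr_gt0.
have e_lt n : e_ n < m.
  by rewrite ltr_pdivrMr ?ltr0n// ltr_pMr// ltr1n.
pose chi x : R := if (c < x) && (x <= d) then h x else 0.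
have mchi : measurable_fun (`]a, b[ : set (measurableTypeR R)) chi.
  have -> : chi = h \_ `]c, d].
    apply/funext => x; rewrite /chi /patch; case: ifPn => [xcd|xcd].
      by rewrite mem_set//= in_itv.
    by rewrite memNset//= in_itv; exact/negP.
  have H : rint a b (h \_ `]c, d]).
    rewrite /rint -restrict_EFin; apply/integrable_restrict => //.
    apply: integrableS hi; [exact: meas_oo| |exact: subIsetl].
    by apply: measurableI; exact: measurable_itv.
  exact: rint_meas H.
have cv : ri a b (fun x => h x * plateau c d (e_ n) x) @[n --> \oo] --> ri a b chi.
  apply: (@ri_dominated _ _ _ _ (fun x => `|h x|)).
  - move=> n; apply: measurable_funM; first exact: rint_meas hi.
    exact: (meas_cont (smooth_cont (plateau_smooth c d (e_ n)))).
  - exact: mchi.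
  - move=> x xab.
    have ecv : e_ n @[n --> \oo] --> 0.
      rewrite -[X in _ --> X](mulr0 m); apply: cvgM; first exact: cvg_cst.
      by have := @cvg_harmonic R; rewrite -cvg_shiftS.
    apply: (@cvg_trans _ (chi x @[_ --> \oo])); last exact: cvg_cst.
    apply: near_eq_cvg.
    have [xc|cx] := leP x c.
      apply: nearW => n; rewrite /chi ltNge xc /= plateau_out ?mulr0//; [exact: ltW|by left].
    have [xd|dx] := leP x d.
      have : \forall n \near \oo, e_ n < x - c by apply: (@cvgr_lt _ _ _ _ _ _ ecv); rewrite subr_gt0.
      by apply: filterS => n hn; rewrite /chi cx xd /= plateau_in ?mulr1//; lra.
    have : \forall n \near \oo, e_ n < x - d by apply: (@cvgr_lt _ _ _ _ _ _ ecv); rewrite subr_gt0.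
    apply: filterS => n hn; rewrite /chi cx leNgt dx /= plateau_out ?mulr0//; first exact: ltW.
    by right; lra.
  - exact: rint_abs.
  - by move=> n x _; rewrite normrM ler_piMr// plateau_bnd.
have -> : ri c d h = ri a b chi.
  have H : rint a b chi.
    apply: (@rint_dom _ _ _ _ (fun x => `|h x|)) => //; last exact: rint_abs.
    by move=> x _; rewrite /chi; case: ifP; rewrite ?normr0.
  rewrite (ri_chasles (ltW ac) _ H); last exact: ltW (lt_trans cd db).
  rewrite [X in _ = _ + X](ri_chasles (ltW cd) (ltW db)); last first.
    by apply: rint_sub H => //; exact: ltW.
  rewrite (@ri_eq _ a c chi (fun=> 0)); last first.
    by move=> x /andP[_ xc]; rewrite /chi ltNge ltW.
  rewrite (@ri_eq _ d b chi (fun=> 0)); last first.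
    by move=> x /andP[dx _]; rewrite /chi (leNgt x) dx andbF.
  rewrite !ri_zero add0r addr0; apply: ri_eq => x /andP[cx xd].
  by rewrite /chi cx ltW.
move/cvgrPdist_le : cv => /(_ _ r0)[n _ hn].
exists (e_ n); split=> //.
- suff : e_ n < b - d by lra.
  by apply: (lt_le_trans (e_lt n)); rewrite ge_min lexx.
- by apply: (lt_le_trans (e_lt n)); rewrite ge_min lexx orbT.
- by rewrite distrC; exact: (hn n (leqnn n)).
Qed.


Definition dstep : R -> R := derive1 step.

Lemma step_class : smooth_class (@step R).
Proof.
have := @step_smooth R 1 0.
by under eq_fun do rewrite mul1r addr0.
Qed.

Lemma is_derive_step x : is_derive x 1 step (dstep x).
Proof.
have [f' _ df] := smooth_class_derive step_class.
by rewrite /dstep derive1E; apply: DeriveDef.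
Qed.

Lemma dstep_cont : continuous dstep.
Proof.
have [f' sf df] := smooth_class_derive step_class.
have -> : dstep = f' by apply/funext => x; rewrite /dstep derive1E; exact: derive_val.
exact: smooth_cont.
Qed.

Lemma dstep_out x : x < 0 \/ 1 < x -> dstep x = 0.
Proof.
move=> H; rewrite /dstep derive1E.
have -> : 'D_1 step x = 'D_1 (fun=> step x : R) x; last exact: derive_cst.
apply: near_eq_derive; case: H => xH.
  near=> y; rewrite !step_le0//; first exact: ltW.
  by apply: ltW; near: y; exact: lt_nbhsl.
near=> y; rewrite !step_ge1//; first exact: ltW.
by apply: ltW; near: y; exact: lt_nbhsr.
Unshelve. all: by end_near. Qed.

Lemma is_derive_step_aff (s t x : R) :
  is_derive x 1 (fun x => step (s * x + t)) (s * dstep (s * x + t)).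
Proof.
have h : is_derive x 1 (fun x : R => s * x + t) s.
  by apply: is_derive_eq; rewrite /GRing.scale /=; ring.
have h1 := @is_derive1_comp R step (fun x => s * x + t) x _ _ (is_derive_step _) h.
by apply: (is_derive_eq h1); rewrite mulrC.
Qed.

Lemma dstep_aff_cont (s t : R) : continuous (fun x => s * dstep (s * x + t)).
Proof.
move=> x; apply: cvgM; first exact: cvg_cst.
apply: (@continuous_comp _ _ _ (fun x : R => s * x + t) dstep); last exact: dstep_cont.
by apply: cvgD; [apply: cvgM; [exact: cvg_cst|exact: cvg_id]|exact: cvg_cst].
Qed.

Lemma derive_plateau c d e x : derive1 (plateau c d e) x =
  e^-1 * dstep (e^-1 * x + - (e^-1 * c)) - e^-1 * dstep (e^-1 * x + - (e^-1 * d)).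
Proof.
rewrite derive1E; apply: derive_val.
apply: is_derive_eq.
  apply: is_deriveD; first exact: is_derive_step_aff.
  apply: is_deriveM; exact: is_derive_step_aff.
by rewrite /GRing.scale /=; ring.
Qed.

Lemma ri_derive c d (F f : R -> R) : c <= d ->
  continuous F -> continuous f -> (forall x, c < x < d -> is_derive x 1 F (f x)) ->
  ri c d f = F d - F c.
Proof.
rewrite le_eqVlt => /predU1P[<- _ _ _|cd cF cf df]; first by rewrite ri_nil subrr.
have := @continuous_FTC2 R f F c d cd (continuous_subspaceT cf).
move=> H.
have {}H : (\int[mu]_(x in `[c, d]) (f x)%:E = (F d)%:E - (F c)%:E)%E.
  apply: H; last first.
    move=> x; rewrite in_itv /= => xcd; rewrite derive1E.
    exact: (@derive_val _ _ _ _ _ _ _ (df x xcd)).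
  split.
  - move=> x; rewrite in_itv /= => xcd; exact: (@ex_derive _ _ _ _ _ _ _ (df x xcd)).
  - by apply: cvg_at_right_filter; exact: cF.
  - by apply: cvg_at_left_filter; exact: cF.
have E : ri c d f = \int[mu]_(x in `[c, d]) f x.
  rewrite /ri Rintegral_itv_bndo_bndc; last exact: rint_cont.
  rewrite Rintegral_itv_obnd_cbnd//.
  by apply: (@integrableS _ _ _ mu `[c, d]) => //;
    [exact: subset_itv_oc_cc|apply: continuous_compact_integrable => //;
      [exact: segment_compact|exact: continuous_subspaceT]].
by rewrite E /Rintegral H.
Qed.

(** The scaled derivative of [step] is an approximate identity at [c], supported on the
    right of [c]. *)
Lemma mollify a b c g : a < c -> c < b -> continuous g ->
  forall r : R, 0 < r -> exists2 e0 : R, 0 < e0 & forall e, 0 < e -> e < e0 ->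
  `|ri a b (fun x => g x * (e^-1 * dstep (e^-1 * x + - (e^-1 * c)))) - g c| <= r.
Proof.
move=> ac cb cg r r0.
have [K K0 hK] := cont_bounded 0 1 dstep_cont.
have K1 : 0 < K + 1 by rewrite ltr_wpDl.
have r1 : 0 < r / (K + 1) by rewrite divr_gt0.
have /cvgrPdist_le /(_ _ r1) [e1 /= e10 he1] := cg c.
exists (Num.min e1 (b - c)); first by rewrite lt_min e10 subr_gt0.
move=> e e0; rewrite lt_min => /andP[ee1 eb].
pose k x := e^-1 * dstep (e^-1 * x + - (e^-1 * c)).
have ck : continuous k by exact: dstep_aff_cont.
have ei0 : 0 < e^-1 by rewrite invr_gt0.
have eie : e^-1 * e = 1 by rewrite mulVf// gt_eqF.
have k0 x : x < c \/ c + e < x -> k x = 0.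
  move=> H; rewrite /k dstep_out ?mulr0// -mulrBr; case: H => H; [left|right].
    by rewrite pmulr_rlt0// subr_lt0.
  by rewrite -{1}eie ltr_pM2l//; lra.
have cM f1 f2 : continuous f1 -> continuous f2 -> continuous (fun x => f1 x * f2 x : R).
  by move=> c1 c2 x; apply: cvgM; [exact: c1|exact: c2].
have E : ri a b (fun x => g x * k x) = ri c (c + e) (fun x => g x * k x).
  have H : rint a b (fun x => g x * k x) by exact/rint_cont/cM.
  rewrite (ri_chasles (ltW ac) (ltW cb))//.
  rewrite [X in _ + X](@ri_chasles _ _ (c + e)); [|lra|lra|by apply: (rint_sub (ltW ac) (lexx b) H)].
  rewrite (@ri_eq _ a c _ (fun=> 0)); last by move=> x /andP[_ xc]; rewrite k0 ?mulr0//; left.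
  rewrite (@ri_eq _ (c + e) b _ (fun=> 0)); last by move=> x /andP[xc _]; rewrite k0 ?mulr0//; right.
  by rewrite !ri_zero add0r addr0.
have ce : c <= c + e by lra.
have I1 : ri c (c + e) k = 1.
  have -> : ri c (c + e) k = step (e^-1 * (c + e) + - (e^-1 * c)) - step (e^-1 * c + - (e^-1 * c)).
    apply: (@ri_derive c (c + e) (fun x => step (e^-1 * x + - (e^-1 * c))) k) => //.
      by apply: smooth_cont; exact: step_smooth.
    by move=> x _; exact: is_derive_step_aff.
  rewrite subrr (@step_le0 _ 0)// subr0 mulrDr addrAC subrr add0r eie.
  by rewrite step_ge1.
rewrite -/(k _) E -[X in _ - X]mulr1 -I1 -riZ; last exact: rint_cont.
rewrite -riB; [|exact/rint_cont/cM|by apply: rintZ; exact: rint_cont].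
have -> : r = ri c (c + e) (fun=> r * e^-1).
  by rewrite ri_cst// -mulrA [c + e]addrC addrK eie mulr1.
apply: ri_abs_le.
- apply: rintB; [exact/rint_cont/cM|by apply: rintZ; exact: rint_cont].
- exact: rint_cst.
move=> x /andP[cx xe].
rewrite -mulrBl normrM.
have h1 : `|g x - g c| <= r / (K + 1).
  rewrite distrC; apply: he1; rewrite /ball_ /= distrC ger0_norm; lra.
have h2 : `|k x| <= e^-1 * (K + 1).
  rewrite /k normrM (gtr0_norm ei0) ler_pM2l//.
  apply: (@le_trans _ _ K); last by lra.
  apply: hK; rewrite -mulrBr; apply/andP; split.
    by rewrite mulr_ge0 ?ltW ?subr_gt0.
  by rewrite -eie ler_pM2l//; lra.
apply: (le_trans (ler_pM (normr_ge0 _) (normr_ge0 _) h1 h2)).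
by rewrite le_eqVlt; apply/orP; left; apply/eqP; field; rewrite !gt_eqF.
Qed.

(** Testing against plateaus recovers increments: the derivative of a plateau
    concentrates at its two edges. *)
Lemma weak_increment a b c d g h : a < c -> c < d -> d < b ->
  continuous g -> rint a b h ->
  (forall phi, test_function a b phi ->
     ri a b (fun x => g x * derive1 phi x) = - ri a b (fun x => h x * phi x)) ->
  g d - g c = ri c d h.
Proof.
move=> ac cd db cg ih H; apply/eqP; rewrite -subr_eq0 -normr_le0; apply/ler_addgt0Pr => r r0.
have r3 : 0 < r / 3 by rewrite divr_gt0.
have [e1 e10 h1] := mollify ac (lt_trans cd db) cg r3.
have [e2 e20 h2] := mollify (lt_trans ac cd) db cg r3.
have m0 : 0 < Num.min (r / 3) (Num.min e1 e2) by rewrite !lt_min r3 e10 e20.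
have [e [e0 db' + hp]] := ri_plateau ac cd db ih m0.
rewrite !lt_min => /and3P[er ee1 ee2].
have {}hp : `|ri a b (fun x => h x * plateau c d e x) - ri c d h| <= r / 3.
  by apply: (le_trans hp); rewrite ge_min lexx.
have := H _ (plateau_test e0 ac (ltW cd) db').
have -> : ri a b (fun x => g x * derive1 (plateau c d e) x) =
   ri a b (fun x => g x * (e^-1 * dstep (e^-1 * x + - (e^-1 * c)))) -
   ri a b (fun x => g x * (e^-1 * dstep (e^-1 * x + - (e^-1 * d)))).
  have I t : rint a b (fun x => g x * (e^-1 * dstep (e^-1 * x + - (e^-1 * t)))).
    apply: rint_cont => x; apply: cvgM; first exact: cg.
    exact: dstep_aff_cont.
  by rewrite -riB//; apply: ri_eq => x _; rewrite derive_plateau mulrBr.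
move: (h1 _ e0 ee1) (h2 _ e0 ee2) hp; rewrite add0r !ler_norml.
move: (ri a b _) (ri a b _) (ri a b _) (ri c d h) => A B C D; lra.
Qed.

(** By Lebesgue's theorem [h] is almost everywhere the derivative of its indefinite
    integral, which is constant on the interval. *)
Lemma ae0_of_ri0 a b h : rint a b h ->
  (forall c d, a < c -> c < d -> d < b -> ri c d h = 0) ->
  {ae mu, forall x, x \in `]a, b[ -> h x = 0}.
Proof.
move=> ih H; pose f := h \_ `]a, b[.
have intT : mu.-integrable setT (EFin \o f).
  rewrite /f -restrict_EFin; by apply/(integrable_mkcond _ (meas_oo a b)).
have intf y : mu.-integrable [set` `]-oo, y]] (EFin \o f).
  by apply: integrableS intT.
have lf : locally_integrable [set: R] f by exact: integrable_locally.
have := FTC1Ny intf lf; apply: aeS => x [_].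
set F := fun x : R => _ => dF xab.
have <- : f x = h x by rewrite /f patchE mem_set.
move: xab; rewrite in_itv /= -dF derive1E => /andP[ax xb].
rewrite (near_eq_derive (g := fun=> F x : R)) ?derive_cst//.
have FE s t : a < s -> s < t -> t < b -> F s = F t.
  move=> as_ st tb; apply/eqP; rewrite eq_sym -subr_eq0 /F.
  have -> : \int[mu]_(z in `]-oo, t]) f z = \int[mu]_(z in `]-oo, t[) f z.
    rewrite Rintegral_itv_bndo_bndc//.
    by apply: integrableS intT.
  rewrite Rintegral_itvB ?bnd_simp//; last by apply: integrableS intT.
  rewrite -[X in X == _]/(ri s t f) -(H s t as_ st tb); apply/eqP; apply: ri_eq => z /andP[sz zt].
  by rewrite /f patchE mem_set//= in_itv /= (lt_trans as_ sz) (lt_trans zt tb).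
near=> y.
have ay : a < y by near: y; exact: lt_nbhsr.
have yb : y < b by near: y; exact: lt_nbhsl.
by have [xy|yx|->//] := ltgtP x y; [rewrite -(FE x y)|rewrite (FE y x)].
Unshelve. all: by end_near. Qed.

End WeakDerivative.


Section WeakDerivativeC.
Context {R : realType}.
Implicit Types (f h phi : R -> R) (a b c d e x : R) (u v w g : R -> R[i]).
Local Notation mu := (@lebesgue_measure R).
Local Notation RE := complex.Re.
Local Notation IM := complex.Im.

(** Both sides are continuous up to the end points, so that a formula on inner
    intervals extends to the closed one. *)
Lemma increment_closed a b (g : R -> R) h : a < b -> continuous g -> rint a b h ->
  (forall c d, a < c -> c < d -> d < b -> g d - g c = ri c d h) ->
  forall c d, a <= c -> c <= d -> d <= b -> g d - g c = ri c d h.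
Proof.
move=> ab cg ih H; pose f := h \_ `]a, b[.
have intT : mu.-integrable setT (EFin \o f).
  rewrite /f -restrict_EFin; by apply/(integrable_mkcond _ (meas_oo a b)).
pose F x := parameterized_integral mu (a - 1) x f.
have Fdiff c d : a <= c -> c <= d -> d <= b -> F d - F c = ri c d h.
  rewrite le_eqVlt => ac; rewrite le_eqVlt => /predU1P[<- _|cd db].
    by rewrite subrr ri_nil.
  have ac' : a <= c by rewrite le_eqVlt.
  rewrite /F /parameterized_integral Rintegral_itvB ?bnd_simp//; last 3 first.
  - by apply: integrableS intT.
  - by lra.
  - exact: ltW.
  rewrite -Rintegral_itv_bndo_bndc; last by apply: integrableS intT.
  apply: ri_eq => z /andP[cz zd].
  by rewrite /f patchE mem_set//= in_itv /= (le_lt_trans ac' cz) (lt_le_trans zd db).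
have cF x : a <= x <= b -> {for x, continuous F}.
  move=> /andP[ax xb].
  have ab1 : a - 1 <= b + 1 by lra.
  have := @parameterized_integral_continuous R (a - 1) (b + 1) f ab1.
  move=> /(_ _)/within_continuous_continuous; apply.
  - by lra.
  - by apply: integrableS intT.
  by rewrite in_itv /=; apply/andP; split; lra.
pose Phi x := F x - g x.
have cPhi x : a <= x <= b -> {for x, continuous Phi}.
  by move=> xab; apply: cvgB; [exact: cF|exact: cg].
pose m := (a + b) / 2.
have PhiE x : a < x < b -> Phi x = Phi m.
  move=> /andP[ax xb]; rewrite /Phi.
  have am : a < m by rewrite /m; lra.
  have mb : m < b by rewrite /m; lra.
  have [xm|mx|->//] := ltgtP x m.
    by have := H _ _ ax xm mb; rewrite -Fdiff ?ltW//; lra.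
  by have := H _ _ am mx xb; rewrite -Fdiff ?ltW//; lra.
have PhiA x : a <= x <= b -> Phi x = Phi m.
  move=> xab; apply/eqP; rewrite -subr_eq0 -normr_le0; apply/ler_addgt0Pr => r r0.
  have /cvgrPdist_le/(_ _ r0)[e /= e0 he] := cPhi x xab.
  rewrite add0r.
  have [y yab yx] : exists2 y : R, a < y < b & `|x - y| < e.
    have [xm|mx] := leP x m.
      exists (x + Num.min (e / 2) ((b - a) / 4)).
        have : Num.min (e / 2) ((b - a) / 4) <= (b - a) / 4 by rewrite ge_min lexx orbT.
        have : 0 < Num.min (e / 2) ((b - a) / 4) by rewrite lt_min !divr_gt0// subr_gt0.
        by move: xab xm; rewrite /m; lra.
      rewrite opprD addrA subrr add0r normrN gtr0_norm.
        by rewrite gt_min; apply/orP; left; lra.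
      by rewrite lt_min !divr_gt0// subr_gt0.
    exists (x - Num.min (e / 2) ((b - a) / 4)).
      have : Num.min (e / 2) ((b - a) / 4) <= (b - a) / 4 by rewrite ge_min lexx orbT.
      have : 0 < Num.min (e / 2) ((b - a) / 4) by rewrite lt_min !divr_gt0// subr_gt0.
      by move: xab mx; rewrite /m; lra.
    rewrite opprB addrC subrK gtr0_norm.
      by rewrite gt_min; apply/orP; left; lra.
    by rewrite lt_min !divr_gt0// subr_gt0.
  by rewrite -(PhiE y yab); apply: he.
move=> c d ac cd db; rewrite -Fdiff//.
have := PhiA c; have := PhiA d; rewrite /Phi ac db (le_trans ac cd) (le_trans cd db) /=.
by move=> /(_ erefl) h1 /(_ erefl) h2; lra.
Qed.

Lemma wd_test a b k u g phi : is_wderiv a b k u g -> test_function a b phi ->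
  cintg a b (fun x => u x * (derive1n k phi x)%:C) /\
  cintg a b (fun x => g x * (phi x)%:C).
Proof.
move=> [hu hg _] tphi.
have cr f : continuous f -> ccont (fun x => (f x)%:C).
  by move=> cf; split => //= x; exact: cvg_cst.
have ck : continuous (derive1n k phi).
  move=> x; apply: differentiable_continuous; apply/derivable1_diffP.
  by case: tphi => h _; exact: h.
split; apply: L2M_intg => //; apply: L2_ccont; apply: cr => //.
exact: test_cont tphi.
Qed.

Lemma cReMr (z : R[i]) (r : R) : RE (z * r%:C) = RE z * r.
Proof. by rewrite cReM /= mulr0 subr0. Qed.
Lemma cImMr (z : R[i]) (r : R) : IM (z * r%:C) = IM z * r.
Proof. by rewrite cImM /= mulr0 add0r. Qed.

(** The hypothesis makes [u] a weak derivative of the constant [0], so [weak_increment] makes all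
    integrals of [u] over inner intervals vanish. *)
Lemma test_ae0 a b u : L2 a b u ->
  (forall phi, test_function a b phi -> cint a b (fun x => u x * (phi x)%:C) = 0) ->
  ae_eq_on a b u (fun=> 0).
Proof.
move=> hu H; have [i1 i2] := L2_intg hu.
have key f : rint a b f ->
    (forall phi, test_function a b phi -> ri a b (fun x => f x * phi x) = 0) ->
    {ae mu, forall x, x \in `]a, b[ -> f x = 0}.
  move=> fi Hf; apply: ae0_of_ri0 => // c d ac cd db.
  have := @weak_increment R a b c d (fun=> 0) f ac cd db.
  rewrite subrr => -> //; first by move=> x; exact: cvg_cst.
  move=> phi /Hf ->; rewrite oppr0 -[RHS](ri_zero a b).
  by apply: ri_eq => x _; rewrite mul0r.
have h1 : {ae mu, forall x, x \in `]a, b[ -> RE (u x) = 0}.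
  apply: key => // phi /H /(congr1 (@complex.Re R)); rewrite Re_cint cRe0 => <-.
  by apply: ri_eq => x _; rewrite cReMr.
have h2 : {ae mu, forall x, x \in `]a, b[ -> IM (u x) = 0}.
  apply: key => // phi /H /(congr1 (@complex.Im R)); rewrite Im_cint cIm0 => <-.
  by apply: ri_eq => x _; rewrite cImMr.
by apply: aeS2 h1 h2 => x h1 h2 xab; apply: complex_ext; [exact: h1|exact: h2].
Qed.

Lemma wderiv_uniq a b k u g g' : is_wderiv a b k u g -> is_wderiv a b k u g' ->
  ae_eq_on a b g g'.
Proof.
move=> w1 w2; case: (w1) (w2) => _ hg e1 [_ hg' e2].
have : ae_eq_on a b (fun x => g x - g' x) (fun=> 0).
  apply: test_ae0; first exact: L2B.
  move=> phi tp; have [_ i1] := wd_test w1 tp; have [_ i2] := wd_test w2 tp.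
  transitivity (cint a b (fun x => g x * (phi x)%:C) - cint a b (fun x => g' x * (phi x)%:C)).
    by rewrite -cintB//; apply: cint_eq => x _; rewrite mulrBl.
  have s0 : (-1) ^+ k != 0 :> R[i] by rewrite signr_eq0.
  by apply/eqP; rewrite subr_eq0; apply/eqP/(mulfI s0); rewrite -e1// -e2.
by apply: aeS => x h /h /eqP; rewrite subr_eq0 => /eqP.
Qed.

Lemma wderiv_ae a b k u u' g g' : L2 a b u' -> L2 a b g' ->
  ae_eq_on a b u u' -> ae_eq_on a b g g' -> is_wderiv a b k u g -> is_wderiv a b k u' g'.
Proof.
move=> hu' hg' uu' gg' [hu hg e]; split=> // phi tp.
have J v v' (f : R -> R) : ae_eq_on a b v v' ->
    cint a b (fun x => v' x * (f x)%:C) = cint a b (fun x => v x * (f x)%:C).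
  by move=> vv'; apply: cint_ae; apply: aeS vv' => x h /h ->.
by rewrite (J _ _ _ uu') (J _ _ _ gg') e.
Qed.

Lemma wderivD a b k u u' g g' : is_wderiv a b k u g -> is_wderiv a b k u' g' ->
  is_wderiv a b k (fun x => u x + u' x) (fun x => g x + g' x).
Proof.
move=> w1 w2; case: (w1) (w2) => hu hg e1 [hu' hg' e2]; split; try exact: L2D.
move=> phi tp; have [i1 i2] := wd_test w1 tp; have [i1' i2'] := wd_test w2 tp.
have -> : cint a b (fun x => (u x + u' x) * (derive1n k phi x)%:C) =
   cint a b (fun x => u x * (derive1n k phi x)%:C) + cint a b (fun x => u' x * (derive1n k phi x)%:C).
  by rewrite -cintD//; apply: cint_eq => x _; rewrite mulrDl.
rewrite e1// e2// -mulrDr; congr (_ * _).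
by rewrite -cintD//; apply: cint_eq => x _; rewrite mulrDl.
Qed.

Lemma wderivZ a b k z u g : is_wderiv a b k u g ->
  is_wderiv a b k (fun x => z * u x) (fun x => z * g x).
Proof.
move=> w1; case: (w1) => hu hg e1; split; try exact: L2Z.
move=> phi tp; have [i1 i2] := wd_test w1 tp.
have -> : cint a b (fun x => z * u x * (derive1n k phi x)%:C) =
   z * cint a b (fun x => u x * (derive1n k phi x)%:C).
  by rewrite -cintZ//; apply: cint_eq => x _; rewrite mulrA.
rewrite e1// mulrCA; congr (_ * _).
by rewrite -cintZ//; apply: cint_eq => x _; rewrite mulrA.
Qed.

Lemma wderivB a b k u u' g g' : is_wderiv a b k u g -> is_wderiv a b k u' g' ->
  is_wderiv a b k (fun x => u x - u' x) (fun x => g x - g' x).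
Proof.
move=> w1 /(wderivZ (-1)) w2; have := wderivD w1 w2.
by under eq_fun do rewrite mulN1r; under [X in is_wderiv _ _ _ _ X]eq_fun do rewrite mulN1r.
Qed.

(** Absolutely continuous functions with square integrable derivative, in
    integrated form. *)
Definition H1 a b u u' := [/\ ccont u, L2 a b u' &
  forall c d, a <= c -> c <= d -> d <= b -> u d - u c = cint c d u'].

(** The weak derivatives of order [k] and [k + 1] of [u] are weakly derivative of one
    another: test the derivative of order [k] against a differentiated test function. *)
Lemma wderiv_H1 a b k u g g' : a < b -> is_wderiv a b k u g -> is_wderiv a b k.+1 u g' ->
  ccont g -> H1 a b g g'.
Proof.
move=> ab w1 w2 cg; case: (w1) (w2) => hu hg e1 [_ hg' e2]; split=> // c d ac cd db.
have [ig1 ig2] := L2_intg hg'.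
have key phi : test_function a b phi ->
    cint a b (fun x => g x * (derive1 phi x)%:C) = - cint a b (fun x => g' x * (phi x)%:C).
  move=> tp; have tp' := test_derive tp.
  have s0 : (-1) ^+ k != 0 :> R[i] by rewrite signr_eq0.
  apply: (mulfI s0); rewrite -e1//.
  have -> : derive1n k (derive1 phi) = derive1n k.+1 phi by rewrite /derive1n iterSr.
  by rewrite e2// exprSr -mulrA mulN1r.
case: cg => cg1 cg2.
apply: complex_ext; rewrite ?(cReB, cImB) ?(Re_cint, Im_cint).
  apply: (@increment_closed a b (fun x => RE (g x)) _ ab) => // c' d' ac' cd' db'.
  apply: (@weak_increment R a b c' d' (fun x => RE (g x)) _ ac' cd' db') => // phi tp.
  have /(congr1 (@complex.Re R)) := key phi tp; rewrite cReN !Re_cint => E.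
  transitivity (ri a b (fun x => RE (g x * (derive1 phi x)%:C))).
    by apply: ri_eq => x _; rewrite cReMr.
  by rewrite E; congr (- _); apply: ri_eq => x _; rewrite cReMr.
apply: (@increment_closed a b (fun x => IM (g x)) _ ab) => // c' d' ac' cd' db'.
apply: (@weak_increment R a b c' d' (fun x => IM (g x)) _ ac' cd' db') => // phi tp.
have /(congr1 (@complex.Im R)) := key phi tp; rewrite cImN !Im_cint => E.
transitivity (ri a b (fun x => IM (g x * (derive1 phi x)%:C))).
  by apply: ri_eq => x _; rewrite cImMr.
by rewrite E; congr (- _); apply: ri_eq => x _; rewrite cImMr.
Qed.

End WeakDerivativeC.

(** * Calculus of absolutely continuous functions *)

Section ProductRule.
Context {R : realType}.
Implicit Types (f q : R -> R) (a b c d e x : R).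

Definition incr a b f f' := forall c d, a <= c -> c <= d -> d <= b -> f d - f c = ri c d f'.

Lemma incr_is_derive a b f f' x : continuous f' -> incr a b f f' -> a < x < b ->
  is_derive x 1 f (f' x).
Proof.
move=> cf' H /andP[ax xb]; apply: is_derive_eps => e e0.
have /cvgrPdist_le /(_ _ e0) [r1 /= r10 hr] := cf' x.
exists (Num.min r1 (Num.min (x - a) (b - x))).
  by rewrite !lt_min r10 !subr_gt0 ax xb.
have key c d : a <= c -> c <= d -> d <= b -> (forall s, c < s < d -> `|x - s| < r1) ->
    `|f d - f c - (d - c) * f' x| <= e * (d - c).
  move=> ac cd db hs; rewrite H//.
  have -> : (d - c) * f' x = ri c d (fun=> f' x) by rewrite ri_cst// mulrC.
  rewrite -riB; [|exact: rint_cont|exact: rint_cst].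
  rewrite -ri_cst//; apply: ri_abs_le.
  - by apply: rintB; [exact: rint_cont|exact: rint_cst].
  - exact: rint_cst.
  - by move=> s scd; rewrite distrC; apply: hr; exact: hs.
move=> y; rewrite !lt_min => /and3P[y1 y2 y3].
have [xy|yx] := leP x y.
  rewrite ger0_norm ?subr_ge0// in y1 y2 y3 *.
  apply: key => //; [lra|lra|move=> s /andP[xs sy]].
  by rewrite distrC ger0_norm; lra.
rewrite ltr0_norm ?subr_lt0// in y1 y2 y3 *.
have := @key y x; rewrite (ltW yx) => /(_ _ _ _ _).
have -> : f x - f y - (x - y) * f' x = - (f y - f x - (y - x) * f' x) by ring.
rewrite normrN opprB; apply; [lra|by []|lra|move=> s /andP[xs sy]].
by rewrite ger0_norm; lra.
Qed.

Lemma geometric_eq0 (r K : R) : (forall k, `|r| <= (2^-1) ^+ k * K) -> r = 0.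
Proof.
move=> H; apply/eqP; rewrite -normr_le0 leNgt; apply/negP => r0.
have K0 : 0 < K by have := H 0%N; rewrite expr0 mul1r; exact: lt_le_trans.
pose k := Num.bound (K / `|r|).
have hk : K / `|r| < k%:R.
  by apply: archi_boundP; rewrite divr_ge0// ltW.
have h2 : (k%:R : R) <= 2 ^+ k by rewrite -natrX ler_nat ltnW// ltn_expl.
have := H k; apply/negP; rewrite -ltNge exprVn mulrC ltr_pdivrMr ?exprn_gt0//.
rewrite -ltr_pdivrMl// mulrC; exact: lt_le_trans hk h2.
Qed.

(** The defect of the product formula is additive over adjacent intervals and of
    second order in their length, so repeated halving makes it vanish. *)
Lemma incrM a b f f' q q' (M : R) : continuous f -> continuous q ->
  rint a b f' -> measurable_fun (`]a, b[ : set (measurableTypeR R)) q' ->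
  (forall x, a < x < b -> `|q' x| <= M) -> 0 <= M ->
  incr a b f f' -> incr a b q q' ->
  rint a b (fun x => f' x * q x) /\ rint a b (fun x => f x * q' x) /\
  incr a b (fun x => f x * q x) (fun x => f' x * q x + f x * q' x).
Proof.
move=> cf cq if' mq' bq' M0 Hf Hq.
have [Kf Kf0 hKf] := cont_bounded a b cf.
have [Kq Kq0 hKq] := cont_bounded a b cq.
have iq' : rint a b q'.
  by apply: (@rint_dom _ _ _ _ (fun=> M)) => //; exact: rint_cst.
have i1 : rint a b (fun x => f' x * q x).
  apply: (@rint_dom _ _ _ _ (fun x => Kq * `|f' x|)).
  - by apply: measurable_funM; [exact: rint_meas if'|exact: meas_cont].
  - move=> x /andP[ax xb]; rewrite normrM mulrC ler_wpM2r// hKq//.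
    by rewrite !ltW.
  - by apply: rintZ; exact: rint_abs.
have i2 : rint a b (fun x => f x * q' x).
  apply: (@rint_dom _ _ _ _ (fun x => Kf * M)).
  - by apply: measurable_funM => //; exact: meas_cont.
  - move=> x /andP[ax xb]; rewrite normrM ler_pM// ?hKf ?bq'// ?ax//.
    by rewrite !ltW.
  - exact: rint_cst.
split=> //; split=> //.
pose A c d := ri c d (fun x => `|f' x|).
pose D c d := f d * q d - f c * q c - ri c d (fun x => f' x * q x + f x * q' x).
have i12 := rintD i1 i2.
have sub c d g : a <= c -> d <= b -> rint a b g -> rint c d g.
  by move=> ac db ig; exact: rint_sub ig.
have bound c d : a <= c -> c <= d -> d <= b -> `|D c d| <= 2 * M * (d - c) * A c d.
  move=> ac cd db.
  have sf := sub c d _ ac db if'; have sq := sub c d _ ac db iq'.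
  have sA := rint_abs sf.
  have dc : 0 <= d - c by rewrite subr_ge0.
  have A0 : 0 <= A c d by apply: ri_ge0.
  have -> : D c d = ri c d (fun s => f' s * (q d - q s)) + ri c d (fun s => (f c - f s) * q' s).
    have E1 : ri c d (fun s => f' s * (q d - q s)) = q d * (f d - f c) - ri c d (fun s => f' s * q s).
      rewrite Hf// -riZ// -riB; [|exact: rintZ|exact: sub i1].
      by apply: ri_eq => s _; ring.
    have E2 : ri c d (fun s => (f c - f s) * q' s) = f c * (q d - q c) - ri c d (fun s => f s * q' s).
      rewrite Hq// -riZ// -riB; [|exact: rintZ|exact: sub i2].
      by apply: ri_eq => s _; ring.
    rewrite E1 E2 /D riD; [by ring|exact: sub i1|exact: sub i2].
  apply: (le_trans (ler_normD _ _)).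
  have -> : 2 * M * (d - c) * A c d = ri c d (fun s => (M * (d - c)) * `|f' s|) + ri c d (fun s => A c d * M).
    by rewrite (ri_cst _ cd) riZ// /A; ring.
  apply: lerD; apply: ri_abs_le.
  - have : rint c d (fun s => q d * f' s - f' s * q s).
      by apply: rintB; [exact: rintZ|exact: sub i1].
    by apply: rint_eq => s _; ring.
  - exact: rintZ.
  - move=> s /andP[cs sd]; rewrite normrM mulrC ler_wpM2r//.
    rewrite Hq; [|exact: le_trans ac (ltW cs)|exact: ltW|by []].
    apply: (@le_trans _ _ (ri s d (fun=> M))).
      apply: ri_abs_le; [by apply: sub iq' => //; exact: le_trans ac (ltW cs)|exact: rint_cst|].
      by move=> x /andP[sx xd]; apply: bq'; rewrite (le_lt_trans ac (lt_trans cs sx)) (lt_le_trans xd db).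
    by rewrite (ri_cst _ (ltW sd)) ler_wpM2l// lerD2l lerN2 ltW.
  - have : rint c d (fun s => f c * q' s - f s * q' s).
      by apply: rintB; [exact: rintZ|exact: sub i2].
    by apply: rint_eq => s _; ring.
  - exact: rint_cst.
  - move=> s /andP[cs sd]; rewrite normrM ler_pM//; last first.
      by apply: bq'; rewrite (le_lt_trans ac cs) (lt_le_trans sd db).
    rewrite distrC Hf; [|by []|exact: ltW|exact: le_trans (ltW sd) db].
    apply: (le_trans (ri_abs (sub c s _ ac (le_trans (ltW sd) db) if'))).
    by rewrite /A (ri_chasles (ltW cs) (ltW sd) sA) lerDl; apply: ri_ge0.
have halve k : forall c d, a <= c -> c <= d -> d <= b ->
    `|D c d| <= (2^-1) ^+ k * (2 * M * (d - c) * A c d).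
  elim: k => [|k IH] c d ac cd db; first by rewrite expr0 mul1r bound.
  pose e := (c + d) / 2.
  have ce : c <= e by rewrite /e; lra.
  have ed : e <= d by rewrite /e; lra.
  have -> : D c d = D c e + D e d.
    by rewrite /D (ri_chasles ce ed (sub c d _ ac db i12)); ring.
  apply: (le_trans (ler_normD _ _)).
  apply: (le_trans (lerD (IH c e ac ce (le_trans ed db)) (IH e d (le_trans ac ce) ed db))).
  rewrite /A (ri_chasles ce ed (rint_abs (sub c d _ ac db if'))) -!/(A _ _).
  have -> : e - c = (d - c) / 2 by rewrite /e; field.
  have -> : d - e = (d - c) / 2 by rewrite /e; field.
  by rewrite le_eqVlt; apply/orP; left; apply/eqP; rewrite exprS; field.
move=> c d ac cd db; apply/eqP; rewrite -subr_eq0; apply/eqP.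
by apply: geometric_eq0 => k; exact: (halve k c d ac cd db).
Qed.

End ProductRule.

Section AbsCont.
Context {R : realType} (a b : R).
Implicit Types (u w q : R -> R[i]) (c d x : R).
Local Notation RE := complex.Re.
Local Notation IM := complex.Im.

Definition C1 u u' := [/\ ccont u, ccont u' & forall x, a < x < b -> cder u x (u' x)].

Lemma incr_RI u u' : (forall c d, a <= c -> c <= d -> d <= b -> u d - u c = cint c d u') <->
  incr a b (fun x => RE (u x)) (fun x => RE (u' x)) /\
  incr a b (fun x => IM (u x)) (fun x => IM (u' x)).
Proof.
split=> [H|[H1 H2] c d ac cd db].
  split=> c d ac cd db.
    by have /(congr1 (@complex.Re R)) := H c d ac cd db; rewrite cReB Re_cint.
  by have /(congr1 (@complex.Im R)) := H c d ac cd db; rewrite cImB Im_cint.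
by apply: complex_ext; rewrite ?cReB ?cImB ?Re_cint ?Im_cint; [exact: H1|exact: H2].
Qed.

Lemma C1_H1 u u' : C1 u u' -> H1 a b u u'.
Proof.
move=> [cu [cu1 cu2] du]; split=> //; first exact: L2_ccont.
case: cu => cu3 cu4.
have dab c d x : a <= c -> d <= b -> c < x < d -> a < x < b.
  by move=> ac db /andP[cx xd]; rewrite (le_lt_trans ac cx) (lt_le_trans xd db).
apply/incr_RI; split=> c d ac cd db; apply: esym.
  by apply: (ri_derive cd cu3 cu1) => x /(dab _ _ _ ac db) /du[].
by apply: (ri_derive cd cu4 cu2) => x /(dab _ _ _ ac db) /du[].
Qed.

Lemma H1_C1 u u' : ccont u' -> H1 a b u u' -> C1 u u'.
Proof.
move=> cu' [cu hu' /incr_RI[h1 h2]]; split=> // x xab.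
by case: cu' => c1 c2; split; [apply: incr_is_derive h1 xab|apply: incr_is_derive h2 xab].
Qed.

Lemma C1_cst z : C1 (fun=> z) (fun=> 0).
Proof. by split=> *; [exact: ccont_cst|exact: ccont_cst|exact: cder_cst]. Qed.

Lemma C1D u u' w w' : C1 u u' -> C1 w w' -> C1 (fun x => u x + w x) (fun x => u' x + w' x).
Proof.
by move=> [? ? du] [? ? dw]; split=> *; [exact: ccontD|exact: ccontD|apply: cderD; auto].
Qed.

Lemma C1B u u' w w' : C1 u u' -> C1 w w' -> C1 (fun x => u x - w x) (fun x => u' x - w' x).
Proof.
by move=> [? ? du] [? ? dw]; split=> *; [exact: ccontB|exact: ccontB|apply: cderB; auto].
Qed.

Lemma C1M u u' w w' : C1 u u' -> C1 w w' ->
  C1 (fun x => u x * w x) (fun x => u' x * w x + u x * w' x).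
Proof.
move=> [? ? du] [? ? dw]; split=> *; [exact: ccontM| |apply: cderM; auto].
by apply: ccontD; exact: ccontM.
Qed.

Lemma C1Z z u u' : C1 u u' -> C1 (fun x => z * u x) (fun x => z * u' x).
Proof.
move=> [? ? du]; split=> *; [|  |by apply: cderZ; auto].
  by apply: ccontM => //; exact: ccont_cst.
by apply: ccontM => //; exact: ccont_cst.
Qed.

Lemma C1_conj u u' : C1 u u' -> C1 (fun x => conjc (u x)) (fun x => conjc (u' x)).
Proof.
by move=> [? ? du]; split=> *; [exact: ccont_conj|exact: ccont_conj|apply: cder_conj; auto].
Qed.

Lemma C1_sum I (s : seq I) (F F' : I -> R -> R[i]) : (forall i, C1 (F i) (F' i)) ->
  C1 (fun x => \sum_(i <- s) F i x) (fun x => \sum_(i <- s) F' i x).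
Proof.
move=> H; split=> *.
- by apply: ccont_sum => i; case: (H i).
- by apply: ccont_sum => i; case: (H i).
- by apply: cder_sum => i; case: (H i) => _ _; apply.
Qed.

Lemma C1_eit (k d : R) :
  C1 (fun x => eit (k * (x - d))) (fun x => 'i * k%:C * eit (k * (x - d))).
Proof.
split; [exact: ccont_eit| |move=> *; exact: cder_eit].
by apply: ccontM; [exact: ccont_cst|exact: ccont_eit].
Qed.

Lemma H1_L2 u u' : H1 a b u u' -> L2 a b u.
Proof. by case=> cu _ _; exact: L2_ccont. Qed.

Lemma H1D u u' w w' : H1 a b u u' -> H1 a b w w' ->
  H1 a b (fun x => u x + w x) (fun x => u' x + w' x).
Proof.
move=> [cu hu du] [cw hw dw]; split; [exact: ccontD|exact: L2D|move=> c d ac cd db].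
have iu : cintg c d u' by apply: cintg_sub (L2_intg hu).
have iw : cintg c d w' by apply: cintg_sub (L2_intg hw).
by rewrite cintD// -du// -dw//; ring.
Qed.

(** The product rule for real functions, applied to the four products of real and
    imaginary parts. *)
Lemma H1_mulC1 u u' q q' : H1 a b u u' -> C1 q q' ->
  H1 a b (fun x => u x * q x) (fun x => u' x * q x + u x * q' x).
Proof.
move=> [cu hu du] hq; case: (hq) => cq cq' _; case: (C1_H1 hq) => _ _ dq.
split; first exact: ccontM.
  apply: L2D; last by apply: L2_ccont; exact: ccontM.
  by under eq_fun do rewrite mulrC; exact: L2M_ccont.
have [K K0 hK] := ccont_bounded a b cq'.
have bRe x : a < x < b -> `|RE (q' x)| <= K.
  by move=> /andP[ax xb]; apply: (le_trans (Re_le_cmod _)); rewrite hK// !ltW.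
have bIm x : a < x < b -> `|IM (q' x)| <= K.
  by move=> /andP[ax xb]; apply: (le_trans (Im_le_cmod _)); rewrite hK// !ltW.
have /incr_RI[u1 u2] := du; have /incr_RI[q1 q2] := dq.
have [iu1 iu2] := L2_intg hu.
case: cu cq cq' => cu1 cu2 [cq1 cq2] [cq3 cq4].
have m3 := meas_cont (c := a) (d := b) cq3; have m4 := meas_cont (c := a) (d := b) cq4.
have [i1 [i1' e1]] := incrM cu1 cq1 iu1 m3 bRe K0 u1 q1.
have [i2 [i2' e2]] := incrM cu2 cq2 iu2 m4 bIm K0 u2 q2.
have [i3 [i3' e3]] := incrM cu1 cq2 iu1 m4 bIm K0 u1 q2.
have [i4 [i4' e4]] := incrM cu2 cq1 iu2 m3 bRe K0 u2 q1.
apply/incr_RI; split=> c d ac cd db.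
  have s g : rint a b g -> rint c d g by move=> ig; apply: rint_sub ig.
  rewrite !cReM (_ : ri c d _ = ri c d (fun x => RE (u' x) * RE (q x) + RE (u x) * RE (q' x)) -
     ri c d (fun x => IM (u' x) * IM (q x) + IM (u x) * IM (q' x))).
    by rewrite -e1// -e2//; ring.
  rewrite -riB; try by apply: rintD; apply: s.
  by apply: ri_eq => x _; rewrite cReD !cReM; ring.
have s g : rint a b g -> rint c d g by move=> ig; apply: rint_sub ig.
rewrite !cImM (_ : ri c d _ = ri c d (fun x => RE (u' x) * IM (q x) + RE (u x) * IM (q' x)) +
   ri c d (fun x => IM (u' x) * RE (q x) + IM (u x) * RE (q' x))).
  by rewrite -e3// -e4//; ring.
rewrite -riD; try by apply: rintD; apply: s.
by apply: ri_eq => x _; rewrite cImD !cImM; ring.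
Qed.

Lemma H1_wderiv u u' : H1 a b u u' -> is_wderiv a b 1 u u'.
Proof.
move=> hu; case: (hu) => cu hu' _; split=> //; first exact: H1_L2 hu.
move=> phi tp; rewrite expr1 mulN1r.
have cphi : C1 (fun x => (phi x)%:C) (fun x => (derive1 phi x)%:C).
  split.
  - by split=> /=; [exact: test_cont tp|move=> x; exact: cvg_cst].
  - by split=> /=; [exact: test_derive_cont tp|move=> x; exact: cvg_cst].
  - move=> x _; apply: cder_real; case: tp => h _.
    by rewrite derive1E; apply: DeriveDef => //; exact: (h 0%N x).
have [_ _ H] := H1_mulC1 hu cphi.
have [ab|ba] := leP a b; last first.
  have E f : cint a b f = 0.
    by rewrite cintE /ri set_itv_ge ?Rintegral_set0// bnd_simp -leNgt ltW.
  by rewrite !E oppr0.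
have [_ [c [d [ac db out]]]] := tp.
have pa : phi a = 0 by apply: out; rewrite in_itv /= (lt_geF ac).
have pb : phi b = 0 by apply: out; rewrite in_itv /= (lt_geF db) andbF.
have := H a b (lexx a) ab (lexx b); rewrite pa pb !mulr0 subrr.
rewrite cintD; first last.
- by apply: L2M_intg; [exact: H1_L2 hu|apply: L2_ccont; case: cphi].
- by apply: L2M_intg => //; apply: L2_ccont; case: cphi.
by move=> /eqP; rewrite eq_sym addrC addr_eq0 => /eqP.
Qed.

(** One-dimensional Sobolev embedding: [u x] differs from every [u y] by at most the
    integral of [|u'|], and one averages over [y]. *)
Lemma sup_le_H1 u u' x : a < b -> H1 a b u u' -> a <= x <= b ->
  cmod (u x) <= (Num.sqrt (b - a))^-1 * nrm a b u + Num.sqrt (b - a) * nrm a b u'.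
Proof.
move=> ab hu /andP[ax xb]; case: (hu) => cu hu' du.
have L0 : 0 < b - a by rewrite subr_gt0.
set l : R := Num.sqrt (b - a); have l0 : 0 < l by rewrite sqrtr_gt0.
have l2 : l * l = b - a by rewrite -expr2 sqr_sqrtr// ltW.
have n1 : nrm a b (fun=> 1 : R[i]) = l.
  by rewrite /nrm ri_cst ?ltW// cmod1 expr1n mul1r.
have I1 w : L2 a b w -> ri a b (fun s => cmod (w s)) <= l * nrm a b w.
  move=> hw; have hc : L2 a b (fun s => (cmod (w s))%:C).
    apply: (L2_dom _ hw) => [|s _]; last by rewrite cmod_real ger0_norm ?cmod_ge0.
    by split=> //=; exact: (meas_cmod (L2_meas hw)).
  have := cauchy_schwarz_re hc (L2_cst a b 1); rewrite n1 mulrC.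
  have -> : nrm a b (fun s => (cmod (w s))%:C) = nrm a b w.
    by congr Num.sqrt; apply: ri_eq => s _; rewrite cmod_real ger0_norm ?cmod_ge0.
  apply: le_trans; rewrite le_eqVlt; apply/orP; left; apply/eqP.
  rewrite /cip Re_cint; apply: ri_eq => s _.
  by rewrite conjc1 mulr1.
have iu' := L2_intg hu'.
have icu' := cintg_cmod iu'.
have P y : a < y < b -> cmod (u x) <= cmod (u y) + l * nrm a b u'.
  move=> /andP[ay yb].
  have D c d : a <= c -> c <= d -> d <= b -> cmod (u d - u c) <= l * nrm a b u'.
    move=> ac cd db; rewrite du//; apply: (le_trans (cmod_cint (cintg_sub ac db iu'))).
    apply: le_trans (I1 _ hu').
    have ir : rint c b (fun s => cmod (u' s)) by apply: rint_sub icu'.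
    rewrite (ri_chasles ac (le_trans cd db) icu') (ri_chasles cd db ir).
    by rewrite addrCA lerDl addr_ge0//; apply: ri_ge0 => s _; exact: cmod_ge0.
  have -> : u x = u y + (u x - u y) by rewrite addrC subrK.
  apply: (le_trans (cmodD _ _)); rewrite lerD2l.
  have [yx|xy] := leP y x; first by apply: D => //; exact: ltW.
  by rewrite cmod_distC; apply: D => //; exact: ltW.
have hu2 := H1_L2 hu.
have : cmod (u x) * (b - a) <= l * nrm a b u + l * nrm a b u' * (b - a).
  rewrite -(ri_cst (cmod (u x)) (ltW ab)) -(ri_cst (l * nrm a b u') (ltW ab)).
  apply: (@le_trans _ _ (ri a b (fun s => cmod (u s) + l * nrm a b u'))).
    apply: ri_le => //; first exact: rint_cst.
    by apply: rintD; [exact/cintg_cmod/L2_intg|exact: rint_cst].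
  rewrite riD; [|exact/cintg_cmod/L2_intg|exact: rint_cst].
  by rewrite lerD2r; exact: I1.
rewrite -ler_pdivlMr// => /le_trans; apply.
rewrite mulrDl mulfK ?gt_eqF// lerD2r -l2 le_eqVlt; apply/orP; left; apply/eqP.
by field; rewrite gt_eqF.
Qed.

End AbsCont.

(** * Fourier series *)

Section Fourier.
Context {R : realType} (a b : R).
Hypothesis ab : a < b.
Implicit Types (u w g : R -> R[i]) (l m : int) (x y : R).
Local Notation RE := complex.Re.
Local Notation IM := complex.Im.
Local Notation E := (fmode a b).
Local Notation "u ^# l" := (fcoef a b u l) (at level 8, format "u ^# l").

Lemma cReMl (r : R) (z : R[i]) : RE (r%:C * z) = r * RE z.
Proof. by rewrite mulrC cReMr mulrC. Qed.

Lemma ba_gt0 : 0 < b - a. Proof. by rewrite subr_gt0. Qed.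
Lemma ba_neq0 : (b - a)%:C != 0 :> R[i].
Proof. by rewrite -cmod_eq0 cmod_real normr_eq0 gt_eqF ?ba_gt0. Qed.

Lemma fmodeE l x : E l x = eit (mu a b l * (x - a)).
Proof. exact: cexp_i. Qed.

Lemma cmod_fmode l x : cmod (E l x) = 1. Proof. by rewrite fmodeE cmod_eit. Qed.

Lemma fcoefE u l : u^#l = (b - a)^-1%:C * cip a b u (E l).
Proof.
congr (_ * _); apply: cint_eq => x _; congr (_ * _).
by rewrite fmodeE -eitN -cexp_i rcN mulrN.
Qed.

Lemma C1_fmode l : C1 a b (E l) (fun x => 'i * (mu a b l)%:C * E l x).
Proof.
have := C1_eit a b (mu a b l) a.
have -> : (fun x => eit (mu a b l * (x - a))) = E l by apply/funext => x; rewrite fmodeE.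
by under eq_fun do rewrite -fmodeE.
Qed.

Lemma ccont_fmode l : ccont (E l). Proof. by case: (C1_fmode l). Qed.
Lemma L2_fmode l : L2 a b (E l). Proof. exact/L2_ccont/ccont_fmode. Qed.

Lemma fmode_a l : E l a = 1. Proof. by rewrite fmodeE subrr mulr0 eit0. Qed.

Lemma eit2pi : eit (2 * pi) = 1 :> R[i].
Proof. by rewrite /eit mulr_natl cos2pi sin2pi. Qed.

Lemma eit2piz l : eit (2 * pi * l%:~R) = 1 :> R[i].
Proof.
have nat n : eit (2 * pi * n%:R) = 1 :> R[i].
  by rewrite mulrC eitM_nat eit2pi expr1n.
case: l => n; first exact: nat.
by rewrite NegzE mulrNz mulrN eitN nat conjc1.
Qed.

Lemma fmode_b l : E l b = 1.
Proof. by rewrite fmodeE /mu mulfVK ?eit2piz// gt_eqF ?ba_gt0. Qed.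

Lemma muD l m : mu a b (l + m) = mu a b l + mu a b m.
Proof. by rewrite /mu intrD mulrDr mulrDl. Qed.
Lemma muN l : mu a b (- l) = - mu a b l.
Proof. by rewrite /mu mulrNz mulrN mulNr. Qed.

Lemma fmodeD l m x : E (l + m) x = E l x * E m x.
Proof. by rewrite !fmodeE muD mulrDl eitD. Qed.
Lemma fmodeN l x : E (- l) x = conjc (E l x).
Proof. by rewrite !fmodeE muN mulNr eitN. Qed.
Lemma fmode0 x : E 0 x = 1.
Proof. by rewrite fmodeE /mu mulr0z mulr0 mul0r mul0r eit0. Qed.

Lemma mu_eq0 l : (mu a b l == 0) = (l == 0).
Proof.
rewrite /mu mulf_eq0 invr_eq0 (gt_eqF ba_gt0) orbF mulf_eq0 intr_eq0.
by rewrite mulf_eq0 pnatr_eq0 (gt_eqF (pi_gt0 R)).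
Qed.

Lemma H1_periodic u u' : H1 a b u u' -> u a = u b -> cint a b u' = 0.
Proof. by move=> [_ _ H] uab; rewrite -(H a b (lexx a) (ltW ab) (lexx b)) uab subrr. Qed.

Lemma cint_fmode l : cint a b (E l) = if l == 0 then (b - a)%:C else 0.
Proof.
case: eqP => [->|/eqP l0].
  rewrite (@cint_eq _ _ _ _ (fun=> 1)); last by move=> x _; rewrite fmode0.
  by apply: complex_ext; rewrite ?Re_cint ?Im_cint /= ?ri_zero ?(ri_cst _ (ltW ab)) ?mul1r.
have := H1_periodic (C1_H1 (C1_fmode l)).
rewrite fmode_a fmode_b => /(_ erefl); rewrite cintZ; last exact/L2_intg/L2_fmode.
move/eqP; rewrite mulf_eq0 mulf_eq0 => /orP[/orP[]|/eqP//].
  by rewrite -cmod_eq0 cmod_i oner_eq0.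
by rewrite -cmod_eq0 cmod_real normr_eq0 mu_eq0 (negbTE l0).
Qed.

Lemma cip_fmode l m : cip a b (E l) (E m) = if l == m then (b - a)%:C else 0.
Proof.
rewrite -subr_eq0 -cint_fmode; apply: cint_eq => x _.
by rewrite fmodeD fmodeN.
Qed.

(** Integration by parts against the modes; the boundary terms cancel by periodicity. *)
Lemma fcoef_deriv u u' l : H1 a b u u' -> u a = u b ->
  u'^#l = 'i * (mu a b l)%:C * u^#l.
Proof.
move=> hu uab; rewrite !fcoefE mulrCA; congr (_ * _).
have hc := C1_conj (C1_fmode l).
have := H1_periodic (H1_mulC1 hu hc); rewrite fmode_a fmode_b uab => /(_ erefl).
case: (hu) => _ hu' _; have hu2 := H1_L2 hu.
rewrite cintD; first last.
- by apply: L2M_intg => //; apply: L2_ccont; case: hc.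
- by apply: cip_intg => //; exact: L2_fmode.
rewrite -/(cip a b u' (E l)).
have -> : cint a b (fun x => u x * conjc ('i * (mu a b l)%:C * E l x)) =
    - ('i * (mu a b l)%:C * cip a b u (E l)).
  rewrite -mulNr /cip -cintZ; last by apply: cip_intg => //; exact: L2_fmode.
  apply: cint_eq => x _; rewrite !conjM conjc_real.
  have -> : conjc ('i : R[i]) = - 'i by apply: complex_ext; rewrite !ReImE ?oppr0.
  by ring.
by move/eqP; rewrite subr_eq0 => /eqP.
Qed.

Lemma fcoefD u w l : L2 a b u -> L2 a b w ->
  fcoef a b (fun x => u x + w x) l = u^#l + w^#l.
Proof.
by move=> hu hw; rewrite !fcoefE cipDl ?mulrDr//; exact: L2_fmode.
Qed.

Lemma fcoefB u w l : L2 a b u -> L2 a b w ->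
  fcoef a b (fun x => u x - w x) l = u^#l - w^#l.
Proof.
by move=> hu hw; rewrite !fcoefE cipBl ?mulrBr//; exact: L2_fmode.
Qed.

Lemma fcoefZ z u l : L2 a b u -> fcoef a b (fun x => z * u x) l = z * u^#l.
Proof.
by move=> hu; rewrite !fcoefE cipZl//; [rewrite mulrCA|exact: L2_fmode].
Qed.

Lemma fcoef_ae u w l : ae_eq_on a b u w -> u^#l = w^#l.
Proof. by move=> h; congr (_ * _); apply: cint_ae; apply: aeS h => x h /h ->. Qed.

Lemma fcoef_fmode l m : (E l)^#m = (l == m)%:R.
Proof.
rewrite fcoefE cip_fmode; case: eqP => _; last by rewrite mulr0.
by rewrite rcV mulVf// ba_neq0.
Qed.

Definition tsum (s : seq int) (c : int -> R[i]) x := \sum_(l <- s) c l * E l x.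

Lemma L2_tsum s c : L2 a b (tsum s c).
Proof. by apply: L2_sum => l; exact/L2Z/L2_fmode. Qed.

Lemma C1_tsum s c : C1 a b (tsum s c) (tsum s (fun l => 'i * (mu a b l)%:C * c l)).
Proof.
rewrite /tsum; have := @C1_sum R a b int s (fun l x => c l * E l x) _ (fun l => C1Z (c l) (C1_fmode l)).
rewrite (_ : (fun x : R => \sum_(i <- s) c i * ('i * (mu a b i)%:C * E i x)) =
  (fun x => \sum_(l <- s) 'i * (mu a b l)%:C * c l * E l x))//.
by apply/funext => x; apply: eq_bigr => l _; ring.
Qed.

Lemma tsum_periodic s c : tsum s c a = tsum s c b.
Proof. by apply: eq_bigr => l _; rewrite fmode_a fmode_b. Qed.

Lemma fcoef_tsum s c m : uniq s -> (tsum s c)^#m = if m \in s then c m else 0.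
Proof.
move=> us; rewrite fcoefE cip_suml; [|by move=> l; exact/L2Z/L2_fmode|exact: L2_fmode].
have H l : cip a b (fun x => c l * E l x) (E m) = if l == m then c m * (b - a)%:C else 0.
  rewrite cipZl ?cip_fmode; try exact: L2_fmode.
  by case: eqP => [->|_]; rewrite ?mulr0.
under eq_bigr do rewrite H.
case: ifPn => ms.
  rewrite (bigD1_seq m)//= eqxx big1 ?addr0; last by move=> l /negbTE ->.
  by rewrite rcV mulrC mulfK// ba_neq0.
rewrite big_seq big1 ?mulr0// => l ls; case: eqP => // lm.
by rewrite -lm ls in ms.
Qed.

Lemma cip_tsum u s c : L2 a b u ->
  cip a b u (tsum s c) = (b - a)%:C * \sum_(l <- s) conjc (c l) * u^#l.
Proof.
move=> hu; rewrite -cip_conj//; last exact: L2_tsum.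
rewrite cip_suml//; last by move=> l; exact/L2Z/L2_fmode.
rewrite mulr_sumr (big_morph (@conjc R) conjD (conjc0 R)); apply: eq_bigr => l _.
rewrite cipZl//; last exact: L2_fmode.
rewrite conjM cip_conj//; last exact: L2_fmode.
by rewrite fcoefE mulrCA; congr (_ * _); rewrite rcV mulrA mulfV ?mul1r// ba_neq0.
Qed.

Lemma parseval_tsum s c : uniq s ->
  nrm a b (tsum s c) ^+ 2 = (b - a) * \sum_(l <- s) cmod (c l) ^+ 2.
Proof.
move=> us; apply: complexI; rewrite -cip_self; last exact: L2_tsum.
rewrite cip_tsum; last exact: L2_tsum.
rewrite rcM; congr (_ * _); rewrite (big_morph (fun r : R => r%:C) (@rcD R) (erefl 0%:C)).
rewrite !big_seq; apply: eq_bigr => l ls.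
by rewrite fcoef_tsum// ls mulrC mul_conj.
Qed.

Lemma nrm_sub_tsum u s : L2 a b u -> uniq s ->
  nrm a b (fun x => u x - tsum s (fcoef a b u) x) ^+ 2 =
  nrm a b u ^+ 2 - (b - a) * \sum_(l <- s) cmod (u^#l) ^+ 2.
Proof.
move=> hu us; have hT := L2_tsum s (fcoef a b u).
rewrite (sqr_nrmD hu (L2N hT)).
rewrite nrmN parseval_tsum//.
have -> : complex.Re (cip a b u (fun x => - tsum s (fcoef a b u) x)) =
   - ((b - a) * \sum_(l <- s) cmod (u^#l) ^+ 2).
  rewrite -(cip_conj (L2N hT) hu) cRe_conj.
  have -> : cip a b (fun x => - tsum s (fcoef a b u) x) u = - cip a b (tsum s (fcoef a b u)) u.
    rewrite -mulN1r -cipZl//; apply: cint_eq => x _; by rewrite mulN1r.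
  rewrite cReN -(cip_conj hu hT) cRe_conj cip_tsum// cReMl; congr (- (_ * _)).
  rewrite cRe_sum; apply: eq_bigr => l _.
  by rewrite mulrC mul_conj.
by ring.
Qed.

Lemma bessel u s : L2 a b u -> uniq s ->
  (b - a) * \sum_(l <- s) cmod (u^#l) ^+ 2 <= nrm a b u ^+ 2.
Proof. by move=> hu us; rewrite -subr_ge0 -nrm_sub_tsum// sqr_ge0. Qed.

End Fourier.


Arguments cmod : simpl never.
Arguments fmode : simpl never.
Arguments fcoef : simpl never.
Arguments cint : simpl never.

Section FourierConvergence.
Context {R : realType} (a b : R).
Hypothesis ab : a < b.
Implicit Types (u w g : R -> R[i]) (l m : int) (x y : R).
Local Notation RE := complex.Re.
Local Notation IM := complex.Im.
Local Notation mu_ := (@lebesgue_measure R).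
Local Notation E := (fmode a b).
Local Notation "u ^# l" := (fcoef a b u l) (at level 8, format "u ^# l").

Definition freqs (N : nat) : seq int := [seq freq N j | j <- iota 0 N].

Lemma freqs_uniq N : uniq (freqs N).
Proof. by rewrite map_inj_uniq ?iota_uniq// => i j; rewrite /freq => /addIr[]. Qed.

Lemma mem_freqs M l : (l \in freqs M.*2) = (- M%:Z <= l) && (l < M%:Z).
Proof.
apply/mapP/andP => [[j]|[l1 l2]].
  rewrite mem_iota add0n => /andP[_ jM] ->; rewrite /freq doubleK; split; lia.
exists (absz (l + M%:Z)); first by rewrite mem_iota; lia.
by rewrite /freq doubleK; lia.
Qed.

Lemma sum_freqs (F : int -> R[i]) N : \sum_(l <- freqs N) F l = \sum_(j < N) F (freq N j).
Proof. by rewrite big_map -{1}[N]subn0 big_mkord. Qed.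

Lemma PN_tsum N u x : PN a b N u x = tsum a b (freqs N) (fcoef a b u) x.
Proof. by rewrite /PN /tsum sum_freqs. Qed.

(** The Riemann-Lebesgue lemma along distinct frequencies: by Bessel's inequality the
    squares form a convergent series. *)
Lemma fcoef_cvg0 g (k : nat -> int) : L2 a b g -> injective k ->
  cmod (g^#(k n)) @[n --> \oo] --> (0 : R).
Proof.
move=> hg ik; pose c n := cmod (g^#(k n)) ^+ 2.
have bnd n : series c n <= nrm a b g ^+ 2 / (b - a).
  rewrite ler_pdivlMr ?ba_gt0// mulrC.
  have us : uniq (map k (iota 0 n)) by rewrite map_inj_uniq ?iota_uniq.
  have := bessel ab hg us; rewrite big_map /series /= /index_iota subn0.
  exact.
have cv : cvgn (series c).
  apply: nondecreasing_is_cvgn.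
    by apply: nondecreasing_series => n _ _; rewrite exprn_ge0// cmod_ge0.
  by exists (nrm a b g ^+ 2 / (b - a)) => _ [n _ <-].
have c0 := cvg_series_cvg_0 cv.
apply/cvgrPdist_le => e e0.
have e2 : 0 < e ^+ 2 by rewrite exprn_gt0.
move/cvgrPdist_le : c0 => /(_ _ e2); apply: filterS => n.
rewrite !sub0r !normrN !ger0_norm ?exprn_ge0 ?cmod_ge0// ler_sqr ?nnegrE ?cmod_ge0//.
exact: ltW.
Qed.

Lemma cder_eps (f : R -> R[i]) x (l : R[i]) : cder f x l -> forall e : R, 0 < e ->
  exists2 r : R, 0 < r & forall y, `|y - x| < r ->
    cmod (f y - f x - (y - x)%:C * l) <= e * `|y - x|.
Proof.
move=> [d1 d2] e e0; have e2 : 0 < e / 2 by rewrite divr_gt0.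
have [r1 r10 h1] := eps_is_derive d1 e2; have [r2 r20 h2] := eps_is_derive d2 e2.
exists (Num.min r1 r2); first by rewrite lt_min r10 r20.
move=> y; rewrite lt_min => /andP[y1 y2].
apply: (le_trans (cmod_le_ReIm _)); rewrite [e]splitr mulrDl; apply: lerD.
  by rewrite !cReB cReMl; exact: h1.
by rewrite !cImB mulrC cImMr mulrC; exact: h2.
Qed.

Lemma eit1_inj (t : R) : eit t = 1 -> `|t| < 2 * pi -> t = 0.
Proof.
move=> h tp; apply/eqP/negPn/negP => t0.
have c1 : cos `|t| = 1.
  have /(congr1 (@complex.Re R)) /= := h.
  by case: (ger0P t) => _; rewrite ?cosN.
have : 0 < sin (`|t| / 2).
  by apply: sin_gt0_pi; rewrite divr_gt0 ?normr_gt0//= ltr_pdivrMr// mulrC.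
have s2 : sin (`|t| / 2) ^+ 2 = 0.
  have := cos_mulr2n (`|t| / 2).
  have -> : `|t| / 2 *+ 2 = `|t| by rewrite -mulr_natr divfK.
  by have := cos2Dsin2 (`|t| / 2); rewrite c1 -mulr_natr; lra.
by move/eqP : s2; rewrite sqrf_eq0 => /eqP ->; rewrite ltxx.
Qed.

(** Chernoff's proof of pointwise convergence: dividing [u - u x] by
    [E 1 - E 1 x] leaves a bounded function, whose coefficients make the partial
    sums telescope. *)
Lemma fourier_cvg u u' x : C1 a b u u' -> a < x < b ->
  cmod (tsum a b (freqs M.*2) (fcoef a b u) x - u x) @[M --> \oo] --> (0 : R).
Proof.
move=> hu xab; case: (hu) => cu cu' du; have /andP[ax xb] := xab.
pose v y := u y - u x.
have cv : ccont v by apply: ccontB => //; exact: ccont_cst.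
pose w y := E 1 y - E 1 x.
have cw : ccont w by apply: ccontB; [exact: ccont_fmode|exact: ccont_cst].
have w0 y : a <= y <= b -> y != x -> w y != 0.
  move=> /andP[ay yb] yx; apply: contra yx => /eqP; rewrite /w => /eqP; rewrite subr_eq0 => /eqP wE.
  have : eit (mu a b 1 * (y - a) - mu a b 1 * (x - a)) = 1.
    by rewrite eitD -fmodeE wE eitN -fmodeE mul_conj cmod_fmode expr1n.
  rewrite -mulrBr opprB addrA subrK => /eit1_inj.
  rewrite /mu mulr1 normrM normrM normfV (gtr0_norm (ba_gt0 ab)).
  have p2 : 0 < 2 * pi :> R by rewrite mulr_gt0 ?pi_gt0.
  rewrite (gtr0_norm p2) -mulrA gtr_pMr// mulrC ltr_pdivrMr ?ba_gt0// mul1r.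
  have yxb : `|y - x| < b - a by rewrite ltr_norml; lra.
  move=> /(_ yxb) /eqP; rewrite mulf_eq0 subr_eq0 => /orP[|//].
  by rewrite mulf_eq0 invr_eq0 (gt_eqF (ba_gt0 ab)) orbF (gt_eqF p2).
(* [v / w], with the inverse of [|w|^2] written as a real power: this is measurable, and
   vanishes at [x], where [v] does. *)
pose g y := v y * conjc (w y) * ((cmod (w y) ^+ 2) `^ (-1))%:C.
have gE y : a < y < b -> g y * w y = v y.
  move=> /andP[ay yb]; rewrite /g.
  have [->|yx] := eqVneq y x; first by rewrite /v /w !subrr mulr0.
  have wy : w y != 0 by apply: w0 => //; rewrite !ltW.
  rewrite powR_inv1 ?exprn_ge0 ?cmod_ge0// mulrAC -(mulrA (v y)) [conjc _ * _]mulrC mul_conj.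
  by rewrite -mulrA -rcM mulfV ?mulr1// expf_neq0// cmod_eq0.
have hg : L2 a b g.
  have mg : cmeas a b g.
    apply: cmeasM; first by apply: cmeasM; [exact: cmeas_ccont|exact/cmeas_conj/cmeas_ccont].
    have mp := measurableT_comp (@measurable_powR R (-1)) (meas_cmod2 (@cmeas_ccont R a b _ cw)).
    by split; [exact: mp|exact: measurable_cst].
  have m0 : 0 < mu a b 1 by rewrite /mu mulr1 divr_gt0 ?ba_gt0// mulr_gt0 ?pi_gt0.
  have [r1 r10 h1] := cder_eps (du x xab) (@ltr01 R).
  have m2 : 0 < mu a b 1 / 2 by rewrite divr_gt0.
  have [_ _ dE] := C1_fmode a b 1; have [r2 r20 h2] := cder_eps (dE x xab) m2.
  pose r : R := Num.min (Num.min r1 r2) (Num.min (x - a) (b - x)) / 2.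
  have r0 : 0 < r by rewrite divr_gt0// !lt_min r10 r20 !subr_gt0 ax xb.
  have rr : r < Num.min (Num.min r1 r2) (Num.min (x - a) (b - x)).
    by rewrite /r ltr_pdivrMr// ltr_pMr ?ltr1n// -(pmulr_lgt0 _ (_ : 0 < 2^-1))// invr_gt0.
  move: rr; rewrite !lt_min => /andP[/andP[rr1 rr2] /andP[rxa rxb]].
  have [Kv Kv0 hKv] := ccont_bounded a b cv.
  have pos c d : a <= c -> c <= d -> d <= b -> (forall y, c <= y <= d -> y != x) ->
      exists2 k : R, 0 < k & forall y, c <= y <= d -> k <= cmod (w y).
    move=> ac cd db hx.
    have [z zcd hz] := @EVT_min R (fun y => cmod (w y)) c d cd (continuous_subspaceT (ccont_cmod cw)).
    exists (cmod (w z)); last by move=> y ycd; apply: hz; rewrite in_itv.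
    have zcd' : c <= z <= d by move: zcd; rewrite in_itv.
    rewrite cmod_gt0; apply: w0; last exact: hx.
    by case/andP: zcd' => cz zd; rewrite (le_trans ac cz) (le_trans zd db).
  have [k1 k10 hk1] : exists2 k : R, 0 < k & forall y, a <= y <= x - r -> k <= cmod (w y).
    by apply: pos => //; [lra|lra|move=> y /andP[_ yr]; apply/eqP => yx; move: yr; rewrite yx; lra].
  have [k2 k20 hk2] : exists2 k : R, 0 < k & forall y, x + r <= y <= b -> k <= cmod (w y).
    by apply: pos => //; [lra|lra|move=> y /andP[yr _]; apply/eqP => yx; move: yr; rewrite yx; lra].
  pose K := Kv / k1 + Kv / k2 + (1 + cmod (u' x)) / (mu a b 1 / 2).
  have K1 : 0 <= Kv / k1 by rewrite divr_ge0// ltW.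
  have K2 : 0 <= Kv / k2 by rewrite divr_ge0// ltW.
  have K3 : 0 <= (1 + cmod (u' x)) / (mu a b 1 / 2).
    by rewrite divr_ge0 ?addr_ge0 ?cmod_ge0// ltW.
  apply: (L2_bnd mg (K := K)) => y yab; have /andP[ay yb] := yab.
  have [->|yx] := eqVneq y x.
    by rewrite /g /v subrr !mul0r cmod0 /K !addr_ge0.
  have wy : w y != 0 by apply: w0 => //; rewrite !ltW.
  have -> : cmod (g y) = cmod (v y) / cmod (w y).
    by rewrite -(gE y yab) cmodM mulfK// cmod_eq0.
  have far k : 0 < k -> k <= cmod (w y) -> cmod (v y) / cmod (w y) <= Kv / k.
    move=> k0 kw; apply: ler_pM; rewrite ?invr_ge0 ?cmod_ge0//.
      by apply: hKv; rewrite !ltW.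
    by rewrite lef_pV2 ?posrE// (lt_le_trans k0).
  have [yl|yl] := leP y (x - r).
    by apply: le_trans (far k1 k10 _) _; [apply: hk1; rewrite yl ltW|rewrite /K; lra].
  have [yr|yr] := leP (x + r) y.
    by apply: le_trans (far k2 k20 _) _; [apply: hk2; rewrite yr ltW|rewrite /K; lra].
  have yxr : `|y - x| < r by rewrite ltr_norml; lra.
  have n0 : 0 < `|y - x| by rewrite normr_gt0 subr_eq0.
  have b1 : cmod (v y) <= (1 + cmod (u' x)) * `|y - x|.
    have -> : v y = (u y - u x - (y - x)%:C * u' x) + (y - x)%:C * u' x by rewrite subrK.
    rewrite (le_trans (cmodD _ _))// mulrDl lerD//; first by apply: h1; exact: lt_trans rr1.
    by rewrite cmodM cmod_real mulrC.
  have b2 : mu a b 1 / 2 * `|y - x| <= cmod (w y).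
    have := h2 y (lt_trans yxr rr2); rewrite -/(w y) => h.
    have : cmod ((y - x)%:C * ('i * (mu a b 1)%:C * E 1 x)) <=
       cmod (w y) + cmod (w y - (y - x)%:C * ('i * (mu a b 1)%:C * E 1 x)).
      by rewrite -{1}(subKr (w y) (_ * _)) cmodB.
    have -> : cmod ((y - x)%:C * ('i * (mu a b 1)%:C * E 1 x)) = mu a b 1 * `|y - x|.
      by rewrite cmodM cmod_real cmodM cmod_fmode cmodM cmod_i cmod_real (gtr0_norm m0) mulr1 mul1r mulrC.
    by move: h; lra.
  apply: (@le_trans _ _ ((1 + cmod (u' x)) / (mu a b 1 / 2))); last by rewrite /K; lra.
  rewrite ler_pdivrMr ?cmod_gt0// (le_trans b1)//.
  rewrite mulrAC ler_pdivlMr// -mulrA ler_wpM2l ?addr_ge0 ?cmod_ge0//.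
  by rewrite mulrC.
have hE l := L2_fmode a b l.
have hv : L2 a b v by exact: L2_ccont.
have coefv l : v^#l = g^#(l - 1) - E 1 x * g^#l.
  have hgE : L2 a b (fun y => g y * E 1 y).
    by under eq_fun do rewrite mulrC; apply: L2M_ccont => //; exact: ccont_fmode.
  have -> : g^#(l - 1) = fcoef a b (fun y => g y * E 1 y) l.
    rewrite !fcoefE; congr (_ * _); apply: cint_eq => y _.
    rewrite -[in RHS]mulrA; congr (_ * _).
    by rewrite [l - 1]addrC fmodeD fmodeN conjM conjcK.
  rewrite -fcoefZ// -fcoefB//; last exact: L2Z.
  rewrite !fcoefE; congr (_ * _); apply: cint_eq => y yab; congr (_ * _).
  by rewrite -gE// /w; ring.
have coefu l : u^#l = v^#l + u x * (l == 0)%:R.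
  have -> : (l == 0)%:R = (E 0)^#l by rewrite fcoef_fmode// eq_sym.
  rewrite -fcoefZ// -fcoefD//; last exact: L2Z.
  by rewrite !fcoefE; congr (_ * _); apply: cint_eq => y _; rewrite fmode0 mulr1 /v subrK.
(* The coefficients of [v] are differences of consecutive coefficients of [g], so the
   partial sum reduces to its two end terms. *)
have tele M : (0 < M)%N -> tsum a b (freqs M.*2) (fcoef a b u) x - u x =
    g^#(- M%:Z - 1) * E (- M%:Z) x - g^#(M%:Z - 1) * E M%:Z x.
  move=> M0.
  have -> : tsum a b (freqs M.*2) (fcoef a b u) x = tsum a b (freqs M.*2) (fcoef a b v) x + u x.
    rewrite /tsum (eq_bigr (fun l => v^#l * E l x + u x * (l == 0)%:R)); last first.
      move=> l _; rewrite coefu mulrDl; congr (_ + _).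
      by case: eqP => [->|_]; rewrite ?fmode0 ?mulr1// !mulr0 mul0r.
    rewrite big_split /=; congr (_ + _).
    rewrite (bigD1_seq 0) ?freqs_uniq//=; last by rewrite mem_freqs; lia.
    by rewrite mulr1 big1 ?addr0// => l /negbTE ->; rewrite mulr0.
  rewrite addrK /tsum sum_freqs.
  pose F (j : nat) := - (g^#(freq M.*2 j - 1) * E (freq M.*2 j) x).
  rewrite (eq_bigr (fun j : 'I_(M.*2) => F j.+1 - F j)); last first.
    move=> j _; rewrite coefv /F.
    have -> : freq M.*2 j.+1 = freq M.*2 j + 1 by rewrite /freq; lia.
    by rewrite addrK fmodeD; ring.
  rewrite -(big_mkord xpredT (fun j => F j.+1 - F j)) telescope_sumr//.
  rewrite /F /freq doubleK opprK addrC add0r.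
  by have -> : (M.*2)%:Z - M%:Z = M%:Z by lia.
apply: (@squeeze_cvgr _ _ _ _ (fun=> 0) (fun M : nat => cmod (g^#(- M%:Z - 1)) + cmod (g^#(M%:Z - 1)))).
- near=> M; rewrite cmod_ge0 /= tele; last by near: M; exists 1%N.
  have gM l m : cmod (g^#l * E m x) = cmod (g^#l) by rewrite cmodM cmod_fmode mulr1.
  by rewrite -(gM _ (- M%:Z)) -(gM (M%:Z - 1) M%:Z) cmodB.
- exact: cvg_cst.
- rewrite -[X in _ --> X]addr0; apply: cvgD.
    by apply: (fcoef_cvg0 (k := fun M : nat => - M%:Z - 1)) => // i j; lia.
  by apply: (fcoef_cvg0 (k := fun M : nat => M%:Z - 1)) => // i j; lia.
Unshelve. all: by end_near. Qed.

Lemma fatou_ri (f_ : nat -> R -> R) (f : R -> R) (K : R) :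
  (forall n, rint a b (f_ n)) -> rint a b f ->
  (forall n x, a < x < b -> 0 <= f_ n x) ->
  (forall x, a < x < b -> f_ n x @[n --> \oo] --> f x) ->
  (forall n, ri a b (f_ n) <= K) -> ri a b f <= K.
Proof.
move=> if_ if0 pos cv bnd.
have := @fatou _ _ R mu_ `]a, b[ (meas_oo a b) (fun n => EFin \o f_ n).
move=> /(_ (fun n => measurable_int _ (if_ n))).
have pos' : forall (n : nat) x, (`]a, b[%classic : set R) x -> (0 <= (EFin \o f_ n) x)%E.
  by move=> n x; rewrite /= in_itv /= => xab; rewrite lee_fin pos.
move=> /(_ pos').
move=> H0.
have {H0}H : (\int[mu_]_(x in `]a, b[) (f x)%:E <=
    limn_einf (fun n => \int[mu_]_(x in `]a, b[) (f_ n x)%:E))%E.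
  apply: le_trans H0; rewrite le_eqVlt; apply/orP; left; apply/eqP.
  apply: eq_integral => x; rewrite inE /= in_itv /= => xab; apply/esym.
  by apply: (cvg_limn_einf_sup _).1; apply: cvg_EFin; [exact: nearW|exact: cv].
have fin (g : R -> R) : rint a b g -> (\int[mu_]_(x in `]a, b[) (g x)%:E = (ri a b g)%:E)%E.
  by move=> ig; rewrite /ri /Rintegral fineK// (integrable_fin_num (meas_oo a b) ig).
rewrite -lee_fin -fin//; apply: (le_trans H).
rewrite limn_einf_lim; apply: lime_le; first exact: is_cvg_einfs.
apply: nearW => n; apply: (@le_trans _ _ (ri a b (f_ n))%:E); last by rewrite lee_fin.
by rewrite -fin//; apply: ereal_inf_lbound; exists n => /=.
Qed.

(** The remainder is the pointwise limit of the sums over the frequencies left out, to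
    which Fatou's lemma applies; for these frequencies [|mu l| h >= 1], and a factor
    [(|mu l| h)^(2 k)] may be inserted into their Parseval sum. *)
Lemma proj_err w w' (B : R) (k N : nat) : C1 a b w w' -> 0 <= B ->
  (forall s, uniq s -> \sum_(l <- s) (mu a b l ^+ k) ^+ 2 * cmod (w^#l) ^+ 2 <= B ^+ 2) ->
  (0 < N)%N ->
  nrm a b (fun x => w x - tsum a b (freqs N.*2) (fcoef a b w) x) <=
    Num.sqrt (b - a) * B * ((b - a) / (N.*2)%:R) ^+ k.
Proof.
move=> hw B0 hB N0; case: (hw) => cw _ _.
pose h := (b - a) / (N.*2)%:R.
have h0 : 0 < h by rewrite divr_gt0 ?ba_gt0// ltr0n double_gt0.
have L2w : L2 a b w by exact: L2_ccont.
pose c := fcoef a b w.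
pose K := (b - a) * (B ^+ 2 * (h ^+ k) ^+ 2).
have muh l : l \notin freqs N.*2 -> 1 <= `|mu a b l| * h.
  rewrite mem_freqs negb_and -ltNge -leNgt => H.
  have lN : (N <= absz l)%N by lia.
  have -> : `|mu a b l| * h = pi * ((absz l)%:R / N%:R).
    rewrite /mu /h !normrM normfV normr_nat (gtr0_norm (pi_gt0 R)) (gtr0_norm (ba_gt0 ab)).
    rewrite -intr_norm -natr_absz -mul2n natrM.
    have bn := ba_gt0 ab; field.
    by rewrite pnatr_eq0 -lt0n N0 gt_eqF.
  have p1 : 1 <= pi :> R by apply: le_trans (pi_ge2 R); lra.
  have q1 : 1 <= (absz l)%:R / N%:R :> R by rewrite ler_pdivlMr ?ltr0n// mul1r ler_nat.
  by nra.
pose rest M := [seq l <- freqs M.*2 | l \notin freqs N.*2].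
have splitM M x : (N <= M)%N ->
   tsum a b (freqs M.*2) c x = tsum a b (freqs N.*2) c x + tsum a b (rest M) c x.
  move=> NM; rewrite /tsum (bigID (mem (freqs N.*2))) /=; congr (_ + _); last first.
    by rewrite big_filter.
  rewrite -big_filter; apply: perm_big; apply: uniq_perm; rewrite ?filter_uniq ?freqs_uniq//.
  by move=> l; rewrite mem_filter !mem_freqs; lia.
have nrest M : nrm a b (tsum a b (rest M) c) ^+ 2 <= K.
  have us : uniq (rest M) by rewrite filter_uniq ?freqs_uniq.
  rewrite parseval_tsum// /K (ler_pM2l (ba_gt0 ab)).
  apply: (@le_trans _ _ (\sum_(l <- rest M) ((mu a b l ^+ k) ^+ 2 * cmod (c l) ^+ 2) * (h ^+ k) ^+ 2)).
    rewrite big_seq [leRHS]big_seq; apply: ler_sum => l; rewrite mem_filter => /andP[lN _].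
    have := muh l lN => H.
    rewrite mulrAC ler_peMl ?exprn_ge0 ?cmod_ge0//.
    rewrite -!exprMn -real_normK ?num_real// normrX normrM (gtr0_norm h0).
    by rewrite !exprn_ege1.
  rewrite -mulr_suml ler_wpM2r ?exprn_ge0//; first exact: ltW.
  exact: hB.
suff H : nrm a b (fun x => w x - tsum a b (freqs N.*2) c x) ^+ 2 <= K.
  rewrite -ler_sqr ?nnegrE ?nrm_ge0 ?mulr_ge0 ?sqrtr_ge0 ?exprn_ge0//; last first.
    by rewrite divr_ge0 ?ler0n// ltW ?ba_gt0.
  have bn := ltW (ba_gt0 ab).
  by apply: (le_trans H); rewrite -/h /K !exprMn sqr_sqrtr// mulrA.
have L2r : L2 a b (fun x => w x - tsum a b (freqs N.*2) c x).
  by apply: L2B => //; exact: L2_tsum.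
rewrite sqr_nrm.
apply: (@fatou_ri (fun M x => cmod (tsum a b (rest (M + N)%N) c x) ^+ 2)).
- by move=> M; apply: L2_int2; exact: L2_tsum.
- exact: L2_int2.
- by move=> M x _; rewrite exprn_ge0 ?cmod_ge0.
- move=> x xab.
  have cv := fourier_cvg hw xab.
  have cv2 : cmod (tsum a b (rest (M + N)%N) c x) @[M --> \oo] -->
      cmod (w x - tsum a b (freqs N.*2) c x).
    apply/cvgrPdist_le => e e0; move/cvgrPdist_le : cv => /(_ e e0)[M0 _ HM].
    exists M0 => // M MM0.
    have := HM (M + N)%N; rewrite /= => /(_ (leq_trans MM0 (leq_addr _ _))).
    rewrite sub0r normrN ger0_norm ?cmod_ge0// => HM'.
    apply: (le_trans (cmod_dist_le _ _)).
    rewrite (_ : _ - _ = - (tsum a b (freqs (M + N).*2) c x - w x)) ?cmodN//.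
    by rewrite (splitM (M + N)%N)// ?leq_addl//; ring.
  have -> : (fun M : nat => cmod (tsum a b (rest (M + N)%N) c x) ^+ 2) =
     (fun M : nat => cmod (tsum a b (rest (M + N)%N) c x) * cmod (tsum a b (rest (M + N)%N) c x)).
    by apply/funext => M; rewrite expr2.
  by rewrite expr2; apply: cvgM.
- by move=> M; rewrite -sqr_nrm.
Qed.

End FourierConvergence.

(** * Homogeneous functions of a complex variable *)

Section Homogeneous.
Context {R : realType}.
Implicit Types (z w h : R[i]) (q p r s M : R) (m n : nat).
Local Notation RE := complex.Re.
Local Notation IM := complex.Im.

(** In polar coordinates this is [r ^ (2 q + m + n) * exp (i (m - n) theta)]: the
    family is closed under differentiation, which lets one treat the
    nonlinearity and its first two derivatives alike. *)
Definition Phi q m n z : R[i] := ((cmod z ^+ 2) `^ q)%:C * (z ^+ m * conjc z ^+ n).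

Lemma powR_lip p s r M : 1 <= p -> 0 <= s -> 0 <= r -> s <= M -> r <= M ->
  `|r `^ p - s `^ p| <= p * M `^ (p - 1) * `|r - s|.
Proof.
move=> p1; wlog sr : s r / s <= r.
  move=> H s0 r0 sM rM; have [sr|rs] := leP s r; first exact: H.
  by rewrite distrC (distrC r); apply: H => //; exact: ltW.
move=> s0 r0 sM rM.
have p0 : 0 < p by lra.
have M0 : 0 <= M by exact: le_trans sM.
have mono x : 0 <= x -> x <= M -> x `^ (p - 1) <= M `^ (p - 1).
  by move=> x0 xM; apply: ge0_ler_powR => //; rewrite ?nnegrE//; lra.
rewrite ger0_norm; last by rewrite subr_ge0 ge0_ler_powR ?nnegrE// ltW.
rewrite ger0_norm ?subr_ge0//.
move: s0; rewrite le_eqVlt => /predU1P[<-|s0].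
  rewrite powR0 ?gt_eqF// !subr0 -(mulr_powRB1 r0 p0) mulrC ler_wpM2r//.
  apply: le_trans (mono r r0 rM) _; rewrite ler_peMl// powR_ge0//.
have [|| c csr ->] := @MVT_segment R (fun x => x `^ p) (fun x => p * x `^ (p - 1)) s r sr.
- move=> x; rewrite in_itv /= => /andP[sx _]; apply: is_derive1_powR.
  exact: lt_trans sx.
- apply: derivable_within_continuous => x; rewrite in_itv /= => /andP[sx _].
  have hx := @is_derive1_powR R p x (lt_le_trans s0 sx).
  exact: ex_derive.
- rewrite ler_wpM2r ?subr_ge0// (ler_pM2l p0).
  move: csr; rewrite in_itv /= => /andP[sc cr].
  by apply: mono; [exact: le_trans (ltW s0) sc|exact: le_trans rM].
Qed.

Lemma Phi0 q m n : (0 < m + n)%N -> Phi q m n 0 = 0.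
Proof.
move=> mn; rewrite /Phi conjc0 -exprD expr0n.
by rewrite gtn_eqF// mulr0.
Qed.

Lemma Phi_polar q m n z : z != 0 -> let om := z / (cmod z)%:C in
  Phi q m n z = (cmod z `^ (2 * q + (m + n)%:R))%:C * (om ^+ m * conjc om ^+ n).
Proof.
move=> z0 /=; have c0 : 0 < cmod z by rewrite cmod_gt0.
have cn0 : (cmod z)%:C != 0 :> R[i] by rewrite -cmod_eq0 cmod_real normr_eq0 gt_eqF.
rewrite /Phi powRD; last by rewrite (gt_eqF c0) implybT.
rewrite powRrM powR_mulrn ?cmod_ge0// powR_mulrn ?cmod_ge0//.
rewrite rcM rcX -mulrA; congr (_ * _).
rewrite conjM -rcV conjc_real rcV !exprMn !exprVn exprD.
by field; rewrite !expf_neq0.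
Qed.

Lemma cmod_Phi q m n z : z != 0 -> cmod (Phi q m n z) = cmod z `^ (2 * q + (m + n)%:R).
Proof.
move=> z0; have c0 : 0 < cmod z by rewrite cmod_gt0.
have com : cmod (z / (cmod z)%:C) = 1.
  by rewrite cmodM cmodV cmod_real (gtr0_norm c0) mulfV// gt_eqF.
rewrite Phi_polar// cmodM cmod_real ger0_norm ?powR_ge0// cmodM !cmodX cmod_conj com.
by rewrite !expr1n !mulr1.
Qed.

Lemma Phi_le q m n z M : (0 < m + n)%N -> 0 <= 2 * q + (m + n)%:R -> cmod z <= M ->
  cmod (Phi q m n z) <= M `^ (2 * q + (m + n)%:R).
Proof.
move=> mn p0 zM; have M0 : 0 <= M by apply: le_trans zM; exact: cmod_ge0.
have [->|z0] := eqVneq z 0; first by rewrite Phi0// cmod0 powR_ge0.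
by rewrite cmod_Phi//; apply: ge0_ler_powR; rewrite ?nnegrE ?cmod_ge0.
Qed.

Lemma unit_expr_lip (u v : R[i]) n : cmod u = 1 -> cmod v = 1 ->
  cmod (u ^+ n - v ^+ n) <= n%:R * cmod (u - v).
Proof.
move=> u1 v1; elim: n => [|n IH]; first by rewrite !expr0 subrr cmod0 mul0r.
have -> : u ^+ n.+1 - v ^+ n.+1 = u * (u ^+ n - v ^+ n) + (u - v) * v ^+ n.
  by rewrite !exprS; ring.
rewrite (le_trans (cmodD _ _))// !cmodM cmodX u1 v1 expr1n mul1r mulr1.
by rewrite -natr1 mulrDl mul1r lerD.
Qed.

(** In polar coordinates the radial factor is Lipschitz by the mean value theorem; the
    angular factor is Lipschitz with constant of order [1 / |w|], which one power of
    the modulus of [w] compensates. *)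
Lemma Phi_lip q m n z w M : (0 < m + n)%N -> 1 <= 2 * q + (m + n)%:R ->
  cmod z <= M -> cmod w <= M ->
  cmod (Phi q m n z - Phi q m n w) <=
    (2 * q + (m + n)%:R + 2 * (m + n)%:R) * M `^ (2 * q + (m + n)%:R - 1) * cmod (z - w).
Proof.
set p := 2 * q + (m + n)%:R => mn p1 zM wM.
have M0 : 0 <= M by apply: le_trans zM; exact: cmod_ge0.
have p0 : 0 < p by lra.
have N0 : 0 <= (m + n)%:R :> R by rewrite ler0n.
have mono x : 0 <= x -> x <= M -> x `^ (p - 1) <= M `^ (p - 1).
  by move=> x0 xM; apply: ge0_ler_powR => //; rewrite ?nnegrE//; lra.
have one z1 : cmod z1 <= M -> cmod (Phi q m n z1) <= (p + 2 * (m + n)%:R) * M `^ (p - 1) * cmod z1.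
  move=> z1M; have [->|z0] := eqVneq z1 0; first by rewrite Phi0// cmod0 mulr0.
  rewrite cmod_Phi// -/p -(mulr_powRB1 (cmod_ge0 z1) p0) mulrC ler_wpM2r ?cmod_ge0//.
  apply: le_trans (mono _ (cmod_ge0 _) z1M) _; rewrite ler_peMl ?powR_ge0//; lra.
have [->|w0] := eqVneq w 0; first by rewrite Phi0// !subr0; exact: one.
have [->|z0] := eqVneq z 0; first by rewrite Phi0// !sub0r !cmodN; exact: one.
rewrite !Phi_polar// -/p.
set r := cmod z; set s := cmod w; set a := z / _; set b := w / _.
have r0 : 0 < r by rewrite cmod_gt0.
have s0 : 0 < s by rewrite cmod_gt0.
have a1 : cmod a = 1 by rewrite /a cmodM cmodV cmod_real (gtr0_norm r0) mulfV// gt_eqF.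
have b1 : cmod b = 1 by rewrite /b cmodM cmodV cmod_real (gtr0_norm s0) mulfV// gt_eqF.
have rn0 : r%:C != 0 :> R[i] by rewrite -cmod_eq0 cmod_real normr_eq0 gt_eqF.
have sn0 : s%:C != 0 :> R[i] by rewrite -cmod_eq0 cmod_real normr_eq0 gt_eqF.
pose A := a ^+ m * conjc a ^+ n; pose B := b ^+ m * conjc b ^+ n.
have A1 : cmod A = 1 by rewrite /A cmodM !cmodX cmod_conj a1 !expr1n mulr1.
have AB : cmod (A - B) <= (m + n)%:R * cmod (a - b).
  have -> : A - B = (a ^+ m - b ^+ m) * conjc a ^+ n + b ^+ m * (conjc a ^+ n - conjc b ^+ n).
    by rewrite /A /B; ring.
  rewrite (le_trans (cmodD _ _))// !cmodM !cmodX cmod_conj a1 b1 !expr1n mulr1 mul1r.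
  rewrite natrD mulrDl lerD ?unit_expr_lip//.
  apply: (le_trans (unit_expr_lip n _ _)); rewrite ?cmod_conj//.
  by rewrite -conjB cmod_conj.
have rs : `|r - s| <= cmod (z - w) by exact: cmod_dist_le.
have sab : s * cmod (a - b) <= 2 * cmod (z - w).
  have -> : s * cmod (a - b) = cmod ((s - r)%:C * a + (z - w)).
    rewrite -[in LHS](gtr0_norm s0) -cmod_real -cmodM; congr cmod.
    have -> : z = r%:C * a by rewrite /a mulrC divfK.
    have -> : w = s%:C * b by rewrite /b mulrC divfK.
    by rewrite rcB; ring.
  rewrite (le_trans (cmodD _ _))// cmodM a1 mulr1 cmod_real distrC.
  by lra.
rewrite -/A -/B; move: A B A1 AB => A B A1 AB.
have -> : (r `^ p)%:C * A - (s `^ p)%:C * B = (r `^ p - s `^ p)%:C * A + (s `^ p)%:C * (A - B).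
  by rewrite rcB; ring.
rewrite (le_trans (cmodD _ _))// !cmodM A1 mulr1 !cmod_real.
have L1 := powR_lip p1 (ltW s0) (ltW r0) wM zM.
have -> : `|s `^ p| = s `^ (p - 1) * s.
  by rewrite ger0_norm ?powR_ge0// mulrC mulr_powRB1// ltW.
have Mp0 : 0 <= M `^ (p - 1) by rewrite powR_ge0.
have L2 : s `^ (p - 1) * s * cmod (A - B) <= M `^ (p - 1) * ((m + n)%:R * (2 * cmod (z - w))).
  rewrite -mulrA ler_pM ?powR_ge0 ?mulr_ge0 ?cmod_ge0 ?mono//; try exact: ltW.
  apply: (@le_trans _ _ (s * ((m + n)%:R * cmod (a - b)))).
    by rewrite ler_pM2l.
  by rewrite mulrCA ler_wpM2l.
apply: (le_trans (lerD L1 L2)).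
apply: (@le_trans _ _ (p * M `^ (p - 1) * cmod (z - w) + M `^ (p - 1) * ((m + n)%:R * (2 * cmod (z - w))))).
  by rewrite lerD2r ler_wpM2l// mulr_ge0// ltW.
by rewrite le_eqVlt; apply/orP; left; apply/eqP; ring.
Qed.

Lemma Phi_ccont q m n (u : R -> R[i]) : (0 < m + n)%N -> 1 <= 2 * q + (m + n)%:R ->
  ccont u -> ccont (fun x => Phi q m n (u x)).
Proof.
move=> mn p1 cu.
have key x : forall e : R, 0 < e ->
    \forall y \near x, cmod (Phi q m n (u x) - Phi q m n (u y)) <= e.
  move=> e e0; pose M := cmod (u x) + 1.
  pose L := (2 * q + (m + n)%:R + 2 * (m + n)%:R) * M `^ (2 * q + (m + n)%:R - 1).
  have M0 : 0 <= M by rewrite addr_ge0 ?cmod_ge0.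
  have L0 : 0 <= L.
    rewrite mulr_ge0 ?powR_ge0// addr_ge0 ?mulr_ge0 ?ler0n//; lra.
  have L1 : 0 < L + 1 by lra.
  have cd : continuous (fun y => cmod (u x - u y)).
    by apply: ccont_cmod; apply: ccontB => //; exact: ccont_cst.
  have m0 : 0 < Num.min 1 (e / (L + 1)) by rewrite lt_min ltr01 divr_gt0.
  have /cvgrPdist_le /(_ _ m0) := cd x.
  rewrite subrr cmod0; apply: filterS => y; rewrite sub0r normrN ger0_norm ?cmod_ge0//.
  rewrite le_min => /andP[d1 de].
  have uM : cmod (u y) <= M.
    have -> : u y = u x - (u x - u y) by rewrite subKr.
    by rewrite (le_trans (cmodB _ _))// lerD2l.
  have uM' : cmod (u x) <= M by rewrite lerDl.
  apply: (le_trans (Phi_lip mn p1 uM' uM)); rewrite -/L.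
  apply: (@le_trans _ _ (L * (e / (L + 1)))); first by rewrite ler_wpM2l.
  by rewrite mulrCA ger_pMr// ler_pdivrMr//; lra.
split=> x; apply/cvgrPdist_le => e e0; have := key x e e0; apply: filterS => y.
  by apply: le_trans; rewrite -cReB Re_le_cmod.
by apply: le_trans; rewrite -cImB Im_le_cmod.
Qed.

Lemma eps_cder (f : R -> R[i]) x (l : R[i]) :
  (forall e : R, 0 < e -> exists2 r : R, 0 < r & forall y, `|y - x| < r ->
    cmod (f y - f x - (y - x)%:C * l) <= e * `|y - x|) -> cder f x l.
Proof.
move=> H; split; apply: is_derive_eps => e /H[r r0 h]; exists r => // y /h; apply: le_trans.
  by have := Re_le_cmod (f y - f x - (y - x)%:C * l); rewrite !cReB cReMl.
have := Im_le_cmod (f y - f x - (y - x)%:C * l).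
by rewrite !cImB [(y - x)%:C * l]mulrC cImMr [IM l * _]mulrC.
Qed.

Lemma cderX (u : R -> R[i]) x l n : cder u x l -> cder (fun y => u y ^+ n) x (n%:R * u x ^+ n.-1 * l).
Proof.
move=> hu; elim: n => [|n IH].
  by rewrite !mul0r; apply: (cder_ext _ (cder_cst 1 x)) => y; rewrite expr0.
have := cderM hu IH.
have -> : l * u x ^+ n + u x * (n%:R * u x ^+ n.-1 * l) = n.+1%:R * u x ^+ n.+1.-1 * l.
  rewrite -[n.+1%:R]natr1 /=; case: n {IH} => [|n] /=; first by rewrite !expr0; ring.
  by rewrite exprS; ring.
by apply: cder_ext => y; rewrite exprS.
Qed.

(** At a zero of [u] the homogeneity exceeds one, and [Phi] vanishes faster than [u]. *)
Lemma cder_Phi0 q m n (u : R -> R[i]) x l : (0 < m + n)%N -> 1 < 2 * q + (m + n)%:R ->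
  cder u x l -> u x = 0 -> cder (fun y => Phi q m n (u y)) x 0.
Proof.
set p := 2 * q + (m + n)%:R => mn p1 du ux.
apply: eps_cder => e e0; pose C := cmod l + 1.
have C0 : 0 < C by rewrite ltr_wpDl ?cmod_ge0.
have [r1 r10 h1] := cder_eps du ltr01.
pose d := (e / C) `^ (p - 1)^-1.
have d0 : 0 < d by rewrite powR_gt0// divr_gt0.
exists (Num.min r1 (d / C)); first by rewrite lt_min r10 divr_gt0.
move=> y; rewrite lt_min => /andP[y1 y2].
rewrite ux Phi0// subr0 mulr0 subr0.
have [->|uy] := eqVneq (u y) 0; first by rewrite Phi0// cmod0 mulr_ge0// ltW.
have b1 : cmod (u y) <= C * `|y - x|.
  have := h1 y y1; rewrite ux subr0 => h.
  have -> : u y = (u y - (y - x)%:C * l) + (y - x)%:C * l by rewrite subrK.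
  rewrite (le_trans (cmodD _ _))// cmodM cmod_real /C mulrDl addrC lerD//.
  by rewrite mulrC.
have b2 : cmod (u y) <= d.
  by apply: (le_trans b1); rewrite mulrC -ler_pdivlMr// ltW.
have p0 : 0 < p by lra.
rewrite cmod_Phi// -/p -(mulr_powRB1 (cmod_ge0 _) p0).
have b3 : cmod (u y) `^ (p - 1) <= e / C.
  apply: (@le_trans _ _ (d `^ (p - 1))).
    by apply: ge0_ler_powR; rewrite ?nnegrE ?cmod_ge0 ?(ltW d0)//; lra.
  have ec : 0 <= e / C by rewrite divr_ge0// ltW.
  by rewrite /d -powRrM mulVf ?powRr1// gt_eqF// subr_gt0.
apply: (le_trans (ler_pM (cmod_ge0 _) (powR_ge0 _ _) b1 b3)).
by rewrite le_eqVlt; apply/orP; left; apply/eqP; field; rewrite gt_eqF.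
Qed.

Lemma cder_Phi q m n (u : R -> R[i]) x l : (0 < m + n)%N -> 1 < 2 * q + (m + n)%:R ->
  cder u x l ->
  cder (fun y => Phi q m n (u y)) x
    ((q + m%:R)%:C * Phi (q - 1) m n.+1 (u x) * l +
     (q + n%:R)%:C * Phi (q - 1) m.+1 n (u x) * conjc l).
Proof.
move=> mn p1 du; have [u0|u0] := eqVneq (u x) 0.
  rewrite u0 !Phi0 ?addnS// !mulr0 !mul0r addr0.
  exact: cder_Phi0 du u0.
have c0 : 0 < cmod (u x) ^+ 2 by rewrite exprn_gt0// cmod_gt0.
have d2 : is_derive x 1 (fun y => cmod (u y) ^+ 2) (2 * RE (conjc (u x) * l)).
  case: du => d1 d2.
  have -> : (fun y => cmod (u y) ^+ 2) = (fun y => RE (u y) * RE (u y) + IM (u y) * IM (u y)).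
    by apply/funext => y; rewrite sqr_cmod !expr2.
  apply: is_derive_eq; rewrite /GRing.scale /= !ReImE; ring.
have d3 := @is_derive1_comp R (fun r => r `^ q) (fun y => cmod (u y) ^+ 2) x _ _
  (@is_derive1_powR R q _ c0) d2.
have := cderM (cder_real d3) (cderM (cderX m du) (cderX n (cder_conj du))).
set d := (X in cder _ x X); set d' := (X in _ -> cder _ x X).
suff -> : d = d' by [].
rewrite /d /d' /Phi [(_ \o _) x]/=.
have -> : (cmod (u x) ^+ 2) `^ q = (cmod (u x) ^+ 2) `^ (q - 1) * cmod (u x) ^+ 2.
  have := @powRD _ (cmod (u x) ^+ 2) (q - 1) 1.
  by rewrite (gt_eqF c0) implybT subrK (powRr1 (ltW c0)) => ->.
set P := (cmod (u x) ^+ 2) `^ (q - 1).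
have -> : (q * P * (2 * RE (conjc (u x) * l)))%:C = (q * P)%:C * (conjc (u x) * l + u x * conjc l).
  rewrite rcM; congr (_ * _); rewrite rcM rc_nat -addcJ; congr (_ + _).
  by rewrite conjM conjcK.
have z2 : (cmod (u x) ^+ 2)%:C = u x * conjc (u x) by rewrite mul_conj.
rewrite [(P * _)%:C]rcM z2 [(q * P)%:C]rcM !rcD !rc_nat.
move: (u x) (conjc (u x)) (conjc l) P%:C => z zb lb Pc.
case: m {mn p1 d d'} => [|m]; case: n => [|n]; rewrite ?exprS ?expr0 ?mul0r ?mulr0 ?add0r ?addr0 /= ?exprS; ring.
Qed.

End Homogeneous.

(** * The nonlinearity *)

Ltac nonneg := repeat (first [assumption | exact: cmod_ge0 | exact: nrm_ge0 |
  exact: sqrtr_ge0 | exact: normr_ge0 | exact: ler0n | exact: ler01 | exact: sqr_ge0 |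
  apply: mulr_ge0 | apply: addr_ge0 | apply: exprn_ge0]).

Section Nonlinearity.
Context {R : realType} (beta sigma : R).
Hypothesis sigma1 : 1 <= sigma.
Implicit Types (z w h k : R[i]) (M L : R).

(** The nonlinearity, its differential at [z] in the direction [h], and the quadratic
    form of its second differential. *)
Definition NF z : R[i] := beta%:C * Phi sigma 1 0 z.
Definition DF z h : R[i] := beta%:C *
  ((sigma + 1)%:C * (Phi (sigma - 1) 1 1 z * h) + sigma%:C * (Phi (sigma - 1) 2 0 z * conjc h)).
Definition D2F z h : R[i] := beta%:C *
  ((sigma * (sigma + 1))%:C * (Phi (sigma - 2) 1 2 z * (h * h)) +
   (2 * sigma * (sigma + 1))%:C * (Phi (sigma - 2) 2 1 z * (h * conjc h)) +
   (sigma * (sigma - 1))%:C * (Phi (sigma - 2) 3 0 z * (conjc h * conjc h))).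

Lemma BopE V (v : R -> R[i]) x : Bop V beta sigma v x = (V x)%:C * v x + NF (v x).
Proof.
rewrite /Bop /nonlin /NF /Phi expr1 expr0 mulr1; congr (_ + _).
by rewrite rcM mulrA.
Qed.

Lemma C1_NF a b u u' : C1 a b u u' -> C1 a b (fun x => NF (u x)) (fun x => DF (u x) (u' x)).
Proof.
move=> [cu cu' du]; split.
- by apply: ccontM; [exact: ccont_cst|apply: Phi_ccont => //; rewrite natrD; have := sigma1; lra].
- apply: ccontM; first exact: ccont_cst.
  apply: ccontD; (apply: ccontM; first exact: ccont_cst).
    by apply: ccontM => //; apply: Phi_ccont => //; rewrite natrD; have := sigma1; lra.
  by apply: ccontM; [apply: Phi_ccont => //; rewrite natrD; have := sigma1; lra|exact: ccont_conj].
- move=> x xab; apply: cderZ.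
  have s1 : 1 < 2 * sigma + (1 + 0)%:R by rewrite natrD; have := sigma1; lra.
  have := cder_Phi (isT : (0 < 1 + 0)%N) s1 (du x xab).
  by rewrite addr0 !mulrA.
Qed.

Lemma C1_DF a b u u' u'' : C1 a b u u' -> C1 a b u' u'' ->
  C1 a b (fun x => DF (u x) (u' x)) (fun x => D2F (u x) (u' x) + DF (u x) (u'' x)).
Proof.
move=> [cu cu' du] [_ cu'' du'].
have cP q m n : (0 < m + n)%N -> 1 <= 2 * q + (m + n)%:R -> ccont (fun x => Phi q m n (u x)).
  by move=> *; exact: Phi_ccont.
have c11 : ccont (fun x => Phi (sigma - 1) 1 1 (u x)) by apply: cP => //; rewrite natrD; have := sigma1; lra.
have c20 : ccont (fun x => Phi (sigma - 1) 2 0 (u x)) by apply: cP => //; rewrite natrD; have := sigma1; lra.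
have c12 : ccont (fun x => Phi (sigma - 2) 1 2 (u x)) by apply: cP => //; rewrite natrD; have := sigma1; lra.
have c21 : ccont (fun x => Phi (sigma - 2) 2 1 (u x)) by apply: cP => //; rewrite natrD; have := sigma1; lra.
have c30 : ccont (fun x => Phi (sigma - 2) 3 0 (u x)) by apply: cP => //; rewrite natrD; have := sigma1; lra.
have cc := ccont_conj cu'; have cc2 := ccont_conj cu''.
have cDF v : ccont v -> ccont (fun x => DF (u x) (v x)).
  move=> cv; have cv' := ccont_conj cv; apply: ccontM; first exact: ccont_cst.
  by apply: ccontD; (apply: ccontM; [exact: ccont_cst|]); apply: ccontM.
split.
- exact: cDF.
- apply: ccontD; last exact: cDF.
  apply: ccontM; first exact: ccont_cst.
  by apply: ccontD; [apply: ccontD|]; (apply: ccontM; [exact: ccont_cst|]);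
    (apply: ccontM; [|apply: ccontM]).
- move=> x xab; have d1 := du x xab; have d2 := du' x xab.
  have s1 : 1 < 2 * (sigma - 1) + (1 + 1)%:R by rewrite natrD; have := sigma1; lra.
  have s2 : 1 < 2 * (sigma - 1) + (2 + 0)%:R by rewrite natrD; have := sigma1; lra.
  have h1 := cder_Phi (isT : (0 < 1 + 1)%N) s1 d1.
  have h2 := cder_Phi (isT : (0 < 2 + 0)%N) s2 d1.
  have := cderZ beta%:C (cderD (cderZ (sigma + 1)%:C (cderM h1 d2))
     (cderZ sigma%:C (cderM h2 (cder_conj d2)))).
  set X := (X in cder _ x X -> _); set Y := (X in _ -> cder _ x X).
  suff -> : X = Y by [].
  rewrite /X /Y /D2F /DF.
  have -> : sigma - 1 - 1 = sigma - 2 by ring.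
  have -> : (sigma - 1 + 1%:R) = sigma by rewrite subrK.
  have -> : (sigma - 1 + 2%:R) = sigma + 1 by ring.
  have -> : (sigma - 1 + 0%:R) = sigma - 1 by rewrite addr0.
  have E1 : (2 * sigma * (sigma + 1))%:C = 2 * (sigma%:C * (sigma%:C + 1)) :> R[i].
    by rewrite !rcM rcD rc_nat mulrA.
  rewrite E1 !rcM !rcD !rcN.
  move: (Phi _ _ _ _) (Phi _ _ _ _) (Phi _ _ _ _) (Phi _ _ _ _) (Phi _ _ _ _) => A1 A2 A3 A4 A5.
  move: (conjc (u' x)) (conjc (u'' x)) => cu1 cu2.
  by ring.
Qed.

Lemma Phi_bnd q m n M : (0 < m + n)%N -> 1 <= 2 * q + (m + n)%:R -> 0 <= M ->
  exists2 L : R, 0 <= L & forall z w, cmod z <= M -> cmod w <= M ->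
    cmod (Phi q m n z) <= L /\ cmod (Phi q m n z - Phi q m n w) <= L * cmod (z - w).
Proof.
move=> mn p1 M0.
pose L1 := M `^ (2 * q + (m + n)%:R).
pose L2 := (2 * q + (m + n)%:R + 2 * (m + n)%:R) * M `^ (2 * q + (m + n)%:R - 1).
have L10 : 0 <= L1 by exact: powR_ge0.
have L20 : 0 <= L2.
  have n0 : 0 <= (m + n)%:R :> R by rewrite ler0n.
  rewrite mulr_ge0 ?powR_ge0//; lra.
exists (L1 + L2) => [|z w zM wM]; first exact: addr_ge0.
split.
  apply: (le_trans (Phi_le mn _ zM)); first lra.
  by rewrite lerDl.
apply: (le_trans (Phi_lip mn p1 zM wM)).
by rewrite ler_wpM2r ?cmod_ge0// lerDr.
Qed.

Lemma cmod_lin_le (c A h : R[i]) (r L : R) : cmod c = r -> cmod A <= L -> cmod (c * (A * h)) <= r * L * cmod h.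
Proof.
move=> <- AL; rewrite !cmodM -mulrA ler_wpM2l ?cmod_ge0// ler_wpM2r ?cmod_ge0//.
Qed.

Lemma quad_lip (A A' h h' k k' : R[i]) L M d : cmod A <= L -> cmod A' <= L -> cmod (A - A') <= L * d ->
  cmod h <= M -> cmod h' <= M -> cmod k <= M -> cmod k' <= M ->
  cmod (A * (h * h') - A' * (k * k')) <= L * M ^+ 2 * d + L * M * cmod (h - k) + L * M * cmod (h' - k').
Proof.
move=> AL AL' Ad hM hM' kM kM'.
have L0 : 0 <= L by apply: le_trans AL; exact: cmod_ge0.
have M0 : 0 <= M by apply: le_trans hM; exact: cmod_ge0.
have -> : A * (h * h') - A' * (k * k') = (A - A') * (h * h') + A' * ((h - k) * h') + A' * (k * (h' - k')).
  by ring.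
rewrite (le_trans (cmodD _ _))// lerD//; last first.
  by rewrite 2!cmodM -mulrA ler_pM ?mulr_ge0 ?cmod_ge0// ler_wpM2r ?cmod_ge0.
rewrite (le_trans (cmodD _ _))// lerD//.
  rewrite 2!cmodM mulrAC; apply: ler_pM; rewrite ?mulr_ge0 ?cmod_ge0//.
  by rewrite expr2 ler_pM ?cmod_ge0.
rewrite 2!cmodM -mulrA ler_pM ?mulr_ge0 ?cmod_ge0// mulrC ler_wpM2r ?cmod_ge0//.
Qed.

Lemma NF_bounds M : 0 <= M -> exists2 L : R, 0 <= L &
  [/\ forall z w, cmod z <= M -> cmod w <= M -> cmod (NF z - NF w) <= L * cmod (z - w),
      forall z h, cmod z <= M -> cmod (DF z h) <= L * cmod h,
      forall z w h, cmod z <= M -> cmod w <= M -> cmod (DF z h - DF w h) <= L * cmod (z - w) * cmod h &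
      forall z w h k, cmod z <= M -> cmod w <= M -> cmod h <= M -> cmod k <= M ->
        cmod (D2F z h - D2F w k) <= L * (cmod (z - w) + cmod (h - k))].
Proof.
move=> M0.
have [||| L1 L10 B1] := @Phi_bnd sigma 1 0 M; [by []|by rewrite natrD; have := sigma1; lra|by []|].
have [||| L2 L20 B2] := @Phi_bnd (sigma - 1) 1 1 M; [by []|by rewrite natrD; have := sigma1; lra|by []|].
have [||| L3 L30 B3] := @Phi_bnd (sigma - 1) 2 0 M; [by []|by rewrite natrD; have := sigma1; lra|by []|].
have [||| L4 L40 B4] := @Phi_bnd (sigma - 2) 1 2 M; [by []|by rewrite natrD; have := sigma1; lra|by []|].
have [||| L5 L50 B5] := @Phi_bnd (sigma - 2) 2 1 M; [by []|by rewrite natrD; have := sigma1; lra|by []|].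
have [||| L6 L60 B6] := @Phi_bnd (sigma - 2) 3 0 M; [by []|by rewrite natrD; have := sigma1; lra|by []|].
have s1 : 1 <= sigma := sigma1.
have s0 : 0 <= sigma := le_trans ler01 s1.
have b0 : 0 <= `|beta| by [].
have c0 : 0 <= sigma + 1 by lra.
have c1 : 0 <= sigma * (sigma + 1) by rewrite mulr_ge0//; lra.
have c2 : 0 <= 2 * sigma * (sigma + 1) by rewrite mulr_ge0//; lra.
have c3 : 0 <= sigma * (sigma - 1) by rewrite mulr_ge0//; lra.
pose K1 := `|beta| * L1.
pose K2 := `|beta| * ((sigma + 1) * L2 + sigma * L3).
pose K3 := `|beta| * (sigma * (sigma + 1) * L4 + 2 * sigma * (sigma + 1) * L5 + sigma * (sigma - 1) * L6) * (M ^+ 2 + 2 * M).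
have K10 : 0 <= K1 by rewrite mulr_ge0.
have K20 : 0 <= K2 by rewrite mulr_ge0// addr_ge0// mulr_ge0//; lra.
have K30 : 0 <= K3.
  by rewrite /K3; nonneg.
exists (K1 + K2 + K3); first by rewrite !addr_ge0.
split.
- move=> z w zM wM; rewrite /NF -mulrBr cmodM cmod_real.
  apply: (@le_trans _ _ (K1 * cmod (z - w))).
    by rewrite /K1 -mulrA ler_wpM2l//; case: (B1 z w zM wM).
  by rewrite ler_wpM2r ?cmod_ge0//; lra.
- move=> z h zM; rewrite /DF cmodM cmod_real.
  apply: (@le_trans _ _ (K2 * cmod h)); last by rewrite ler_wpM2r ?cmod_ge0//; lra.
  rewrite /K2 -mulrA ler_wpM2l// mulrDl (le_trans (cmodD _ _))// lerD//.
    apply: cmod_lin_le; first by rewrite cmod_real ger0_norm.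
    by case: (B2 z z zM zM).
  rewrite -(cmod_conj h); apply: cmod_lin_le; first by rewrite cmod_real; exact: ger0_norm s0.
  by case: (B3 z z zM zM).
- move=> z w h zM wM; rewrite /DF -mulrBr cmodM cmod_real.
  apply: (@le_trans _ _ (K2 * cmod (z - w) * cmod h)); last first.
    by rewrite !ler_wpM2r ?cmod_ge0//; lra.
  rewrite -(mulrA K2) /K2 -(mulrA `|beta|) ler_wpM2l//.
  have -> : (sigma + 1)%:C * (Phi (sigma - 1) 1 1 z * h) + sigma%:C * (Phi (sigma - 1) 2 0 z * conjc h) -
     ((sigma + 1)%:C * (Phi (sigma - 1) 1 1 w * h) + sigma%:C * (Phi (sigma - 1) 2 0 w * conjc h)) =
     (sigma + 1)%:C * ((Phi (sigma - 1) 1 1 z - Phi (sigma - 1) 1 1 w) * h) +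
     sigma%:C * ((Phi (sigma - 1) 2 0 z - Phi (sigma - 1) 2 0 w) * conjc h) by ring.
  rewrite (le_trans (cmodD _ _))//.
  rewrite [leRHS](_ : _ = (sigma + 1) * (L2 * cmod (z - w)) * cmod h + sigma * (L3 * cmod (z - w)) * cmod h); last by ring.
  rewrite lerD//.
    apply: cmod_lin_le; first by rewrite cmod_real ger0_norm.
    by case: (B2 z w zM wM).
  rewrite -(cmod_conj h); apply: cmod_lin_le; first by rewrite cmod_real; exact: ger0_norm s0.
  by case: (B3 z w zM wM).
- move=> z w h k zM wM hM kM; rewrite /D2F -mulrBr cmodM cmod_real.
  apply: (@le_trans _ _ (K3 * (cmod (z - w) + cmod (h - k)))); last first.
    by rewrite ler_wpM2r ?addr_ge0 ?cmod_ge0//; lra.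
  rewrite /K3 -2!(mulrA `|beta|) -(mulrA _ (M ^+ 2 + 2 * M)) ler_wpM2l//.
  have hcM : cmod (conjc h) <= M by rewrite cmod_conj.
  have kcM : cmod (conjc k) <= M by rewrite cmod_conj.
  have hk : cmod (conjc h - conjc k) = cmod (h - k) by rewrite -conjB cmod_conj.
  have [P4 Q4] := B4 z w zM wM; have [P4' _] := B4 w w wM wM.
  have [P5 Q5] := B5 z w zM wM; have [P5' _] := B5 w w wM wM.
  have [P6 Q6] := B6 z w zM wM; have [P6' _] := B6 w w wM wM.
  have q4 := quad_lip P4 P4' Q4 hM hM kM kM.
  have q5 := quad_lip P5 P5' Q5 hM hcM kM kcM.
  have q6 := quad_lip P6 P6' Q6 hcM hcM kcM kcM.
  rewrite hk in q5 q6.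
  set D := cmod (z - w) in q4 q5 q6 *; set E := cmod (h - k) in q4 q5 q6 *.
  have D0 : 0 <= D by exact: cmod_ge0.
  have E0 : 0 <= E by exact: cmod_ge0.
  have fin L (c : R) (X : R[i]) : 0 <= L -> 0 <= c -> cmod X <= L * M ^+ 2 * D + L * M * E + L * M * E ->
      cmod (c%:C * X) <= c * L * ((M ^+ 2 + 2 * M) * (D + E)).
    move=> L0 cc0 HX; rewrite cmodM cmod_real (ger0_norm cc0) -mulrA ler_wpM2l//.
    apply: (le_trans HX).
    have : 0 <= L * (M ^+ 2 * E + 2 * M * D) by rewrite mulr_ge0// addr_ge0// !mulr_ge0.
    by nra.
  have f4 := fin _ _ _ L40 c1 q4; have f5 := fin _ _ _ L50 c2 q5; have f6 := fin _ _ _ L60 c3 q6.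
  set W := (M ^+ 2 + 2 * M) * (D + E) in f4 f5 f6 *.
  apply: (@le_trans _ _ (sigma * (sigma + 1) * L4 * W + 2 * sigma * (sigma + 1) * L5 * W + sigma * (sigma - 1) * L6 * W)); last first.
    by rewrite le_eqVlt; apply/orP; left; apply/eqP; rewrite /W; ring.
  apply: le_trans (lerD (lerD f4 f5) f6).
  rewrite [X in cmod X](_ : _ = (sigma * (sigma + 1))%:C * (Phi (sigma - 2) 1 2 z * (h * h) - Phi (sigma - 2) 1 2 w * (k * k)) +
    (2 * sigma * (sigma + 1))%:C * (Phi (sigma - 2) 2 1 z * (h * conjc h) - Phi (sigma - 2) 2 1 w * (k * conjc k)) +
    (sigma * (sigma - 1))%:C * (Phi (sigma - 2) 3 0 z * (conjc h * conjc h) - Phi (sigma - 2) 3 0 w * (conjc k * conjc k))); last by ring.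
  by rewrite (le_trans (cmodD _ _))// lerD2r cmodD.
Qed.

(** Expand at [v] along the segments to [u] and [w]: the linear terms combine into the
    differential applied to the second difference. *)
Lemma NF_second_diff M : 0 <= M -> exists2 L : R, 0 <= L &
  forall u v w, cmod u <= M -> cmod v <= M -> cmod w <= M ->
    cmod (NF u + NF w - 2 * NF v) <=
      L * (cmod (u + w - 2 * v) + cmod (u - v) ^+ 2 + cmod (w - v) ^+ 2).
Proof.
move=> M0; have [L L0 [_ b1 b2 _]] := NF_bounds M0; exists L => // u v w uM vM wM.
have taylor z : cmod z <= M -> cmod (NF z - NF v - DF v (z - v)) <= L * cmod (z - v) ^+ 2.
  move=> zM; set h := z - v.
  have cl : C1 0 1 (fun t : R => v + t%:C * h) (fun=> 0 + (1 * h)).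
    apply: C1D; first exact: C1_cst.
    have ct : C1 0 1 (fun t : R => t%:C : R[i]) (fun=> 1).
      split.
      - by split => /= x; [exact: cvg_id|exact: cvg_cst].
      - exact: ccont_cst.
      - by move=> x _; apply: (cder_real (l := 1)); exact: is_derive_id.
    have := C1M ct (C1_cst 0 1 h).
    by under [X in C1 _ _ _ X]eq_fun do rewrite mulr0 addr0.
  rewrite add0r mul1r in cl.
  have ct2 : C1 0 1 (fun t : R => t%:C * DF v h) (fun=> DF v h).
    have ct : C1 0 1 (fun t : R => t%:C : R[i]) (fun=> 1).
      split.
      - by split => /= x; [exact: cvg_id|exact: cvg_cst].
      - exact: ccont_cst.
      - by move=> x _; apply: (cder_real (l := 1)); exact: is_derive_id.
    have := C1M ct (C1_cst 0 1 (DF v h)).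
    by under [X in C1 _ _ _ X]eq_fun do rewrite mulr0 addr0 mul1r.
  have cG := C1B (C1_NF cl) ct2.
  have [_ L2G H] := C1_H1 cG.
  have := H 0 1 (lexx 0) ler01 (lexx 1).
  rewrite !mul0r addr0 subr0 !mul1r (_ : v + h = z); last by rewrite addrC subrK.
  move=> E; have -> : NF z - NF v - DF v h = NF z - DF v h - NF v by ring.
  rewrite E; have iG := L2_intg L2G.
  apply: (le_trans (cmod_cint iG)).
  have -> : L * cmod h ^+ 2 = ri 0 1 (fun=> L * cmod h ^+ 2) by rewrite ri_cst// subr0 mulr1.
  apply: ri_le; [exact: cintg_cmod|exact: rint_cst|move=> t /andP[t0 t1]].
  have tM : cmod (v + t%:C * h) <= M.
    have -> : v + t%:C * h = (1 - t)%:C * v + t%:C * z by rewrite /h rcB; ring.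
    rewrite (le_trans (cmodD _ _))// !cmodM !cmod_real (gtr0_norm t0) gtr0_norm ?subr_gt0//.
    have -> : M = (1 - t) * M + t * M by ring.
    by apply: lerD; apply: ler_wpM2l => //; rewrite ?subr_ge0; exact: ltW.
  apply: (le_trans (b2 _ _ _ tM vM)).
  rewrite addrC addKr cmodM cmod_real (gtr0_norm t0) expr2 !mulrA ler_wpM2r ?cmod_ge0//.
  by rewrite -mulrA ler_wpM2l// ler_piMl ?cmod_ge0//; exact: ltW.
have DFD h k : DF v (h + k) = DF v h + DF v k by rewrite /DF conjD; ring.
have -> : NF u + NF w - 2 * NF v = (NF u - NF v - DF v (u - v)) + (NF w - NF v - DF v (w - v)) + DF v (u + w - 2 * v).
  have -> : u + w - 2 * v = (u - v) + (w - v) by ring.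
  by rewrite (DFD (u - v)); ring.
have h1 := taylor u uM; have h2 := taylor w wM; have h3 := b1 v (u + w - 2 * v) vM.
apply: (le_trans (cmodD _ _)); have h4 := cmodD (NF u - NF v - DF v (u - v)) (NF w - NF v - DF v (w - v)).
by lra.
Qed.

End Nonlinearity.

(** * The right-hand side of the equation on smooth periodic functions *)

Section Field.
Context {R : realType} (a b : R).
Hypothesis ab : a < b.
Context (W0 W1 W2 : R -> R[i]) (beta sigma : R).
Hypothesis W01 : C1 a b W0 W1.
Hypothesis W12 : H1 a b W1 W2.
Hypothesis W0per : W0 a = W0 b.
Hypothesis W1per : W1 a = W1 b.
Hypothesis sigma1 : 1 <= sigma.
Implicit Types (u v w : R -> R[i]) (M L : R).
Local Notation N := (NF beta sigma).
Local Notation D := (DF beta sigma).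
Local Notation D2 := (D2F beta sigma).

Definition bounded_by M u := forall x, a < x < b -> cmod (u x) <= M.

(** The field and what its first two derivatives in [x] are when [u1], [u2] are
    those of [u]. *)
Definition field u x := W0 x * u x + N (u x).
Definition field1 u u1 x := W1 x * u x + W0 x * u1 x + D (u x) (u1 x).
Definition field2 u u1 u2 x := W2 x * u x + W1 x * u1 x + (W1 x * u1 x + W0 x * u2 x) +
  (D2 (u x) (u1 x) + D (u x) (u2 x)).

Lemma nrm_dom3 u w1 w2 w3 L : L2 a b u -> L2 a b w1 -> L2 a b w2 -> L2 a b w3 -> 0 <= L ->
  (forall x, a < x < b -> cmod (u x) <= L * (cmod (w1 x) + cmod (w2 x) + cmod (w3 x))) ->
  nrm a b u <= L * (nrm a b w1 + nrm a b w2 + nrm a b w3).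
Proof.
move=> hu h1 h2 h3 L0 H.
pose q x : R[i] := (cmod (w2 x) + cmod (w3 x))%:C.
have cq x : cmod (q x) = cmod (w2 x) + cmod (w3 x).
  by rewrite cmod_real ger0_norm// addr_ge0 ?cmod_ge0.
have Lq : L2 a b q.
  have -> : q = (fun x => (cmod (w2 x))%:C + (cmod (w3 x))%:C).
    by apply/funext => x; rewrite /q rcD.
  have Lc w : L2 a b w -> L2 a b (fun x => (cmod (w x))%:C).
    move=> hw; apply: (@L2_dom _ _ _ _ w) => //.
      by split => /=; [apply: meas_cmod; exact: L2_meas hw|exact: measurable_cst].
    by move=> x _; rewrite cmod_real ger0_norm// cmod_ge0.
  by apply: L2D; exact: Lc.
have n1 : nrm a b u <= L * nrm a b w1 + L * nrm a b q.
  by apply: nrm_dom2 => // x xab; rewrite cq -mulrDr addrA; exact: H.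
have n2 : nrm a b q <= 1 * nrm a b w2 + 1 * nrm a b w3.
  by apply: nrm_dom2 => // x xab; rewrite cq !mul1r.
rewrite -addrA mulrDr; apply: (le_trans n1); rewrite lerD2l ler_wpM2l//.
by rewrite !mul1r in n2.
Qed.

Lemma field_C1 u u1 : C1 a b u u1 -> C1 a b (field u) (field1 u u1).
Proof. by move=> hu; apply: C1D; [exact: C1M|exact: C1_NF]. Qed.

Lemma field_H1 u u1 u2 : C1 a b u u1 -> C1 a b u1 u2 ->
  H1 a b (field1 u u1) (field2 u u1 u2).
Proof.
move=> h1 h2; apply: H1D; last by apply: C1_H1; exact: C1_DF h1 h2.
by apply: H1D; [exact: H1_mulC1|apply: C1_H1; exact: C1M].
Qed.

Lemma field_per u : u a = u b -> field u a = field u b.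
Proof. by rewrite /field W0per => ->. Qed.

Lemma field1_per u u1 : u a = u b -> u1 a = u1 b -> field1 u u1 a = field1 u u1 b.
Proof. by rewrite /field1 W0per W1per => -> ->. Qed.

Lemma fcoef_field1 u u1 l : C1 a b u u1 -> u a = u b ->
  fcoef a b (field1 u u1) l = 'i * (mu a b l)%:C * fcoef a b (field u) l.
Proof.
by move=> h1 p; apply: fcoef_deriv => //; [apply: C1_H1; exact: field_C1|exact: field_per].
Qed.

Lemma fcoef_field2 u u1 u2 l : C1 a b u u1 -> C1 a b u1 u2 -> u a = u b -> u1 a = u1 b ->
  fcoef a b (field2 u u1 u2) l = 'i * (mu a b l)%:C * ('i * (mu a b l)%:C * fcoef a b (field u) l).
Proof.
move=> h1 h2 p p1; rewrite -(fcoef_field1 l h1 p).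
by apply: fcoef_deriv => //; [exact: field_H1|exact: field1_per].
Qed.

Lemma L2_field u u1 : C1 a b u u1 -> L2 a b (field u).
Proof. by move=> /field_C1 /C1_H1 /H1_L2. Qed.

Lemma L2_C1 u u1 : C1 a b u u1 -> L2 a b u.
Proof. by move=> /C1_H1 /H1_L2. Qed.

Lemma L2_C1' u u1 : C1 a b u u1 -> L2 a b u1.
Proof. by case=> _ c _; exact: L2_ccont. Qed.

(** Lipschitz bounds on bounded sets, first in [L^2] and then in [H^1]; in the
    latter only one of the two functions needs a bounded derivative, so that the
    other one may be a numerical solution. *)
Lemma field_lip M : 0 <= M -> exists2 L : R, 0 <= L & forall u u1 w w1,
  C1 a b u u1 -> C1 a b w w1 -> bounded_by M u -> bounded_by M w -> bounded_by M w1 ->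
  nrm a b (fun x => field u x - field w x) <= L * nrm a b (fun x => u x - w x) /\
  nrm a b (fun x => field1 u u1 x - field1 w w1 x) <=
    L * (nrm a b (fun x => u x - w x) + nrm a b (fun x => u1 x - w1 x)).
Proof.
move=> M0; have [L L0 [b1 b2 b3 _]] := NF_bounds beta sigma1 M0.
have [K0 K00 k0] := ccont_bounded a b (let: And3 h _ _ := W01 in h).
have [K1 K10 k1] := ccont_bounded a b (let: And3 _ h _ := W01 in h).
have open_closed x : a < x < b -> a <= x <= b by case/andP => /ltW -> /ltW ->.
exists (K0 + K1 + L + L * M) => [|u u1 w w1 hu hw uM wM w1M]; first by nonneg.
have Lu := L2_C1 hu; have Lw := L2_C1 hw.
have Lu1 := L2_C1' hu; have Lw1 := L2_C1' hw.
have Ld := L2B Lu Lw; have Ld1 := L2B Lu1 Lw1.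
have LM0 : 0 <= L * M by exact: mulr_ge0.
split.
  apply: (@le_trans _ _ ((K0 + L) * nrm a b (fun x => u x - w x))); last first.
    by rewrite ler_wpM2r ?nrm_ge0//; lra.
  have h : nrm a b (fun x => field u x - field w x) <=
      (K0 + L) * nrm a b (fun x => u x - w x) + 0 * nrm a b (fun x => u x - w x).
    apply: nrm_dom2 => //; [|by nonneg|].
      by apply: L2B; apply: L2_field; eassumption.
    move=> x xab; rewrite mul0r addr0 /field.
    have -> : W0 x * u x + N (u x) - (W0 x * w x + N (w x)) = W0 x * (u x - w x) + (N (u x) - N (w x)).
      by ring.
    rewrite (le_trans (cmodD _ _))// mulrDl lerD ?b1 ?uM ?wM//.
    by rewrite cmodM ler_wpM2r ?cmod_ge0 ?k0 ?open_closed.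
  by rewrite mul0r addr0 in h.
rewrite mulrDr; apply: nrm_dom2 => //; try by nonneg.
  by apply: L2B; [exact: L2_C1' (field_C1 hu)|exact: L2_C1' (field_C1 hw)].
move=> x xab; rewrite /field1.
have -> : W1 x * u x + W0 x * u1 x + D (u x) (u1 x) - (W1 x * w x + W0 x * w1 x + D (w x) (w1 x)) =
  W1 x * (u x - w x) + W0 x * (u1 x - w1 x) + D (u x) (u1 x - w1 x) + (D (u x) (w1 x) - D (w x) (w1 x)).
  by rewrite /DF conjB; ring.
set d := u x - w x; set d1 := u1 x - w1 x.
have h1 : cmod (W1 x * d) <= K1 * cmod d.
  by rewrite cmodM ler_wpM2r ?cmod_ge0 ?k1 ?open_closed.
have h2 : cmod (W0 x * d1) <= K0 * cmod d1.
  by rewrite cmodM ler_wpM2r ?cmod_ge0 ?k0 ?open_closed.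
have h3 := b2 (u x) d1 (uM x xab).
have h4 : cmod (D (u x) (w1 x) - D (w x) (w1 x)) <= L * M * cmod d.
  apply: le_trans (b3 _ _ _ (uM x xab) (wM x xab)) _.
  by rewrite -/d mulrAC ler_wpM2r ?cmod_ge0// ler_wpM2l// w1M.
have s1 := cmodD (W1 x * d + W0 x * d1 + D (u x) d1) (D (u x) (w1 x) - D (w x) (w1 x)).
have s2 := cmodD (W1 x * d + W0 x * d1) (D (u x) d1).
have s3 := cmodD (W1 x * d) (W0 x * d1).
have d0 := cmod_ge0 d; have d10 := cmod_ge0 d1.
have m1 : 0 <= (K0 + L) * cmod d by nonneg.
have m2 : 0 <= (K1 + L * M) * cmod d1 by nonneg.
apply: (@le_trans _ _ (K1 * cmod d + K0 * cmod d1 + L * cmod d1 + L * M * cmod d)); first by lra.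
by rewrite -subr_ge0; apply: (le_trans (addr_ge0 m1 m2)); rewrite le_eqVlt; apply/orP; left; apply/eqP; ring.
Qed.

(** The second derivative of the potential is merely square integrable; the
    function it multiplies is therefore measured in the sup norm. *)
Lemma field2_lip M : 0 <= M -> exists2 L : R, 0 <= L & forall u u1 u2 w w1 w2,
  C1 a b u u1 -> C1 a b w w1 -> C1 a b u1 u2 -> C1 a b w1 w2 ->
  bounded_by M u -> bounded_by M w -> bounded_by M u1 -> bounded_by M w1 -> bounded_by M w2 ->
  nrm a b (fun x => field2 u u1 u2 x - field2 w w1 w2 x) <=
    L * (nrm a b (fun x => u x - w x) + nrm a b (fun x => u1 x - w1 x) +
         nrm a b (fun x => u2 x - w2 x)).
Proof.
move=> M0; have [L L0 [_ b2 b3 b4]] := NF_bounds beta sigma1 M0.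
have [K0 K00 k0] := ccont_bounded a b (let: And3 h _ _ := W01 in h).
have [K1 K10 k1] := ccont_bounded a b (let: And3 _ h _ := W01 in h).
have open_closed x : a < x < b -> a <= x <= b by case/andP => /ltW -> /ltW ->.
pose s := Num.sqrt (b - a); pose K2 := nrm a b W2 * (s^-1 + s).
have s0 : 0 <= s by exact: sqrtr_ge0.
have si0 : 0 <= s^-1 by rewrite invr_ge0.
have K20 : 0 <= K2 by rewrite /K2; nonneg.
pose C := K0 + 2 * K1 + 2 * L + L * M.
have C0 : 0 <= C by rewrite /C; nonneg.
exists (K2 + C) => [|u u1 u2 w w1 w2 hu hw hu1 hw1 uM wM u1M w1M w2M]; first by nonneg.
have Lu := L2_C1 hu; have Lw := L2_C1 hw.
have Lu1 := L2_C1' hu; have Lw1 := L2_C1' hw.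
have Lu2 := L2_C1' hu1; have Lw2 := L2_C1' hw1.
have Ld := L2B Lu Lw; have Ld1 := L2B Lu1 Lw1; have Ld2 := L2B Lu2 Lw2.
set n0 := nrm a b (fun x => u x - w x); set n1 := nrm a b (fun x => u1 x - w1 x).
set n2 := nrm a b (fun x => u2 x - w2 x).
have hd := C1B hu hw.
have LW2 : L2 a b W2 by case: W12.
pose A x := (u x - w x) * W2 x.
have cmd : cmeas a b (fun x => u x - w x) by exact: L2_meas.
have dS x : a < x < b -> cmod (u x - w x) <= s^-1 * n0 + s * n1.
  by move=> xab; apply: (sup_le_H1 ab (C1_H1 hd)); exact: open_closed.
have n00 : 0 <= n0 := nrm_ge0 _ _ _.
have n10 : 0 <= n1 := nrm_ge0 _ _ _.
have n20 : 0 <= n2 := nrm_ge0 _ _ _.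
have LA : L2 a b A by exact: L2M_bnd cmd dS LW2.
have nA : nrm a b A <= K2 * (n0 + n1).
  apply: (@le_trans _ _ ((s^-1 * n0 + s * n1) * nrm a b W2)).
    by apply: nrmM_bnd => //; nonneg.
  rewrite /K2 mulrC -mulrA ler_wpM2l ?nrm_ge0//.
  have : 0 <= s^-1 * n1 + s * n0 by nonneg.
  lra.
pose B x := field2 u u1 u2 x - field2 w w1 w2 x - A x.
have LF : L2 a b (fun x => field2 u u1 u2 x - field2 w w1 w2 x).
  by apply: L2B; [case: (field_H1 hu hu1)|case: (field_H1 hw hw1)].
have LB : L2 a b B by exact: L2B.
have nB : nrm a b B <= C * (n0 + n1 + n2).
  apply: nrm_dom3 => // x xab; rewrite /B /A /field2.
  set d := u x - w x; set d1 := u1 x - w1 x; set d2 := u2 x - w2 x.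
  rewrite (_ : _ - _ = 2 * (W1 x * d1) + W0 x * d2 + (D2 (u x) (u1 x) - D2 (w x) (w1 x)) +
    D (u x) d2 + (D (u x) (w2 x) - D (w x) (w2 x))); last first.
    by move: (D2 _ _) (D2 _ _) => E1 E2; rewrite /DF /d /d1 /d2 conjB; ring.
  have h1 : cmod (2 * (W1 x * d1)) <= 2 * (K1 * cmod d1).
    have -> : 2 = (2 : R)%:C :> R[i] by rewrite rc_nat.
    rewrite cmodM cmod_real ger0_norm// ler_wpM2l//.
    by rewrite cmodM ler_wpM2r ?cmod_ge0 ?k1 ?open_closed.
  have h2 : cmod (W0 x * d2) <= K0 * cmod d2.
    by rewrite cmodM ler_wpM2r ?cmod_ge0 ?k0 ?open_closed.
  have h3 := b4 _ _ _ _ (uM x xab) (wM x xab) (u1M x xab) (w1M x xab).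
  have h4 := b2 (u x) d2 (uM x xab).
  have h5 : cmod (D (u x) (w2 x) - D (w x) (w2 x)) <= L * M * cmod d.
    apply: le_trans (b3 _ _ _ (uM x xab) (wM x xab)) _.
    by rewrite -/d mulrAC ler_wpM2r ?cmod_ge0// ler_wpM2l// w2M.
  rewrite -/d -/d1 in h3.
  move: (2 * (W1 x * d1)) (W0 x * d2) (D2 (u x) (u1 x) - D2 (w x) (w1 x)) (D (u x) d2)
    (D (u x) (w2 x) - D (w x) (w2 x)) h1 h2 h3 h4 h5 => A1 A2 A3 A4 A5 h1 h2 h3 h4 h5.
  have s1 := cmodD (A1 + A2 + A3 + A4) A5.
  have s2 := cmodD (A1 + A2 + A3) A4.
  have s3 := cmodD (A1 + A2) A3.
  have s4 := cmodD A1 A2.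
  have m1 : 0 <= (K0 + 2 * K1 + L) * cmod d by nonneg.
  have m2 : 0 <= (K0 + L + L * M) * cmod d1 by nonneg.
  have m3 : 0 <= (2 * K1 + L + L * M) * cmod d2 by nonneg.
  apply: (@le_trans _ _ (2 * (K1 * cmod d1) + K0 * cmod d2 + L * (cmod d + cmod d1) + L * cmod d2 + L * M * cmod d)).
    by lra.
  rewrite -subr_ge0; apply: (le_trans (addr_ge0 (addr_ge0 m1 m2) m3)).
  by rewrite le_eqVlt; apply/orP; left; apply/eqP; rewrite /C; ring.
have -> : (fun x => field2 u u1 u2 x - field2 w w1 w2 x) = (fun x => A x + B x).
  by apply/funext => x; rewrite /B [RHS]addrC subrK.
apply: (le_trans (nrmD LA LB)); apply: (le_trans (lerD nA nB)).
have : 0 <= K2 * n2 by nonneg.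
by lra.
Qed.

(** The squares of first differences produced by the Taylor expansion are estimated in
    [L^2] by one factor in the sup norm, that is in [H^1]. *)
Lemma field_second_diff M : 0 <= M -> exists2 L : R, 0 <= L & forall u u1 v v1 w w1 (e : R),
  C1 a b u u1 -> C1 a b v v1 -> C1 a b w w1 ->
  bounded_by M u -> bounded_by M v -> bounded_by M w -> 0 <= e ->
  nrm a b (fun x => u x - v x) <= e -> nrm a b (fun x => u1 x - v1 x) <= e ->
  nrm a b (fun x => w x - v x) <= e -> nrm a b (fun x => w1 x - v1 x) <= e ->
  nrm a b (fun x => u x + w x - 2 * v x) <= e ^+ 2 ->
  nrm a b (fun x => field u x + field w x - 2 * field v x) <= L * e ^+ 2.
Proof.
move=> M0; have [L L0 sd] := NF_second_diff beta sigma1 M0.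
have [K0 K00 k0] := ccont_bounded a b (let: And3 h _ _ := W01 in h).
have open_closed x : a < x < b -> a <= x <= b by case/andP => /ltW -> /ltW ->.
pose s := Num.sqrt (b - a).
have s0 : 0 <= s by exact: sqrtr_ge0.
have si0 : 0 <= s^-1 by rewrite invr_ge0.
pose S := s^-1 + s.
have S0 : 0 <= S by exact: addr_ge0.
exists ((K0 + L + L * S) * 3) => [|u u1 v v1 w w1 e hu hv hw uM vM wM e0 n1 n1' n2 n2' n3]; first by nonneg.
have Lu := L2_C1 hu; have Lw := L2_C1 hw; have Lv := L2_C1 hv.
have L2v : L2 a b (fun x => 2 * v x) by exact: L2Z.
have sup z z1 : C1 a b z z1 -> nrm a b (fun x => z x - v x) <= e -> nrm a b (fun x => z1 x - v1 x) <= e ->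
    forall x, a < x < b -> cmod (z x - v x) <= S * e.
  move=> hz m1 m2 x xab; have hd := C1B hz hv.
  apply: (le_trans (sup_le_H1 ab (C1_H1 hd) (open_closed x xab))).
  by rewrite /S mulrDl lerD// ler_wpM2l.
have supu := sup u u1 hu n1 n1'; have supw := sup w w1 hw n2 n2'.
have Se0 : 0 <= S * e by nonneg.
have Ld1 := L2B Lu Lv; have Ld2 := L2B Lw Lv; have Ld3 := L2B (L2D Lu Lw) L2v.
have LDG : L2 a b (fun x => field u x + field w x - 2 * field v x).
  by apply: L2B; [apply: L2D; apply: L2_field; eassumption|apply: L2Z; apply: L2_field; eassumption].
have zS (z : R -> R[i]) : L2 a b z -> nrm a b z <= e ->
    nrm a b (fun x => e%:C * z x) <= e ^+ 2.
  move=> hz hn; rewrite nrmZ// cmod_real ger0_norm// expr2.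
  by rewrite ler_wpM2l.
apply: (@le_trans _ _ ((K0 + L + L * S) * (nrm a b (fun x => u x + w x - 2 * v x) +
    nrm a b (fun x => e%:C * (u x - v x)) + nrm a b (fun x => e%:C * (w x - v x))))).
  apply: nrm_dom3 => //; [exact: L2Z|exact: L2Z|by nonneg|].
  move=> x xab; rewrite /field.
  have -> : W0 x * u x + N (u x) + (W0 x * w x + N (w x)) - 2 * (W0 x * v x + N (v x)) =
    W0 x * (u x + w x - 2 * v x) + (N (u x) + N (w x) - 2 * N (v x)) by ring.
  apply: (le_trans (cmodD _ _)).
  have h1 : cmod (W0 x * (u x + w x - 2 * v x)) <= K0 * cmod (u x + w x - 2 * v x).
    by rewrite cmodM ler_wpM2r ?cmod_ge0 ?k0 ?open_closed.
  have h2 := sd _ _ _ (uM x xab) (vM x xab) (wM x xab).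
  have h3 := supu x xab; have h4 := supw x xab.
  rewrite [cmod (e%:C * _)]cmodM [cmod (e%:C * (w x - v x))]cmodM cmod_real (ger0_norm e0).
  have q1 : cmod (u x - v x) ^+ 2 <= S * (e * cmod (u x - v x)).
    by rewrite expr2 mulrA ler_wpM2r ?cmod_ge0.
  have q2 : cmod (w x - v x) ^+ 2 <= S * (e * cmod (w x - v x)).
    by rewrite expr2 mulrA ler_wpM2r ?cmod_ge0.
  move: (cmod_ge0 (u x + w x - 2 * v x)) (cmod_ge0 (u x - v x)) (cmod_ge0 (w x - v x)) h1 h2 q1 q2.
  move: (cmod (u x + w x - 2 * v x)) (cmod (u x - v x)) (cmod (w x - v x)) => A B C A0 B0 C0 h1 h2 q1 q2.
  have eB0 : 0 <= e * B by exact: mulr_ge0.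
  have eC0 : 0 <= e * C by exact: mulr_ge0.
  have LSA0 : 0 <= L * S * A by nonneg.
  have LB0 : 0 <= (K0 + L) * (e * B + e * C) by nonneg.
  have LQ : L * (A + B ^+ 2 + C ^+ 2) <= L * (A + S * (e * B) + S * (e * C)).
    by rewrite ler_wpM2l// !lerD.
  rewrite (_ : (K0 + L + L * S) * _ = K0 * A + L * (A + S * (e * B) + S * (e * C)) + L * S * A +
    (K0 + L) * (e * B + e * C)); last by ring.
  lra.
rewrite -mulrA ler_wpM2l//; first by nonneg.
have z1 := zS _ Ld1 n1; have z2 := zS _ Ld2 n2.
lra.
Qed.

End Field.

(** * Curves in [L^2] *)

Section Curves.
Context {R : realType}.
Implicit Types (f g : R -> R) (c d t s : R).
Local Notation RE := complex.Re.

Lemma within_cont_eps f c d :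
  (forall t, c <= t <= d -> forall e : R, 0 < e -> exists2 r : R, 0 < r &
    forall s, c <= s <= d -> `|s - t| < r -> `|f s - f t| <= e) ->
  {within `[c, d], continuous f}.
Proof.
move=> H; apply/subspace_continuousP => t; rewrite /= in_itv /= => tI.
apply/cvgrPdist_le => e e0; have [r r0 h] := H t tI e e0.
rewrite /= near_withinE; exists r => // s /= sr; rewrite in_itv /= => sI.
by rewrite distrC; apply: h => //; rewrite distrC.
Qed.

Lemma bounded_eps f c d : c <= d ->
  (forall t, c <= t <= d -> forall e : R, 0 < e -> exists2 r : R, 0 < r &
    forall s, c <= s <= d -> `|s - t| < r -> `|f s - f t| <= e) ->
  exists2 K : R, 0 <= K & forall t, c <= t <= d -> f t <= K.
Proof.
move=> cd /within_cont_eps /(EVT_max cd)[t _ h].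
exists (Num.max 0 (f t)) => [|s sI]; first by rewrite le_max lexx.
by rewrite le_max (h s) ?orbT.
Qed.

Lemma mvt_eps f f' c d : c < d -> (forall t, c < t < d -> is_derive t 1 f (f' t)) ->
  (forall t, c <= t <= d -> forall e : R, 0 < e -> exists2 r : R, 0 < r &
    forall s, c <= s <= d -> `|s - t| < r -> `|f s - f t| <= e) ->
  exists2 t : R, c < t < d & f d - f c = f' t * (d - c).
Proof.
move=> cd df /within_cont_eps cf.
have dI t : t \in `]c, d[ -> is_derive t 1 f (f' t) by rewrite in_itv /= => /df.
by have [t tI E] := MVT cd dI cf; exists t.
Qed.

Context (a b : R).
Implicit Types (X Y : R -> R -> R[i]).

Definition L2cont c d X := forall t, c <= t <= d -> L2 a b (X t) /\
  forall e : R, 0 < e -> exists2 r : R, 0 < r &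
    forall s, c <= s <= d -> `|s - t| < r -> nrm a b (fun x => X s x - X t x) <= e.

Definition L2der c d X Y := forall t, c <= t <= d -> [/\ L2 a b (X t), L2 a b (Y t) &
  forall e : R, 0 < e -> exists2 r : R, 0 < r &
    forall s, c <= s <= d -> `|s - t| < r ->
      nrm a b (fun x => X s x - X t x - (s - t)%:C * Y t x) <= e * `|s - t|].

Lemma L2cont_bounded c d X : c <= d -> L2cont c d X ->
  exists2 K : R, 0 <= K & forall t, c <= t <= d -> nrm a b (X t) <= K.
Proof.
move=> cd cX; apply: (@bounded_eps (fun t => nrm a b (X t))) => // t tI e e0.
have [Lt /(_ e e0)[r r0 h]] := cX t tI; exists r => // s sI st.
have [Ls _] := cX s sI.
by apply: le_trans (nrm_dist Ls Lt) _; exact: h.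
Qed.

(** A curve moves no faster than its velocity: test the displacement [w] against
    itself and apply the mean value theorem to the inner product with [w]. *)
Lemma L2_mvt c d X Y (K : R) : c <= d -> L2der c d X Y ->
  (forall t, c <= t <= d -> nrm a b (Y t) <= K) ->
  nrm a b (fun x => X d x - X c x) <= K * (d - c).
Proof.
rewrite le_eqVlt => /predU1P[<-|cd] hX YK.
  have [|Lc _ _] := hX c; first by rewrite lexx.
  rewrite subrr mulr0 -[leRHS](_ : nrm a b (fun x => 0 * X c x) = 0).
    by apply: nrm_le => [||x _]; rewrite ?subrr ?mul0r//; [exact: L2B|exact: L2Z].
  by rewrite nrmZ// cmod0 mul0r.
have cI : c <= c <= d by rewrite lexx ltW.
have dI : c <= d <= d by rewrite lexx ltW.
have [Lc LYc _] := hX c cI; have [Ld _ _] := hX d dI.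
set w := (fun x => X d x - X c x); have Lw : L2 a b w by exact: L2B.
have K0 : 0 <= K by apply: le_trans (YK c cI); exact: nrm_ge0.
pose f t := RE (cip a b (X t) w); pose f' t := RE (cip a b (Y t) w).
have ip_le z : L2 a b z -> `|RE (cip a b z w)| <= nrm a b z * nrm a b w.
  move=> hz; apply: le_trans (Re_le_cmod _) _; exact: cauchy_schwarz.
have W0 := nrm_ge0 a b w.
have W10 : 0 < nrm a b w + 1 by exact: ltr_wpDl.
have est t : c <= t <= d -> forall e : R, 0 < e -> exists2 r : R, 0 < r &
    forall s, c <= s <= d -> `|s - t| < r -> `|f s - f t - (s - t) * f' t| <= e * `|s - t|.
  move=> tI e e0; have [Lt LYt /(_ (e / (nrm a b w + 1)))[|r r0 h]] := hX t tI.
    by rewrite divr_gt0.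
  exists r => // s sI st; have [Ls _ _] := hX s sI.
  have Lst := L2B Ls Lt; have LZ := L2Z (s - t)%:C LYt.
  have -> : f s - f t - (s - t) * f' t = RE (cip a b (fun x => X s x - X t x - (s - t)%:C * Y t x) w).
    by rewrite (cipBl Lst LZ Lw) (cipBl Ls Lt Lw) (cipZl _ LYt Lw) !cReB cReMl.
  apply: le_trans (ip_le _ (L2B Lst LZ)) _.
  apply: le_trans (ler_wpM2r W0 (h s sI st)) _.
  set n := nrm a b w in W0 W10 *.
  have -> : e / (n + 1) * `|s - t| * n = e * `|s - t| * (n / (n + 1)) by ring.
  by rewrite ler_piMr ?mulr_ge0 ?(ltW e0)// ler_pdivrMr//; lra.
have df t : c < t < d -> is_derive t 1 f (f' t).
  case/andP => ct td; have tI : c <= t <= d by rewrite !ltW.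
  apply: is_derive_eps => e e0; have [r r0 h] := est t tI e e0.
  exists (Num.min r (Num.min (t - c) (d - t))) => [|s].
    by rewrite !lt_min r0 !subr_gt0 ct.
  rewrite !lt_min => /andP[sr /andP[]]; rewrite !ltr_norml => /andP[h1 _] /andP[_ h2].
  by apply: h => //; lra.
have cf t : c <= t <= d -> forall e : R, 0 < e -> exists2 r : R, 0 < r &
    forall s, c <= s <= d -> `|s - t| < r -> `|f s - f t| <= e.
  move=> tI e e0; have [r r0 h] := est t tI 1 ltr01.
  have k0 : 0 < 1 + `|f' t| by exact: ltr_pwDl.
  exists (Num.min r (e / (1 + `|f' t|))) => [|s sI]; first by rewrite lt_min r0 divr_gt0.
  rewrite lt_min ltr_pdivlMr// => /andP[sr se].
  have := h s sI sr; rewrite mul1r => h1.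
  rewrite -(subrK ((s - t) * f' t) (f s - f t)) (le_trans (ler_normD _ _))// normrM.
  by apply: le_trans (ltW se); rewrite mulrDr mulr1 lerD2r.
have [t /andP[ct td] E] := mvt_eps cd df cf.
have tI : c <= t <= d by rewrite !ltW.
have [_ LYt _] := hX t tI.
have W2 : nrm a b w ^+ 2 = f d - f c.
  by rewrite /f -cReB -cipBl// -/w cip_self.
have : nrm a b w * nrm a b w <= K * (d - c) * nrm a b w.
  rewrite -expr2 W2 E mulrAC ler_wpM2r//; first by rewrite subr_ge0 ltW.
  apply: le_trans (ler_norm _) _; apply: le_trans (ip_le _ LYt) _.
  by rewrite ler_wpM2r// YK.
have [->|W] := eqVneq (nrm a b w) 0; first by move=> _; rewrite mulr_ge0// subr_ge0 ltW.
by rewrite ler_pM2r// lt_neqAle eq_sym W.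
Qed.

Lemma L2der_sub c d c' d' X Y : c <= c' -> d' <= d -> L2der c d X Y -> L2der c' d' X Y.
Proof.
move=> cc dd H t /andP[t1 t2]; have sub s : c' <= s <= d' -> c <= s <= d.
  by case/andP => s1 s2; rewrite (le_trans cc)// (le_trans s2).
have [|LX LY h] := H t; first by rewrite sub// t1.
by split=> // e /h[r r0 h']; exists r => // s /sub; exact: h'.
Qed.

Lemma L2_lip c d X Y (K : R) : L2der c d X Y ->
  (forall t, c <= t <= d -> nrm a b (Y t) <= K) ->
  forall s t, c <= s <= d -> c <= t <= d -> nrm a b (fun x => X t x - X s x) <= K * `|t - s|.
Proof.
move=> H YK; have main s t : c <= s <= d -> c <= t <= d -> s <= t ->
    nrm a b (fun x => X t x - X s x) <= K * `|t - s|.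
  move=> /andP[cs sd] /andP[ct td] st; rewrite ger0_norm ?subr_ge0//.
  apply: (L2_mvt st (L2der_sub cs td H)) => r /andP[sr rt].
  by rewrite YK// (le_trans cs)// (le_trans rt).
move=> s t sI tI; have [st|ts] := leP s t; first exact: main.
by rewrite nrm_distC distrC; apply: main => //; exact: ltW.
Qed.

(** The mean value inequality for [X r - (r - t) Y t], whose velocity [Y r - Y t] is at most
    [K |s - t|] between [t] and [s]. *)
Lemma L2_taylor c d X Y (K : R) : 0 <= K -> L2der c d X Y ->
  (forall s t, c <= s <= d -> c <= t <= d -> nrm a b (fun x => Y t x - Y s x) <= K * `|t - s|) ->
  forall t s, c <= t <= d -> c <= s <= d ->
  nrm a b (fun x => X s x - X t x - (s - t)%:C * Y t x) <= K * (s - t) ^+ 2.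
Proof.
move=> K0 H YK t s tI sI.
have [LXt LYt _] := H t tI.
pose Z r x := X r x - (r - t)%:C * Y t x.
have HZ : L2der c d Z (fun r x => Y r x - Y t x).
  move=> r rI; have [LXr LYr h] := H r rI; split.
  - exact/L2B/L2Z.
  - exact: L2B.
  move=> e /h[q q0 h']; exists q => // p pI /(h' p pI); apply: le_trans.
  have [LXp _ _] := H p pI.
  rewrite le_eqVlt; apply/orP; left; apply/eqP; congr (nrm a b _); apply/funext => x.
  by rewrite /Z !rcB; ring.
have seg p q : c <= p <= d -> c <= q <= d -> p <= q -> (forall r, p <= r <= q -> `|r - t| <= `|s - t|) ->
    nrm a b (fun x => Z q x - Z p x) <= K * `|s - t| * (q - p).
  move=> /andP[cp pd] /andP[cq qd] pq hr; apply: (L2_mvt pq (L2der_sub cp qd HZ)) => r /andP[pr rq].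
  have rI : c <= r <= d by rewrite (le_trans cp)// (le_trans rq).
  by apply: (le_trans (YK t r tI rI)); rewrite ler_wpM2l// hr// pr.
have EZ : (fun x => X s x - X t x - (s - t)%:C * Y t x) = (fun x => Z s x - Z t x).
  by apply/funext => x; rewrite /Z subrr mul0r subr0 addrAC.
rewrite EZ -[_ ^+ 2](real_normK (num_real _)) expr2 mulrA.
have [st|ts] := leP t s.
  by rewrite {2}[`|s - t|]ger0_norm ?subr_ge0//; apply: seg => // r /andP[r1 r2]; rewrite !ger0_norm; lra.
have E : `|s - t| = t - s by rewrite distrC gtr0_norm// subr_gt0.
rewrite nrm_distC {2}E.
by apply: seg => //; [exact: ltW|move=> r /andP[r1 r2]; rewrite !ler0_norm; lra].
Qed.

End Curves.

(** * From Sobolev norms to derivatives of curves *)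

Section SobolevCurves.
Context {R : realType} (a b : R).
Hypothesis ab : a < b.
Implicit Types (u v g : R -> R[i]) (c d t s e : R).

Lemma L2norm_lt u e : L2 a b u -> (L2norm a b u < e%:E)%E -> nrm a b u < e.
Proof. by move=> /L2normE ->; rewrite lte_fin. Qed.

Lemma sum_L2norm m (D : nat -> R -> R[i]) : (forall k, (k <= m)%N -> L2 a b (D k)) ->
  sqrte (\sum_(k < m.+1) L2norm a b (D k) ^+ 2)%E =
  (Num.sqrt (\sum_(k < m.+1) nrm a b (D k) ^+ 2))%:E.
Proof.
move=> LD; rewrite (eq_bigr (fun k : 'I_m.+1 => (nrm a b (D k) ^+ 2)%:E)); last first.
  by move=> k _; rewrite L2normE ?EFin_expe//; apply: LD; rewrite -ltnS.
by rewrite sumEFin.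
Qed.

(** All families of weak derivatives agree almost everywhere, so one element of the set
    of which [Hnorm] is the infimum determines all the norms. *)
Lemma Hnorm_lt m u e : (Hnorm a b m u < e%:E)%E ->
  forall k g, (k <= m)%N -> is_wderiv a b k u g -> nrm a b g < e.
Proof.
move=> /ereal_inf_lt[_ [D hD <-]] He k g km hg.
have LD j : (j <= m)%N -> L2 a b (D j) by move=> /hD[].
move: He; rewrite sum_L2norm// lte_fin; apply: le_lt_trans.
rewrite (nrm_ae (wderiv_uniq hg (hD k km))).
rewrite -[leLHS](ger0_norm (nrm_ge0 _ _ _)) -sqrtr_sqr ler_wsqrtr//.
rewrite (bigD1 (Ordinal (km : (k < m.+1)%N)))//= lerDl.
by apply: sumr_ge0 => *; exact: sqr_ge0.
Qed.

Lemma cvg0_within (F : R -> \bar R) (I : set R) t :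
  F s @[s --> within I (nbhs t)] --> 0%E ->
  forall e, 0 < e -> exists2 r : R, 0 < r & forall s, I s -> `|s - t| < r -> (F s < e%:E)%E.
Proof.
move=> h e e0; have : nbhs (0%E : \bar R) [set y : \bar R | (y < e%:E)%E].
  by apply: open_nbhs_nbhs; split; [exact: open_ereal_lt_ereal|rewrite /= lte_fin].
move=> /h; rewrite /= /nbhs /= /within /= => -[r r0 H]; exists r => // s Is st.
by apply: H => //=; rewrite distrC.
Qed.

Lemma cvg0_within_dnbhs (F : R -> \bar R) (I : set R) t :
  F s @[s --> within I t^'] --> 0%E ->
  forall e, 0 < e -> exists2 r : R, 0 < r & forall s, I s -> s != t -> `|s - t| < r -> (F s < e%:E)%E.
Proof.
move=> h e e0; have : nbhs (0%E : \bar R) [set y : \bar R | (y < e%:E)%E].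
  by apply: open_nbhs_nbhs; split; [exact: open_ereal_lt_ereal|rewrite /= lte_fin].
move=> /h; rewrite /= /nbhs /= /within /= => -[r r0 H]; exists r => // s Is sneq st.
by apply: H => //=; rewrite distrC.
Qed.

Lemma L2cont_Hnorm X m c d (I : set R) (u U : R -> R -> R[i]) k : (k <= m)%N ->
  (forall t, c <= t <= d -> I t) -> C0_in X (Hnorm a b m) I u ->
  (forall t, c <= t <= d -> is_wderiv a b k (u t) (U t)) -> L2cont a b c d U.
Proof.
move=> km cI hC hU t tI; have wt := hU t tI; split; first by case: wt.
move=> e e0; have [_ /cvg0_within /(_ e e0)[r r0 h]] := hC t (cI t tI).
exists r => // s sI st; apply: ltW; apply: (Hnorm_lt (h s (cI s sI) st) km).
by apply: wderivB => //; exact: hU.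
Qed.

Lemma diff_quotient (c : R) (p q y : R[i]) : c != 0 ->
  c%:C * (c^-1%:C * (p - q) - y) = p - q - c%:C * y.
Proof.
move=> c0; rewrite mulrBr mulrA -rcM mulfV// mul1r; ring.
Qed.

Lemma nrm_quotient (p q y : R -> R[i]) c e : L2 a b p -> L2 a b q -> L2 a b y ->
  (c != 0 -> nrm a b (fun x => c^-1%:C * (p x - q x) - y x) <= e) ->
  (c = 0 -> forall x, p x = q x) ->
  nrm a b (fun x => p x - q x - c%:C * y x) <= e * `|c|.
Proof.
move=> Lp Lq Ly h h0; have [c0|c0] := eqVneq c 0.
  rewrite c0 normr0 mulr0 -[leRHS](_ : nrm a b (fun x => 0 * y x) = 0).
    apply: nrm_le => [||x _]; first exact/L2B/L2Z/Ly/L2B.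
      exact: L2Z.
    by rewrite h0// subrr !mul0r subrr.
  by rewrite nrmZ// cmod0 mul0r.
have -> : (fun x => p x - q x - c%:C * y x) = (fun x => c%:C * (c^-1%:C * (p x - q x) - y x)).
  by apply/funext => x; rewrite diff_quotient.
rewrite nrmZ; last by apply: L2B => //; exact/L2Z/L2B.
by rewrite cmod_real mulrC ler_wpM2r// h.
Qed.

Lemma L2der_Hnorm m c d (I : set R) (u v U V : R -> R -> R[i]) k : (k <= m)%N ->
  (forall t, c <= t <= d -> I t) -> time_deriv (Hnorm a b m) I u v ->
  (forall t, c <= t <= d -> is_wderiv a b k (u t) (U t)) ->
  (forall t, c <= t <= d -> is_wderiv a b k (v t) (V t)) -> L2der a b c d U V.
Proof.
move=> km cI hD hU hV t tI; have wt := hU t tI; have wv := hV t tI.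
split; [by case: wt|by case: wv|move=> e e0].
have [r r0 h] := cvg0_within_dnbhs (hD t (cI t tI)) e0.
exists r => // s sI st; have ws := hU s sI.
apply: nrm_quotient; [by case: ws|by case: wt|by case: wv| |].
  move=> st0; apply: ltW; apply: (Hnorm_lt (h s (cI s sI) _ st) km).
    by rewrite -subr_eq0.
  by apply: wderivB => //; apply: wderivZ; exact: wderivB.
by move/eqP; rewrite subr_eq0 => /eqP ->.
Qed.

Lemma L2der_L2norm c d (I : set R) (u v : R -> R -> R[i]) :
  (forall t, c <= t <= d -> I t) -> time_deriv (L2norm a b) I u v ->
  (forall t, c <= t <= d -> L2 a b (u t)) ->
  (forall t, c <= t <= d -> L2 a b (v t)) -> L2der a b c d u v.
Proof.
move=> cI hD hu hv t tI; have Lu := hu t tI; have Lv := hv t tI.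
split=> // e e0; have [r r0 h] := cvg0_within_dnbhs (hD t (cI t tI)) e0.
exists r => // s sI st; have Ls := hu s sI.
apply: nrm_quotient => //.
  move=> st0; apply: ltW; apply: L2norm_lt (h s (cI s sI) _ st).
    by apply: L2B => //; exact/L2Z/L2B.
  by rewrite -subr_eq0.
by move/eqP; rewrite subr_eq0 => /eqP ->.
Qed.

Lemma L2cont_L2norm c d (I : set R) (u : R -> R -> R[i]) :
  (forall t, c <= t <= d -> I t) -> C0_in (L2 a b) (L2norm a b) I u -> L2cont a b c d u.
Proof.
move=> cI hC t tI; have [Lt /cvg0_within h] := hC t (cI t tI); split=> // e /h[r r0 h'].
exists r => // s sI st; have [Ls _] := hC s (cI s sI).
by apply: ltW; apply: L2norm_lt (h' s (cI s sI) st); exact: L2B.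
Qed.

(** A representative of a periodic Sobolev function all of whose derivatives but
    the last one are continuous. *)
Definition jet m (U : nat -> R -> R[i]) := [/\ forall k, (k < m)%N -> C1 a b (U k) (U k.+1),
  H1 a b (U m) (U m.+1) & forall k, (k <= m)%N -> U k a = U k b].

Lemma wderiv0 u : L2 a b u -> is_wderiv a b 0 u u.
Proof.
by move=> Lu; split=> // phi _; rewrite expr0 mul1r.
Qed.

(** Continuity on the closed interval becomes continuity on the line after extending by the
    boundary values. *)
Lemma clamp_rep (g : R -> R[i]) : {within `[a, b], continuous (fun x => complex.Re (g x))} ->
  {within `[a, b], continuous (fun x => complex.Im (g x))} ->
  exists f, ccont f /\ forall x, a <= x <= b -> f x = g x.
Proof.
move=> cR cI; pose h x := Num.max a (Num.min b x).
have hab x : a <= h x <= b.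
  by rewrite /h le_max lexx /= ge_max (ltW ab) ge_min lexx.
have ch : continuous h.
  move=> x; apply: (@continuous_max R R (fun=> a) (fun x => Num.min b x)); first exact: cvg_cst.
  by apply: (@continuous_min R R (fun=> b) id); [exact: cvg_cst|exact: cvg_id].
have comp (q : R -> R) : {within `[a, b], continuous q} -> continuous (q \o h).
  move=> /subspace_continuousP cq x.
  have hx : `[a, b]%classic (h x) by rewrite /= in_itv /= hab.
  apply/cvgrPdist_le => e e0; have /cvgrPdist_le /(_ e e0) := cq _ hx.
  rewrite near_withinE => /(ch x)[r r0 hr]; exists r => // y /hr; apply.
  by rewrite /= in_itv /= hab.
exists (fun x => g (h x)); split; first by split; [exact: comp cR|exact: comp cI].
by move=> x /andP[ax xb]; rewrite /h (min_idPr xb) (max_idPr ax).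
Qed.

(** The boundary condition provides representatives continuous up to the boundary;
    these are primitives of one another, hence classically differentiable but for the
    last. *)
Lemma Hper_jet m u : Hper a b m.+1 u -> exists U, jet m U /\
  forall k, (k <= m.+1)%N -> is_wderiv a b k u (U k).
Proof.
move=> [hm hp].
have hk k : exists g, [/\ (k <= m.+1)%N -> is_wderiv a b k u g,
    (k <= m)%N -> ccont g & (k <= m)%N -> g a = g b].
  have [km|mk] := leqP k m; last first.
    have [k1|k1] := leqP k m.+1; first by have [g hg] := hm k k1; exists g; split.
    by exists (fun=> 0); split.
  have [g [wg cR cI gab]] := hp k km.
  have [f [cf fg]] := clamp_rep cR cI; exists f; split=> // _.
    have Lf : L2 a b f by exact: L2_ccont.
    have [Lu Lg _] := wg.
    apply: (wderiv_ae Lu Lf _ _ wg); apply: aeW => x; rewrite in_itv /= => // /andP[ax xb].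
    by rewrite fg// !ltW.
  by rewrite !fg ?lexx ?ltW.
have [U HU] := choice hk; exists U.
have w k : (k <= m.+1)%N -> is_wderiv a b k u (U k) by case: (HU k).
have cU k : (k <= m)%N -> ccont (U k) by case: (HU k).
have pU k : (k <= m)%N -> U k a = U k b by case: (HU k).
have hH k : (k <= m)%N -> H1 a b (U k) (U k.+1).
  by move=> km; apply: (wderiv_H1 ab (w k (leqW km)) (w k.+1 km) (cU k km)).
split=> //; split=> // [k km|]; last exact: hH.
by apply: H1_C1; [exact: cU|exact/hH/ltnW].
Qed.

End SobolevCurves.

(** * Regularity of the exact solution *)

Section SolutionData.
Context {R : realType} (a b : R).
Hypothesis ab : a < b.
Context (psi : R -> R -> R[i]) (T : R).
Hypothesis T0 : 0 < T.
Hypothesis psi0C : Ck_in (Hper a b 4) (Hnorm a b 4) `[0, T] 0 psi.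
Hypothesis psi1C : Ck_in (Hm a b 2) (Hnorm a b 2) `[0, T] 1 psi.
Hypothesis psi2C : Ck_in (L2 a b) (L2norm a b) `[0, T] 2 psi.
Implicit Types (t s : R).

Let inI t : 0 <= t <= T -> (`[0, T]%classic : set R) t.
Proof. by rewrite /= in_itv. Qed.

Lemma uniform_bound m (P : nat -> R -> Prop) :
  (forall k K K', P k K -> K <= K' -> P k K') ->
  (forall k, (k <= m)%N -> exists2 K : R, 0 <= K & P k K) ->
  exists2 K : R, 0 <= K & forall k, (k <= m)%N -> P k K.
Proof.
move=> mono; elim: m => [|m IH] h.
  by have [K K0 PK] := h 0%N (leqnn _); exists K => // k; rewrite leqn0 => /eqP ->.
have [K K0 PK] := IH (fun k km => h k (leqW km)); have [K' K'0 PK'] := h m.+1 (leqnn _).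
exists (K + K') => [|k]; first exact: addr_ge0.
rewrite leq_eqVlt => /predU1P[->|]; first by apply: mono PK' _; rewrite lerDr.
by rewrite ltnS => /PK h'; apply: mono h' _; rewrite lerDl.
Qed.

(** The two first order Taylor remainders at [t]: the linear terms cancel. *)
Lemma psi_second_diff : exists2 K : R, 0 <= K &
  forall t s, 0 <= s -> 0 <= t - s -> t + s <= T ->
    nrm a b (fun x => psi (t + s) x + psi (t - s) x - 2 * psi t x) <= K * s ^+ 2.
Proof.
case: psi2C => [C0 [v [dv [Cv [v' [dv' [Cv' _]]]]]]].
have Lp t : 0 <= t <= T -> L2 a b (psi t) by move=> /inI /C0[].
have Lv t : 0 <= t <= T -> L2 a b (v t) by move=> /inI /Cv[].
have Lv' t : 0 <= t <= T -> L2 a b (v' t) by move=> /inI /Cv'[].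
have D1 := L2der_L2norm inI dv Lp Lv.
have D2 := L2der_L2norm inI dv' Lv Lv'.
have [K K0 hK] := L2cont_bounded (ltW T0) (L2cont_L2norm inI Cv').
have lipv := L2_lip D2 hK.
exists (2 * K) => [|t s s0 ts0 tsT]; first by rewrite mulr_ge0.
have It : 0 <= t <= T by lra.
have Ip : 0 <= t + s <= T by lra.
have Im : 0 <= t - s <= T by lra.
have tp := L2_taylor K0 D1 lipv It Ip; have tm := L2_taylor K0 D1 lipv It Im.
have e1 : t + s - t = s by ring.
have e2 : t - s - t = - s by ring.
rewrite e1 in tp; rewrite e2 in tm.
have -> : (fun x => psi (t + s) x + psi (t - s) x - 2 * psi t x) =
  (fun x => (psi (t + s) x - psi t x - s%:C * v t x) + (psi (t - s) x - psi t x - (- s)%:C * v t x)).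
  by apply/funext => x; rewrite rcN; ring.
have LZ c : L2 a b (fun x => c%:C * v t x) by exact/L2Z/Lv.
apply: le_trans (nrmD _ _) _; try by apply: L2B => //; apply: L2B; exact: Lp.
by apply: le_trans (lerD tp tm) _; rewrite sqrrN; lra.
Qed.

(** [U t k] is the representative of the [k]-th spatial derivative of [psi t]. The bounds use
    the three regularity classes in turn: values in [H^4], Lipschitz in [H^2], second
    differences in [L^2]. *)
Lemma solution_data : exists (U : R -> nat -> R -> R[i]), exists2 K : R, 0 <= K &
  [/\ forall t, 0 <= t <= T -> jet a b 3 (U t),
      forall t k, 0 <= t <= T -> (k <= 4)%N -> is_wderiv a b k (psi t) (U t k),
      forall t k, 0 <= t <= T -> (k <= 4)%N -> nrm a b (U t k) <= K,
      forall s t k, 0 <= s <= T -> 0 <= t <= T -> (k <= 2)%N ->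
        nrm a b (fun x => U t k x - U s k x) <= K * `|t - s| &
      forall t s, 0 <= s -> 0 <= t - s -> t + s <= T ->
        nrm a b (fun x => U (t + s) 0%N x + U (t - s) 0%N x - 2 * U t 0%N x) <= K * s ^+ 2].
Proof.
have exU t : exists U, 0 <= t <= T -> jet a b 3 U /\
    forall k, (k <= 4)%N -> is_wderiv a b k (psi t) (U k).
  case: (boolP (0 <= t <= T)) => tI; last by exists (fun _ _ => 0).
  have [/(_ t (inI tI))[hp _] _] := psi0C.
  by have [U hU] := Hper_jet ab hp; exists U.
have [U hU] := choice exU; exists U.
have wU t k : 0 <= t <= T -> (k <= 4)%N -> is_wderiv a b k (psi t) (U t k).
  by move=> /hU[_]; apply.
have [K1 K10 b1] : exists2 K : R, 0 <= K & forall k, (k <= 4)%N ->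
    forall t, 0 <= t <= T -> nrm a b (U t k) <= K.
  apply: (@uniform_bound 4 (fun k K => forall t, 0 <= t <= T -> nrm a b (U t k) <= K)).
    by move=> k K K' h KK t /h h'; exact: le_trans KK.
  move=> k k4; have [c0 _] := psi0C.
  exact: L2cont_bounded (ltW T0) (L2cont_Hnorm k4 inI c0 (fun t tI => wU t k tI k4)).
have [K2 K20 b2] : exists2 K : R, 0 <= K & forall k, (k <= 2)%N ->
    forall s t, 0 <= s <= T -> 0 <= t <= T ->
      nrm a b (fun x => U t k x - U s k x) <= K * `|t - s|.
  apply: (@uniform_bound 2 (fun k K => forall s t, 0 <= s <= T -> 0 <= t <= T ->
      nrm a b (fun x => U t k x - U s k x) <= K * `|t - s|)).
    move=> k K K' h KK s t sI tI; apply: le_trans (h s t sI tI) _.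
    by rewrite ler_wpM2r.
  move=> k k2; case: psi1C => _ [v [dv [cv _]]].
  have exV t : exists g, 0 <= t <= T -> is_wderiv a b k (v t) g.
    case: (boolP (0 <= t <= T)) => tI; last by exists (fun=> 0).
    by have [/(_ k k2)[g hg] _] := cv t (inI tI); exists g.
  have [V hV] := choice exV.
  have k4 : (k <= 4)%N by exact: leq_trans k2 _.
  have D1 := L2der_Hnorm k2 inI dv (fun t tI => wU t k tI k4) hV.
  have [K K0 hK] := L2cont_bounded (ltW T0) (L2cont_Hnorm k2 inI cv hV).
  by exists K => // s t sI tI; exact: L2_lip D1 hK s t sI tI.
have [K3 K30 b3] := psi_second_diff.
exists (K1 + K2 + K3); first by rewrite !addr_ge0.
split=> //.
- by move=> t /hU[].
- by move=> t k tI k4; apply: le_trans (b1 k k4 t tI) _; lra.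
- by move=> s t k sI tI k2; apply: le_trans (b2 k k2 s t sI tI) _; rewrite ler_wpM2r//; lra.
- move=> t s s0 ts0 tsT.
  have It : 0 <= t <= T by lra.
  have Ip : 0 <= t + s <= T by lra.
  have Im : 0 <= t - s <= T by lra.
  have aeU r : 0 <= r <= T -> ae_eq_on a b (U r 0%N) (psi r).
    move=> rI; have w := wU r 0%N rI isT; have [Lp _ _] := w.
    exact: wderiv_uniq w (wderiv0 Lp).
  have e1 := aeU _ It; have e2 := aeU _ Ip; have e3 := aeU _ Im.
  rewrite (@nrm_ae _ _ _ _ (fun x => psi (t + s) x + psi (t - s) x - 2 * psi t x)).
    by apply: le_trans (b3 t s s0 ts0 tsT) _; rewrite ler_wpM2r ?sqr_ge0//; lra.
  have e12 : {ae @lebesgue_measure R, forall x, x \in `]a, b[ -> U t 0%N x = psi t x /\ U (t + s) 0%N x = psi (t + s) x}.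
    by apply: aeS2 e1 e2 => x h1 h2 xab; split; [exact: h1|exact: h2].
  by apply: aeS2 e12 e3 => x h1 h2 xab; have [-> ->] := h1 xab; rewrite (h2 xab).
Qed.

End SolutionData.

(** * Local error of a diagonal oscillatory system *)

Section ScalarFacts.
Context {R : realType}.
Implicit Types (x y z : R[i]) (r t m : R).
Local Notation RE := complex.Re.

Lemma abs_sin_le t : `|sin t| <= `|t|.
Proof.
wlog t0 : t / 0 <= t.
  move=> H; have [t0|t0] := leP 0 t; first exact: H.
  by rewrite -normrN -sinN -(normrN t); apply: H; rewrite oppr_ge0 ltW.
have dI r : r \in `]0, t[ -> is_derive r 1 (sin : R -> R) (cos r) by move=> _; exact: is_derive_sin.
have cS : {within `[0, t], continuous (sin : R -> R)}.
  by apply: continuous_subspaceT; exact: continuous_sin.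
rewrite (ger0_norm t0); have [r _] := MVT_segment t0 dI cS.
rewrite sin0 !subr0 => ->; rewrite normrM (ger0_norm t0) ler_piMl//.
exact: cos_max.
Qed.

Lemma ler_wpMX (C r t : R) n : 0 <= C -> 0 < r -> r < t -> C * r ^+ n <= C * t ^+ n.
Proof.
move=> C0 r0 rt; rewrite ler_wpM2l// lerXn2r ?nnegrE//; [exact: ltW|exact: ltW (lt_trans r0 rt)|exact: ltW].
Qed.

(** The antiderivative of [cos (r m)] vanishing at [0]. *)
Definition sinc_int m r : R := if m == 0 then r else sin (r * m) / m.

Lemma is_derive_sinc_int m r : is_derive r 1 (sinc_int m) (cos (r * m)).
Proof.
rewrite /sinc_int; case: eqP => [->|/eqP m0].
  by rewrite mulr0 cos0; exact: is_derive_id.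
have h : is_derive r 1 (fun r : R => r * m) m.
  by apply: is_derive_eq; rewrite /GRing.scale /=; ring.
have h2 := @is_derive1_comp R sin (fun r => r * m) r _ _ (is_derive_sin _) h.
have -> : (fun r => sin (r * m) / m) = (fun r => m^-1 * (sin \o (fun r => r * m)) r).
  by apply/funext => q /=; rewrite mulrC.
apply: is_derive_eq; rewrite /GRing.scale /=; field => //.
Qed.

Lemma sinc_int0 m : sinc_int m 0 = 0.
Proof. by rewrite /sinc_int mul0r sin0 mul0r if_same. Qed.

Lemma abs_sinc_int m r : 0 <= r -> `|sinc_int m r| <= r.
Proof.
move=> r0; rewrite /sinc_int; case: eqP => [_|/eqP m0]; first by rewrite ger0_norm.
by rewrite normrM normrV ?unitfE// ler_pdivrMr ?normr_gt0// (le_trans (abs_sin_le _))// normrM ger0_norm.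
Qed.

(** The antiderivative of [exp (i r m)] vanishing at [0]. *)
Definition eit_int m r : R[i] := if m == 0 then r%:C else (eit (m * (r - 0)) - 1) / ('i * m%:C).

Lemma cder_eit_int m r : cder (eit_int m) r (eit (m * (r - 0))).
Proof.
rewrite /eit_int; case: eqP => [->|/eqP m0].
  by rewrite mul0r eit0; apply: (@cder_real R id r 1); exact: is_derive_id.
have m0' : m%:C != 0 :> R[i] by rewrite -cmod_eq0 cmod_real normr_eq0.
have i0 : 'i != 0 :> R[i] by rewrite -cmod_eq0 cmod_i oner_eq0.
have := cderZ ('i * m%:C)^-1 (cderB (cder_eit m 0 r) (cder_cst 1 r)).
rewrite subr0 mulrA mulVf ?mulf_neq0// mul1r.
by apply: cder_ext => q; rewrite mulrC.
Qed.

Lemma eit_int0 m : eit_int m 0 = 0.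
Proof. by rewrite /eit_int subr0 mulr0 eit0 subrr mul0r if_same. Qed.

Lemma cder_ccont (f : R -> R[i]) (l : R -> R[i]) : (forall x : R, cder f x (l x)) -> ccont f.
Proof.
move=> h; split=> x; have [h1 h2] := h x.
  by apply: differentiable_continuous; apply/derivable1_diffP; exact: ex_derive.
by apply: differentiable_continuous; apply/derivable1_diffP; exact: ex_derive.
Qed.

(** A mean value inequality for weighted Euclidean norms: apply the mean value
    theorem to the inner product of [E] with its own final value. *)
Lemma sum_mvt (I : eqType) (s : seq I) (om : I -> R) (E E' : R -> I -> R[i]) (tau K : R) :
  0 < tau -> (forall l, 0 <= om l) -> (forall l, ccont (E^~ l)) -> (forall l, E 0 l = 0) ->
  (forall r l, 0 < r < tau -> cder (E^~ l) r (E' r l)) ->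
  (forall r, 0 < r < tau -> \sum_(l <- s) om l * cmod (E' r l) ^+ 2 <= K) ->
  \sum_(l <- s) om l * cmod (E tau l) ^+ 2 <= K * tau ^+ 2.
Proof.
move=> tau0 om0 cE E0 dE bE.
pose F r := \sum_(l <- s) (om l)%:C * conjc (E tau l) * E r l.
pose F' r := \sum_(l <- s) (om l)%:C * conjc (E tau l) * E' r l.
have dF r : 0 < r < tau -> cder F r (F' r).
  by move=> rt; apply: cder_sum => l; apply: cderZ; exact: dE.
have cF : ccont F by apply: ccont_sum => l; apply: ccontM => //; exact: ccont_cst.
have dI r : r \in `]0, tau[ -> is_derive r 1 (fun r => RE (F r)) (RE (F' r)).
  by rewrite in_itv /= => /dF[].
have [r rI] := MVT tau0 dI (continuous_subspaceT (let: conj h _ := cF in h)).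
have -> : F 0 = 0 by rewrite /F big1// => l _; rewrite E0 mulr0.
rewrite subr0; set S := \sum_(l <- s) _.
have -> : RE (F tau) = S.
  rewrite /F cRe_sum; apply: eq_bigr => l _.
  by rewrite -mulrA cReMl mulrC [_ * E tau l]mulrC mul_conj mulrC.
rewrite subr0 => ES; move: rI; rewrite in_itv /= => /bE bK.
have : S <= 2^-1 * S + 2^-1 * (tau ^+ 2 * K).
  have -> : S = RE (F' r) * tau by [].
  rewrite -{2}ES; apply: (@le_trans _ _ (2^-1 * S + 2^-1 * (tau ^+ 2 * \sum_(l <- s) om l * cmod (E' r l) ^+ 2))).
    rewrite /F' cRe_sum /S !mulr_sumr mulr_suml -big_split /=; apply: ler_sum => l _.
    rewrite -mulrA cReMl.
    have h : RE (conjc (E tau l) * E' r l) <= cmod (E tau l) * cmod (E' r l).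
      apply: le_trans (ler_norm _) _; apply: le_trans (Re_le_cmod _) _.
      by rewrite cmodM cmod_conj.
    apply: (@le_trans _ _ (om l * (tau * (cmod (E tau l) * cmod (E' r l))))).
      by rewrite -mulrA ler_wpM2l// mulrC ler_wpM2l// ltW.
    rewrite [leRHS](_ : _ = om l * (2^-1 * cmod (E tau l) ^+ 2 + 2^-1 * (tau ^+ 2 * cmod (E' r l) ^+ 2))); last by ring.
    rewrite ler_wpM2l// -subr_ge0.
    rewrite (_ : _ - _ = 2^-1 * (cmod (E tau l) - tau * cmod (E' r l)) ^+ 2); last by field.
    by rewrite mulr_ge0// ?invr_ge0// sqr_ge0.
  rewrite lerD2l ler_wpM2l ?invr_ge0// ler_wpM2l ?sqr_ge0//.
by rewrite mulrC; lra.
Qed.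

End ScalarFacts.

Section LocalError.
Context {R : realType} (I : eqType) (s : seq I) (m : I -> R).
Context (c g : R -> I -> R[i]) (T K : R).
Local Notation RE := complex.Re.
Local Notation IM := complex.Im.
Hypothesis K0 : 0 <= K.
Hypothesis c_cont : forall l, ccont (c^~ l).
Hypothesis c_ode : forall (t : R) l, 0 < t < T ->
  cder (c^~ l) t (- 'i * ((m l)%:C * c t l + g t l)).
Hypothesis g_lip : forall t t', \sum_(l <- s) cmod (g t' l - g t l) ^+ 2 <= K * (t' - t) ^+ 2.
Hypothesis mg_lip : forall t t',
  \sum_(l <- s) m l ^+ 2 * cmod (g t' l - g t l) ^+ 2 <= K * (t' - t) ^+ 2.
Hypothesis g_second : forall t r : R, 0 <= r -> 0 <= t - r -> t + r <= T ->
  \sum_(l <- s) cmod (g (t + r) l + g (t - r) l - 2 * g t l) ^+ 2 <= K * r ^+ 4.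

(** Defects of the two-step and of the one-step formula, as functions of the
    step size [r], both normalized to vanish at [r = 0]: differentiating cancels the
    stiff terms [m l * c]. *)
Definition defect2 t r l : R[i] := eit (m l * (r - 0)) * c (t + r) l -
  eit (- m l * (r - 0)) * c (t - r) l + 2 * 'i * (sinc_int (m l) r)%:C * g t l.
Definition defect2' t r l : R[i] := - 'i * ((cos (r * m l))%:C * (g (t + r) l + g (t - r) l - 2 * g t l) +
  'i * (sin (r * m l))%:C * (g (t + r) l - g (t - r) l)).
Definition defect1 r l : R[i] := eit (m l * (r - 0)) * c r l - c 0 l + 'i * (eit_int (m l) r * g 0 l).
Definition defect1' r l : R[i] := - 'i * eit (m l * (r - 0)) * (g r l - g 0 l).

Lemma ii : 'i * 'i = -1 :> R[i].
Proof. by rewrite -expr2 sqr_i. Qed.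

Lemma cder_shift (f : R -> R[i]) t (e x : R) l : cder f (t + e * x) l -> cder (fun r => f (t + e * r)) x (e%:C * l).
Proof.
move=> [h1 h2].
have h : is_derive x 1 (fun r : R => t + e * r) e.
  by apply: is_derive_eq; rewrite /GRing.scale /=; ring.
split.
  by have := @is_derive1_comp R (fun y => RE (f y)) (fun r => t + e * r) x _ _ h1 h; rewrite cReMl mulrC.
by have := @is_derive1_comp R (fun y => IM (f y)) (fun r => t + e * r) x _ _ h2 h; rewrite [e%:C * l]mulrC cImMr.
Qed.

Lemma cder_defect2 t r l : 0 < t - r -> 0 < r -> t + r < T -> cder (fun r => defect2 t r l) r (defect2' t r l).
Proof.
move=> tr r0 trT.
have hp : cder (fun q => c (t + q) l) r (- 'i * ((m l)%:C * c (t + r) l + g (t + r) l)).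
  have /(c_ode l) h : 0 < t + 1 * r < T by lra.
  have := cder_shift h; rewrite !mul1r; apply: cder_ext => q; by rewrite mul1r.
have hm : cder (fun q => c (t - q) l) r ('i * ((m l)%:C * c (t - r) l + g (t - r) l)).
  have /(c_ode l) h : 0 < t + -1 * r < T by lra.
  have := cder_shift h; rewrite mulN1r rcN mulN1r mulNr opprK; apply: cder_ext => q; by rewrite mulN1r.
have hs := cder_real (is_derive_sinc_int (m l) r).
have := cderD (cderB (cderM (cder_eit (m l) 0 r) hp) (cderM (cder_eit (- m l) 0 r) hm))
  (cderM (cderZ (2 * 'i) hs) (cder_cst (g t l) r)).
rewrite mulr0 addr0 /defect2 /defect2'; set d := (X in cder _ r X -> _); set d' := (X in _ -> cder _ r X).
suff -> : d = d' by [].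
rewrite /d /d'.
have -> : eit (m l * (r - 0)) = (cos (r * m l))%:C + 'i * (sin (r * m l))%:C.
  by rewrite subr0 mulrC; apply: complex_ext; rewrite !ReImE /=; ring.
have -> : eit (- m l * (r - 0)) = (cos (r * m l))%:C - 'i * (sin (r * m l))%:C.
  by rewrite subr0 mulrC mulrN; apply: complex_ext; rewrite !ReImE /= ?cosN ?sinN; ring.
rewrite rcN; move: ii; move: 'i (cos _)%:C (sin _)%:C (c (t + r) l) (c (t - r) l) (g (t + r) l) (g (t - r) l) (g t l) (m l)%:C.
by move=> i C S cp cm gp gm gt M ii; ring.
Qed.

Lemma cder_defect1 r l : 0 < r < T -> cder (defect1^~ l) r (defect1' r l).
Proof.
move=> rT; have := cderD (cderB (cderM (cder_eit (m l) 0 r) (c_ode l rT)) (cder_cst (c 0 l) r))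
  (cderZ 'i (cderM (cder_eit_int (m l) r) (cder_cst (g 0 l) r))).
rewrite /defect1 /defect1'; set d := (X in cder _ r X -> _); set d' := (X in _ -> cder _ r X).
by suff -> : d = d' by []; rewrite /d /d'; ring.
Qed.

Lemma ccont_shift t (e : R) l : ccont (fun r => c (t + e * r) l).
Proof.
have h : continuous (fun r : R => t + e * r).
  by move=> x; apply: cvgD; [exact: cvg_cst|apply: cvgM; [exact: cvg_cst|exact: cvg_id]].
have [h1 h2] := c_cont l.
by split=> x; [apply: (continuous_comp (h x) (h1 _))|apply: (continuous_comp (h x) (h2 _))].
Qed.

Lemma ccont_defect2 t l : ccont (fun r => defect2 t r l).
Proof.
apply: ccontD; [apply: ccontB; apply: ccontM; try exact: ccont_eit|].
- by apply: (ccont_ext _ (ccont_shift t 1 l)) => x; rewrite mul1r.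
- by apply: (ccont_ext _ (ccont_shift t (-1) l)) => x; rewrite mulN1r.
apply: ccontM; last exact: ccont_cst.
apply: ccontM; first exact: ccont_cst.
exact: (cder_ccont (fun x => cder_real (is_derive_sinc_int (m l) x))).
Qed.

Lemma ccont_defect1 l : ccont (defect1^~ l).
Proof.
apply: ccontD; [apply: ccontB; [apply: ccontM; [exact: ccont_eit|exact: c_cont]|exact: ccont_cst]|].
apply: ccontM; first exact: ccont_cst.
apply: ccontM; last exact: ccont_cst.
exact: (cder_ccont (cder_eit_int (m l))).
Qed.

Lemma defect2_0 t l : defect2 t 0 l = 0.
Proof. by rewrite /defect2 subr0 !mulr0 eit0 addr0 subr0 !mul1r subrr sinc_int0 mulr0 mul0r add0r. Qed.

Lemma defect1_0 l : defect1 0 l = 0.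
Proof. by rewrite /defect1 subr0 !mulr0 eit0 mul1r subrr eit_int0 mul0r mulr0 add0r. Qed.

Lemma cmod_defect2' t r l : cmod (defect2' t r l) ^+ 2 <=
  2 * cmod (g (t + r) l + g (t - r) l - 2 * g t l) ^+ 2 +
  2 * (`|sin (r * m l)| ^+ 2 * cmod (g (t + r) l - g (t - r) l) ^+ 2).
Proof.
rewrite cmodM cmodN cmod_i mul1r; apply: le_trans (cmod_sqrD _ _) _.
rewrite !(cmodM, cmod_real, cmod_i) mul1r !exprMn lerD//.
rewrite ler_wpM2l// ler_piMl ?sqr_ge0// expr_le1// ?normr_ge0//; exact: cos_max.
Qed.

(** Uses [|sin (r m)| <= r m]: the difference of [g] is then measured with the weight [m],
    and the derivative of the defect is of order [r^2]. *)
Lemma defect2_bound t tau : 0 < tau -> 0 <= t - tau -> t + tau <= T ->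
  \sum_(l <- s) cmod (defect2 t tau l) ^+ 2 <= 10 * K * tau ^+ 6.
Proof.
move=> tau0 t0 tT.
have := @sum_mvt R I s (fun=> 1) (defect2 t) (defect2' t) tau (10 * K * tau ^+ 4) tau0 (fun=> ler01)
  (ccont_defect2 t) (defect2_0 t).
under eq_bigr do rewrite mul1r.
rewrite -(mulrA _ (tau ^+ _)) -exprD; apply=> [r l /andP[r0 rt]|r /andP[r0 rt]]; first by apply: cder_defect2; lra.
apply: (@le_trans _ _ (10 * K * r ^+ 4)); last first.
  by apply: ler_wpMX => //; rewrite mulr_ge0.
have h1 : \sum_(l <- s) cmod (g (t + r) l + g (t - r) l - 2 * g t l) ^+ 2 <= K * r ^+ 4.
  by apply: g_second; lra.
have h2 : \sum_(l <- s) m l ^+ 2 * cmod (g (t + r) l - g (t - r) l) ^+ 2 <= K * (2 * r) ^+ 2.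
  by have := mg_lip (t - r) (t + r); rewrite (_ : t + r - (t - r) = 2 * r)//; ring.
have h3 : \sum_(l <- s) `|sin (r * m l)| ^+ 2 * cmod (g (t + r) l - g (t - r) l) ^+ 2 <= r ^+ 2 * (K * (2 * r) ^+ 2).
  apply: (@le_trans _ _ (r ^+ 2 * \sum_(l <- s) m l ^+ 2 * cmod (g (t + r) l - g (t - r) l) ^+ 2)).
    rewrite mulr_sumr; apply: ler_sum => l _; rewrite mulrA ler_wpM2r ?sqr_ge0//.
    by rewrite -exprMn -[leRHS]real_normK ?num_real// lerXn2r ?nnegrE// abs_sin_le.
  by rewrite ler_wpM2l ?sqr_ge0.
apply: (@le_trans _ _ (2 * (K * r ^+ 4) + 2 * (r ^+ 2 * (K * (2 * r) ^+ 2)))).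
  apply: le_trans (lerD (ler_wpM2l _ h1) (ler_wpM2l _ h3)) => //.
  rewrite !mulr_sumr -big_split /=; apply: ler_sum => l _; rewrite mul1r; exact: cmod_defect2'.
by rewrite le_eqVlt; apply/orP; left; apply/eqP; ring.
Qed.

(** With the weight [m] on the defect, the sine is bounded by one and only first differences
    of [g] are available: one order less. *)
Lemma mdefect2_bound t tau : 0 < tau -> 0 <= t - tau -> t + tau <= T ->
  \sum_(l <- s) m l ^+ 2 * cmod (defect2 t tau l) ^+ 2 <= 16 * K * tau ^+ 4.
Proof.
move=> tau0 t0 tT.
have := @sum_mvt R I s (fun l => m l ^+ 2) (defect2 t) (defect2' t) tau (16 * K * tau ^+ 2) tau0
  (fun l => sqr_ge0 (m l)) (ccont_defect2 t) (defect2_0 t).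
rewrite -(mulrA _ (tau ^+ _)) -exprD; apply=> [r l /andP[r0 rt]|r /andP[r0 rt]]; first by apply: cder_defect2; lra.
apply: (@le_trans _ _ (16 * K * r ^+ 2)); last first.
  by apply: ler_wpMX => //; rewrite mulr_ge0.
have h1 : \sum_(l <- s) m l ^+ 2 * cmod (g (t + r) l - g t l) ^+ 2 <= K * r ^+ 2.
  by have := mg_lip t (t + r); rewrite (_ : t + r - t = r)//; ring.
have h2 : \sum_(l <- s) m l ^+ 2 * cmod (g (t - r) l - g t l) ^+ 2 <= K * r ^+ 2.
  by have := mg_lip t (t - r); rewrite (_ : t - r - t = - r) ?sqrrN//; ring.
have h3 : \sum_(l <- s) m l ^+ 2 * cmod (g (t + r) l - g (t - r) l) ^+ 2 <= K * (2 * r) ^+ 2.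
  by have := mg_lip (t - r) (t + r); rewrite (_ : t + r - (t - r) = 2 * r)//; ring.
apply: (@le_trans _ _ (4 * (K * r ^+ 2) + 4 * (K * r ^+ 2) + 2 * (K * (2 * r) ^+ 2))); last first.
  by rewrite le_eqVlt; apply/orP; left; apply/eqP; ring.
apply: le_trans (lerD (lerD (ler_wpM2l _ h1) (ler_wpM2l _ h2)) (ler_wpM2l _ h3)) => //.
rewrite !mulr_sumr -!big_split /=; apply: ler_sum => l _.
rewrite ![_ * (m l ^+ 2 * _)]mulrCA -!mulrDr ler_wpM2l ?sqr_ge0//.
apply: le_trans (cmod_defect2' _ _ _) _; rewrite lerD//.
  have -> : g (t + r) l + g (t - r) l - 2 * g t l = (g (t + r) l - g t l) + (g (t - r) l - g t l) by ring.
  have := cmod_sqrD (g (t + r) l - g t l) (g (t - r) l - g t l); lra.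
by rewrite ler_wpM2l// ler_piMl ?sqr_ge0// expr_le1// ?normr_ge0//; exact: sin_max.
Qed.

Lemma cmod_defect1' r l : cmod (defect1' r l) = cmod (g r l - g 0 l).
Proof. by rewrite !cmodM cmodN cmod_i cmod_eit !mul1r. Qed.

Lemma defect1_bound tau : 0 < tau -> tau <= T ->
  \sum_(l <- s) cmod (defect1 tau l) ^+ 2 <= K * tau ^+ 4.
Proof.
move=> tau0 tT.
have := @sum_mvt R I s (fun=> 1) defect1 defect1' tau (K * tau ^+ 2) tau0 (fun=> ler01)
  ccont_defect1 defect1_0.
under eq_bigr do rewrite mul1r.
rewrite -(mulrA _ (tau ^+ _)) -exprD; apply=> [r l /andP[r0 rt]|r /andP[r0 rt]].
  by apply: cder_defect1; rewrite r0 (lt_le_trans rt).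
under eq_bigr do rewrite mul1r cmod_defect1'.
apply: le_trans (g_lip 0 r) _; rewrite subr0.
exact: ler_wpMX.
Qed.

Lemma mdefect1_bound tau : 0 < tau -> tau <= T ->
  \sum_(l <- s) m l ^+ 2 * cmod (defect1 tau l) ^+ 2 <= K * tau ^+ 4.
Proof.
move=> tau0 tT.
have := @sum_mvt R I s (fun l => m l ^+ 2) defect1 defect1' tau (K * tau ^+ 2) tau0
  (fun l => sqr_ge0 (m l)) ccont_defect1 defect1_0.
rewrite -(mulrA _ (tau ^+ _)) -exprD; apply=> [r l /andP[r0 rt]|r /andP[r0 rt]].
  by apply: cder_defect1; rewrite r0 (lt_le_trans rt).
under eq_bigr do rewrite cmod_defect1'.
apply: le_trans (mg_lip 0 r) _; rewrite subr0.
exact: ler_wpMX.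
Qed.

End LocalError.

(** * Consistency *)

Section Consistency.
Context {R : realType} (a b : R).
Hypothesis ab : a < b.
Context (W : nat -> R -> R[i]) (beta sigma : R).
Hypothesis W_jet : jet a b 1 W.
Hypothesis sigma1 : 1 <= sigma.
Context (U : R -> nat -> R -> R[i]) (T K : R).
Hypothesis K0 : 0 <= K.
Hypothesis U_jet : forall t, jet a b 3 (U t).
Hypothesis U_bound : forall t k, (k <= 4)%N -> nrm a b (U t k) <= K.
Hypothesis U_lip : forall s t k, (k <= 2)%N ->
  nrm a b (fun x => U t k x - U s k x) <= K * `|t - s|.
Hypothesis U_second : forall t s, 0 <= s -> 0 <= t - s -> t + s <= T ->
  nrm a b (fun x => U (t + s) 0%N x + U (t - s) 0%N x - 2 * U t 0%N x) <= K * s ^+ 2.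
Implicit Types (t : R) (l : int) (s : seq int).

Local Notation F := (field (W 0%N) beta sigma).

Let W01 : C1 a b (W 0%N) (W 1%N). Proof. by case: W_jet => h _ _; exact: h. Qed.
Let W12 : H1 a b (W 1%N) (W 2). Proof. by case: W_jet. Qed.
Let W0per : W 0%N a = W 0%N b. Proof. by case: W_jet => _ _; exact. Qed.
Let W1per : W 1%N a = W 1%N b. Proof. by case: W_jet => _ _; exact. Qed.

Lemma U_C1 t k : (k < 3)%N -> C1 a b (U t k) (U t k.+1).
Proof. by case: (U_jet t) => h _ _; exact: h. Qed.

Lemma U_H1 t k : (k <= 3)%N -> H1 a b (U t k) (U t k.+1).
Proof.
rewrite leq_eqVlt => /predU1P[->|k3]; first by case: (U_jet t).
by apply: C1_H1; exact: U_C1.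
Qed.

Lemma U_per t k : (k <= 3)%N -> U t k a = U t k b.
Proof. by case: (U_jet t) => _ _; exact. Qed.

Definition sobolev_cst : R := (Num.sqrt (b - a))^-1 + Num.sqrt (b - a).

Lemma sobolev_cst_gt0 : 0 < sobolev_cst.
Proof.
have s0 : 0 < Num.sqrt (b - a) by rewrite sqrtr_gt0 subr_gt0.
by rewrite /sobolev_cst addr_gt0 ?invr_gt0.
Qed.

Lemma sobolev u u' x : H1 a b u u' -> a < x < b ->
  cmod (u x) <= sobolev_cst * (nrm a b u + nrm a b u').
Proof.
move=> hu /andP[ax xb]; have xab : a <= x <= b by rewrite !ltW.
apply: le_trans (sup_le_H1 ab hu xab) _; rewrite /sobolev_cst.
have s0 : 0 <= Num.sqrt (b - a) := sqrtr_ge0 _.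
have i0 : 0 <= (Num.sqrt (b - a))^-1 by rewrite invr_ge0.
have n0 := nrm_ge0 a b u; have n1 := nrm_ge0 a b u'.
have h1 := mulr_ge0 s0 n0; have h2 := mulr_ge0 i0 n1.
lra.
Qed.

Definition sup_cst : R := sobolev_cst * (K + K).

Lemma U_sup t k : (k <= 3)%N -> bounded_by a b sup_cst (U t k).
Proof.
move=> k3 x xab; apply: le_trans (sobolev (U_H1 t k3) xab) _.
rewrite /sup_cst ler_wpM2l ?(ltW sobolev_cst_gt0)//.
by apply: lerD; apply: U_bound => //; exact: leq_trans k3 _.
Qed.

Lemma sup_cst_ge0 : 0 <= sup_cst.
Proof. by rewrite mulr_ge0 ?addr_ge0// ltW// sobolev_cst_gt0. Qed.

Lemma fcoef_F2 t l : fcoef a b (field2 (W 0%N) (W 1%N) (W 2) beta sigma (U t 0%N) (U t 1%N) (U t 2)) l =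
  - (mu a b l ^+ 2)%:C * fcoef a b (F (U t 0%N)) l.
Proof.
rewrite (fcoef_field2 ab beta W01 W12 W0per W1per sigma1)//; try exact: U_C1; try exact: U_per.
rewrite mulrA; congr (_ * _); rewrite rcX; transitivity (('i * 'i) * (mu a b l)%:C ^+ 2); first by ring.
by rewrite -expr2 sqr_i; ring.
Qed.

Lemma bessel_le u s (e : R) : L2 a b u -> uniq s -> nrm a b u <= e ->
  \sum_(l <- s) cmod (fcoef a b u l) ^+ 2 <= (b - a)^-1 * e ^+ 2.
Proof.
move=> Lu us ue; have ba : 0 < b - a by rewrite subr_gt0.
rewrite ler_pdivlMl//; apply: le_trans (bessel ab Lu us) _.
have e0 : 0 <= e by apply: le_trans ue; exact: nrm_ge0.
by rewrite lerXn2r ?nnegrE ?nrm_ge0.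
Qed.

Lemma cmod_negM (r : R) (z : R[i]) : cmod (- r%:C * z) ^+ 2 = r ^+ 2 * cmod z ^+ 2.
Proof. by rewrite cmodM cmodN cmod_real exprMn real_normK ?num_real. Qed.

Lemma L2_F t : L2 a b (F (U t 0%N)).
Proof. exact: (L2_field beta W01 sigma1 (@U_C1 t 0 isT)). Qed.

(** Bessel's inequality turns the [L^2] and [H^2] bounds on the field along the solution into
    the bounds on its coefficients that the local error needs; the weight [mu^2]
    comes from the second derivative, the field being periodic with its first one. *)
Lemma coef_estimates : exists2 K' : R, 0 <= K' & forall s, uniq s ->
  let g t l := fcoef a b (F (U t 0%N)) l in
  [/\ forall t t', \sum_(l <- s) cmod (g t' l - g t l) ^+ 2 <= K' * (t' - t) ^+ 2,
      forall t t', \sum_(l <- s) (mu a b l ^+ 2) ^+ 2 * cmod (g t' l - g t l) ^+ 2 <= K' * (t' - t) ^+ 2 &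
      forall t r, 0 <= r -> 0 <= t - r -> t + r <= T ->
        \sum_(l <- s) cmod (g (t + r) l + g (t - r) l - 2 * g t l) ^+ 2 <= K' * r ^+ 4].
Proof.
have M0 := sup_cst_ge0.
have [L1 L10 b1] := field_lip beta W01 sigma1 M0.
have [L2' L20 b2] := field2_lip ab beta W01 W12 sigma1 M0.
have [L3 L30 b3] := field_second_diff ab beta W01 sigma1 M0.
have ba : 0 <= (b - a)^-1 by rewrite invr_ge0 subr_ge0 ltW.
pose K1 := (b - a)^-1 * (L1 * K) ^+ 2.
pose K2 := (b - a)^-1 * (L2' * (3 * K)) ^+ 2.
pose K3 := (b - a)^-1 * (L3 * (K + 1) ^+ 2) ^+ 2.
have K10 : 0 <= K1 by rewrite mulr_ge0// sqr_ge0.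
have K20 : 0 <= K2 by rewrite mulr_ge0// sqr_ge0.
have K30 : 0 <= K3 by rewrite mulr_ge0// sqr_ge0.
exists (K1 + K2 + K3); first by rewrite !addr_ge0.
move=> s us g; split.
- move=> t t'; apply: (@le_trans _ _ (K1 * (t' - t) ^+ 2)).
    rewrite /K1 -mulrA -exprMn; rewrite (eq_bigr (fun l => cmod (fcoef a b (fun x => F (U t' 0%N) x - F (U t 0%N) x) l) ^+ 2)); last first.
      by move=> l _; rewrite (fcoefB l (L2_F t') (L2_F t)).
    rewrite -[(_ * (t' - t)) ^+ 2]real_normK ?num_real// normrM ger0_norm ?mulr_ge0// -mulrA.
    apply: bessel_le => //; first by apply: L2B; exact: L2_F.
    have [h _] := b1 _ _ _ _ (@U_C1 t' 0 isT) (@U_C1 t 0 isT)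
      (@U_sup t' 0 isT) (@U_sup t 0 isT) (@U_sup t 1 isT).
    apply: le_trans h _; rewrite ler_wpM2l//; exact: U_lip.
  by rewrite ler_wpM2r ?sqr_ge0//; lra.
- move=> t t'; apply: (@le_trans _ _ (K2 * (t' - t) ^+ 2)).
    rewrite /K2 -mulrA -exprMn.
    pose G t := field2 (W 0%N) (W 1%N) (W 2) beta sigma (U t 0%N) (U t 1%N) (U t 2).
    have LG r : L2 a b (G r).
      by case: (field_H1 beta W01 W12 sigma1 (@U_C1 r 0 isT) (@U_C1 r 1 isT)).
    rewrite (eq_bigr (fun l => cmod (fcoef a b (fun x => G t' x - G t x) l) ^+ 2)); last first.
      move=> l _; rewrite (fcoefB l (LG t') (LG t)) !fcoef_F2 -cmod_negM.
      by congr (cmod _ ^+ 2); exact: mulrBr.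
    rewrite -[(_ * (t' - t)) ^+ 2]real_normK ?num_real// normrM ger0_norm ?mulr_ge0// -mulrA.
    apply: bessel_le => //; first exact: L2B.
    have h := b2 _ _ _ _ _ _ (@U_C1 t' 0 isT) (@U_C1 t 0 isT)
      (@U_C1 t' 1 isT) (@U_C1 t 1 isT)
      (@U_sup t' 0 isT) (@U_sup t 0 isT) (@U_sup t' 1 isT) (@U_sup t 1 isT) (@U_sup t 2 isT).
    apply: le_trans h _; rewrite ler_wpM2l//.
    have u0 := @U_lip t t' 0 isT; have u1 := @U_lip t t' 1 isT.
    have u2 := @U_lip t t' 2 isT; lra.
  by rewrite ler_wpM2r ?sqr_ge0//; lra.
move=> t r r0 tr tT; apply: (@le_trans _ _ (K3 * r ^+ 4)).
  have -> : K3 * r ^+ 4 = (b - a)^-1 * (L3 * ((K + 1) * r) ^+ 2) ^+ 2 by rewrite /K3; ring.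
  rewrite (eq_bigr (fun l => cmod (fcoef a b (fun x => F (U (t + r) 0%N) x + F (U (t - r) 0%N) x -
     2 * F (U t 0%N) x) l) ^+ 2)); last first.
    move=> l _; rewrite (fcoefB l (L2D (L2_F (t + r)) (L2_F (t - r))) (L2Z 2 (L2_F t))).
    by rewrite (fcoefD l (L2_F (t + r)) (L2_F (t - r))) (fcoefZ 2 l (L2_F t)).
  apply: bessel_le => //; first by apply: L2B; [apply: L2D; exact: L2_F|exact/L2Z/L2_F].
  have Kr0 : 0 <= (K + 1) * r by rewrite mulr_ge0// addr_ge0.
  have d1 k : (k <= 2)%N -> nrm a b (fun x => U (t + r) k x - U t k x) <= (K + 1) * r.
    move=> k2; apply: le_trans (U_lip t (t + r) k2) _.
    rewrite (_ : t + r - t = r); last by ring.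
    by rewrite ger0_norm// ler_wpM2r//; lra.
  have d2 k : (k <= 2)%N -> nrm a b (fun x => U (t - r) k x - U t k x) <= (K + 1) * r.
    move=> k2; apply: le_trans (U_lip t (t - r) k2) _.
    rewrite (_ : t - r - t = - r); last by ring.
    by rewrite normrN ger0_norm// ler_wpM2r//; lra.
  apply: (b3 _ _ _ _ _ _ _ (@U_C1 (t + r) 0 isT) (@U_C1 t 0 isT)
    (@U_C1 (t - r) 0 isT) (@U_sup _ 0 isT) (@U_sup _ 0 isT) (@U_sup _ 0 isT) Kr0
    (d1 0 isT) (d1 1 isT) (d2 0 isT) (d2 1 isT)).
  apply: le_trans (U_second r0 tr tT) _; rewrite exprMn ler_wpM2r ?sqr_ge0//.
  by have k0 := K0; have := sqr_ge0 K; rewrite (_ : (K + 1) ^+ 2 = K ^+ 2 + 2 * K + 1); [lra|ring].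
by rewrite ler_wpM2r ?exprn_ge0//; lra.
Qed.

Lemma cmod_fcoef_le u l : L2 a b u -> cmod (fcoef a b u l) <= (Num.sqrt (b - a))^-1 * nrm a b u.
Proof.
move=> Lu; have ba : 0 < b - a by rewrite subr_gt0.
have := bessel_le (s := [:: l]) Lu isT (lexx _); rewrite big_seq1.
rewrite -[(b - a)^-1](@sqr_sqrtr _ _ _) ?invr_ge0 ?(ltW ba)// sqrtrV ?(ltW ba)// -exprMn.
by rewrite ler_sqr ?nnegrE ?cmod_ge0 ?mulr_ge0 ?invr_ge0 ?sqrtr_ge0 ?nrm_ge0.
Qed.

Lemma L2_U t k : (k <= 3)%N -> L2 a b (U t k).
Proof. by move=> /(U_H1 t) /H1_L2. Qed.

Lemma coef_cont l : ccont (fun t => fcoef a b (U t 0%N) l).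
Proof.
have ba : 0 < b - a by rewrite subr_gt0.
pose C := (Num.sqrt (b - a))^-1 * K.
have C0 : 0 <= C by rewrite mulr_ge0 ?invr_ge0 ?sqrtr_ge0.
have key t y : cmod (fcoef a b (U t 0%N) l - fcoef a b (U y 0%N) l) <= C * `|t - y|.
  rewrite -fcoefB; [|exact: L2_U|exact: L2_U].
  apply: le_trans (cmod_fcoef_le l (L2B (@L2_U t 0 isT) (@L2_U y 0 isT))) _.
  by rewrite -mulrA ler_wpM2l ?invr_ge0 ?sqrtr_ge0//; exact: U_lip.
have near_le t (e : R) : 0 < e -> \forall y \near t,
    cmod (fcoef a b (U t 0%N) l - fcoef a b (U y 0%N) l) <= e.
  move=> e0; exists (e / (C + 1)) => /=; first by rewrite divr_gt0// ltr_wpDl.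
  move=> y /= ty; apply: le_trans (key t y) _.
  apply: (@le_trans _ _ (C * (e / (C + 1)))); first by rewrite ler_wpM2l// ltW.
  by rewrite mulrCA ger_pMr// ler_pdivrMr ?ltr_wpDl//; lra.
split=> t; apply/cvgrPdist_le => e /(near_le t); apply: filterS => y; apply: le_trans.
  by rewrite -cReB Re_le_cmod.
by rewrite -cImB Im_le_cmod.
Qed.

(** The equation holds almost everywhere in space at each time, and the difference
    quotients converge in [L^2], which bounds every coefficient. *)
Lemma coef_ode V psi (I : set R) psi0 (t : R) l :
  nlse_solution a b V beta sigma psi0 I psi -> (forall t, 0 <= t <= T -> I t) ->
  (forall t k, 0 <= t <= T -> (k <= 4)%N -> is_wderiv a b k (psi t) (U t k)) ->
  ae_eq_on a b (fun x => (V x)%:C) (W 0%N) -> 0 < t < T ->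
  cder (fun t => fcoef a b (U t 0%N) l) t
    (- 'i * ((mu a b l ^+ 2)%:C * fcoef a b (U t 0%N) l + fcoef a b (F (U t 0%N)) l)).
Proof.
move=> [C0 [dpsi [td [Cd _] eqn]] _] TI wU VW /andP[t0 tT].
have Lp r : 0 <= r <= T -> L2 a b (psi r).
  by move=> rI; have [] := wU r 0%N rI isT.
have Ld r : 0 <= r <= T -> L2 a b (dpsi r) by move=> /TI /Cd[].
have tI : 0 <= t <= T by rewrite !ltW.
have aeU r : 0 <= r <= T -> ae_eq_on a b (U r 0%N) (psi r).
  by move=> rI; exact: wderiv_uniq (wU r 0 rI isT) (wderiv0 (Lp r rI)).
have cU r : 0 <= r <= T -> fcoef a b (U r 0%N) l = fcoef a b (psi r) l.
  by move=> rI; apply: fcoef_ae; exact: aeU.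
have [lap [wl el]] := eqn t (TI t tI) t0.
have El : ae_eq_on a b (fun x => 'i * dpsi t x) (fun x => - U t 2 x + F (U t 0%N) x).
  have e1 := wderiv_uniq wl (wU t 2 tI isT).
  have e2 : {ae @lebesgue_measure R, forall x, x \in `]a, b[ ->
      'i * dpsi t x = - U t 2 x + Bop V beta sigma (psi t) x}.
    by apply: aeS2 el e1 => x h1 h2 xI; rewrite (h1 xI) (h2 xI).
  have e3 : {ae @lebesgue_measure R, forall x, x \in `]a, b[ ->
      'i * dpsi t x = - U t 2 x + Bop V beta sigma (U t 0%N) x}.
    by apply: aeS2 e2 (aeU t tI) => x h1 h2 xI; rewrite (h1 xI) /Bop (h2 xI).
  by apply: aeS2 e3 VW => x h1 h2 xI; rewrite (h1 xI) BopE (h2 xI).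
have c2 : fcoef a b (U t 2) l = - (mu a b l ^+ 2)%:C * fcoef a b (U t 0%N) l.
  rewrite (fcoef_deriv ab l (@U_H1 t 1 isT) (@U_per t 1 isT)).
  rewrite (fcoef_deriv ab l (@U_H1 t 0 isT) (@U_per t 0 isT)).
  rewrite mulrA; congr (_ * _); rewrite rcX; transitivity (('i * 'i) * (mu a b l)%:C ^+ 2); first by ring.
  by rewrite -expr2 sqr_i; ring.
have cd : - 'i * ((mu a b l ^+ 2)%:C * fcoef a b (U t 0%N) l + fcoef a b (F (U t 0%N)) l) =
    fcoef a b (dpsi t) l.
  have := fcoef_ae l El.
  rewrite fcoefZ; last exact: Ld.
  rewrite (fcoefD l (L2N (@L2_U t 2 isT)) (L2_F t)).
  have -> : fcoef a b (fun x => - U t 2 x) l = - fcoef a b (U t 2) l.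
    rewrite -mulN1r -fcoefZ; last exact: L2_U.
    by congr (fcoef a b _ l); apply/funext => x; rewrite mulN1r.
  rewrite c2 mulNr opprK => <-.
  by rewrite mulrA mulNr -expr2 sqr_i opprK mul1r.
rewrite cd.
have D := L2der_L2norm TI td Lp Ld.
have [_ _ hD] := D t tI.
apply: eps_cder => e e0.
pose q := (Num.sqrt (b - a))^-1.
have q0 : 0 < q by rewrite invr_gt0 sqrtr_gt0 subr_gt0.
have [r r0 h] := hD (e / q) (divr_gt0 e0 q0).
exists (Num.min r (Num.min t (T - t))) => [|y]; first by rewrite !lt_min r0 t0 subr_gt0.
rewrite !lt_min => /andP[yr /andP[]]; rewrite !ltr_norml => /andP[h1 _] /andP[_ h2].
have yI : 0 <= y <= T by lra.
have Ly := Lp y yI; have Lt := Lp t tI; have Ldt := Ld t tI.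
rewrite !cU// -fcoefB// -fcoefZ// -fcoefB; [|exact: L2B|exact: L2Z].
apply: le_trans (cmod_fcoef_le l (L2B (L2B Ly Lt) (L2Z _ Ldt))) _.
apply: le_trans (ler_wpM2l (ltW q0) (h y yI yr)) _.
by rewrite mulrA mulrCA mulfV ?mulr1// gt_eqF.
Qed.

End Consistency.

(** * Stability *)

(** [(1 + tau La)^n (k1 + n tau k2)] majorizes both [x n] and [x (n + 1)], whence an induction
    over pairs of consecutive terms. The recursion need only hold where [x] is within
    the bound to be proved. *)
Lemma gronwall (R : realType) (x : nat -> R) (N : nat) (tau T La k1 k2 : R) :
  0 <= tau -> 0 <= La -> 0 <= k1 -> 0 <= k2 -> N%:R * tau <= T ->
  let G := expR (La * T) * (k1 + T * k2) in
  x 0%N <= 0 -> ((0 < N)%N -> x 1%N <= k1) ->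
  (forall n, (n.+1 < N)%N -> x n.+1 <= G -> x n.+2 <= x n + tau * La * x n.+1 + tau * k2) ->
  forall n, (n <= N)%N -> x n <= G.
Proof.
move=> tau0 La0 k10 k20 NT G x0 x1 step.
pose Y n := (1 + tau * La) ^+ n * (k1 + n%:R * tau * k2).
have q0 : 0 <= tau * La by exact: mulr_ge0.
have nt0 n : 0 <= n%:R * tau * k2 by rewrite !mulr_ge0.
have p1 n : 1 <= (1 + tau * La) ^+ n by apply: exprn_ege1; rewrite lerDl.
have p0 n : 0 <= (1 + tau * La) ^+ n := le_trans ler01 (p1 n).
have nT n : (n <= N)%N -> n%:R * tau <= T.
  by move=> nN; apply: le_trans NT; rewrite ler_wpM2r// ler_nat.
have YG n : (n <= N)%N -> Y n <= G.
  move=> nN; rewrite /Y /G; apply: ler_pM => //; first exact: addr_ge0.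
    have h : 1 + tau * La <= expR (tau * La) by exact: expR_ge1Dx.
    apply: (@le_trans _ _ (expR (tau * La) ^+ n)).
      by rewrite lerXn2r ?nnegrE ?expR_ge0// addr_ge0.
    by rewrite -expRM_natl ler_expR mulrA mulrC ler_wpM2l// nT.
  by rewrite lerD2l ler_wpM2r// nT.
have Ystep n : (1 + tau * La) * Y n + tau * k2 <= Y n.+1.
  rewrite /Y exprS -natr1 !mulrDl mul1r; set P := _ ^+ n.
  have h : tau * k2 <= (1 + tau * La) * P * (tau * k2).
    by rewrite ler_peMl ?mulr_ge0//; have := p1 n.+1; rewrite exprS.
  by move: h; rewrite !mulrDl !mulrDr; lra.
have Y0 n : 0 <= Y n by rewrite mulr_ge0// addr_ge0.
have Yle n : Y n <= Y n.+1.
  by apply: le_trans (Ystep n); rewrite mulrDl mul1r -addrA lerDl addr_ge0 ?mulr_ge0 ?addr_ge0.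
have main n : (n <= N)%N -> x n <= Y n /\ ((n < N)%N -> x n.+1 <= Y n).
  elim: n => [_|n IH nN].
    have -> : Y 0%N = k1 by rewrite /Y expr0 mul1r !mul0r addr0.
    by split=> //; exact: le_trans x0 _.
  have [h1 /(_ nN) h2] := IH (ltnW nN); split=> [|nN']; first exact: le_trans h2 (Yle n).
  apply: le_trans (step n nN' (le_trans h2 (YG n (ltnW nN)))) _.
  apply: le_trans (Ystep n); rewrite mulrDl mul1r lerD2r lerD// ler_wpM2l//.
by move=> n nN; have [h _] := main n nN; exact: le_trans h (YG n nN).
Qed.

Lemma err_first_arith (R : realType) (tau L p0 p1 k0 k1 x y : R) :
  0 < tau -> tau <= 1 -> 0 <= L -> 0 <= p0 -> 0 <= p1 ->
  x <= tau * (L * p0) + k0 -> y <= tau * (L * (p0 + p1)) + k1 ->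
  x + y <= 2 * L * (p0 + p1) + (k0 + k1) /\ x <= L * p0 + k0.
Proof.
move=> tau0 tau1 L0 p00 p10 hx hy.
have lp0 : 0 <= L * p0 by exact: mulr_ge0.
have lp1 : 0 <= L * p1 by exact: mulr_ge0.
have t0 : tau * (L * p0) <= L * p0 by rewrite ler_piMl.
have t1 : tau * (L * p1) <= L * p1 by rewrite ler_piMl.
have E : tau * (L * (p0 + p1)) = tau * (L * p0) + tau * (L * p1) by ring.
by rewrite E in hy; split; lra.
Qed.

Lemma err_next_arith (R : realType) (tau L p0 p1 k0 k1 x0 y0 x1 y1 x2 y2 : R) :
  0 < tau -> 0 <= L -> 0 <= p1 -> 0 <= y1 ->
  x2 <= x0 + 2 * tau * (L * (x1 + p0)) + tau * k0 ->
  y2 <= y0 + 2 * tau * (L * (x1 + p0 + (y1 + p1))) + tau * k1 ->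
  x2 + y2 <= x0 + y0 + tau * (4 * L) * (x1 + y1) + tau * (4 * L * (p0 + p1) + (k0 + k1)) /\
  x2 <= x0 + tau * (2 * L) * x1 + tau * (2 * L * p0 + k0).
Proof.
move=> tau0 L0 p10 y10 hx hy.
have tL : 0 <= tau * L by rewrite mulr_ge0// ltW.
have q1 := mulr_ge0 tL y10; have q2 := mulr_ge0 tL p10.
split; last by apply: le_trans hx _; rewrite le_eqVlt; apply/orP; left; apply/eqP; ring.
apply: le_trans (lerD hx hy) _; rewrite -subr_ge0.
rewrite (_ : _ - _ = 2 * (tau * L * y1) + 2 * (tau * L * p1)); last by ring.
by rewrite addr_ge0// mulr_ge0.
Qed.

Lemma err_sum_arith (R : realType) (x y p0 p1 G : R) : x + y <= G -> x + p0 + (y + p1) <= G + (p0 + p1).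
Proof. lra. Qed.

Section TrigNorms.
Context {R : realType} (a b : R).
Hypothesis ab : a < b.
Context (s : seq int).
Hypothesis us : uniq s.
Implicit Types (c d : int -> R[i]).

Lemma tsum_eq c d : {in s, c =1 d} -> tsum a b s c = tsum a b s d.
Proof. by move=> cd; apply/funext => x; apply: eq_big_seq => l ls; rewrite cd. Qed.

Lemma tsumD c d x : tsum a b s (fun l => c l + d l) x = tsum a b s c x + tsum a b s d x.
Proof. by rewrite -big_split; apply: eq_bigr => l _; rewrite mulrDl. Qed.

Lemma tsumB c d x : tsum a b s (fun l => c l - d l) x = tsum a b s c x - tsum a b s d x.
Proof. by rewrite -sumrB; apply: eq_bigr => l _; rewrite mulrBl. Qed.

Lemma tsumZ z c x : tsum a b s (fun l => z * c l) x = z * tsum a b s c x.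
Proof. by rewrite mulr_sumr; apply: eq_bigr => l _; rewrite mulrA. Qed.

Lemma nrm_tsum_le c (q : R) : 0 <= q -> \sum_(l <- s) cmod (c l) ^+ 2 <= q ^+ 2 ->
  nrm a b (tsum a b s c) <= Num.sqrt (b - a) * q.
Proof.
move=> q0 cq; have ba : 0 <= b - a by rewrite subr_ge0 ltW.
rewrite -ler_sqr ?nnegrE ?nrm_ge0 ?mulr_ge0 ?sqrtr_ge0// (parseval_tsum ab)//.
by rewrite exprMn sqr_sqrtr// ler_wpM2l.
Qed.

Lemma nrm_tsum_mul c d (q : R) : 0 <= q -> {in s, forall l, cmod (c l) <= q * cmod (d l)} ->
  nrm a b (tsum a b s c) <= q * nrm a b (tsum a b s d).
Proof.
move=> q0 cd; have ba : 0 <= b - a by rewrite subr_ge0 ltW.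
rewrite -ler_sqr ?nnegrE ?nrm_ge0 ?mulr_ge0 ?nrm_ge0// exprMn !(parseval_tsum ab)//.
rewrite mulrCA ler_wpM2l// mulr_sumr big_seq [leRHS]big_seq; apply: ler_sum => l ls.
rewrite -exprMn ler_sqr ?nnegrE ?mulr_ge0 ?cmod_ge0//; exact: cd.
Qed.

Lemma nrm_tsum_fcoef u : L2 a b u -> nrm a b (tsum a b s (fcoef a b u)) <= nrm a b u.
Proof.
move=> Lu; rewrite -ler_sqr ?nnegrE ?nrm_ge0// (parseval_tsum ab)//.
exact: bessel.
Qed.

(** One step of the recursion in norm: Fourier multipliers act on norms by their sup. *)
Lemma nrm_tsum3 c d e f (q : R) (w0 w1 : int -> R[i]) : 0 <= q ->
  {in s, forall l, c l = w0 l * d l + w1 l * e l + f l} ->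
  (forall l, cmod (w0 l) <= 1) -> (forall l, cmod (w1 l) <= q) ->
  nrm a b (tsum a b s c) <= nrm a b (tsum a b s d) + q * nrm a b (tsum a b s e) + nrm a b (tsum a b s f).
Proof.
move=> q0 E w01 w1q; rewrite (tsum_eq E).
have -> : tsum a b s (fun l => w0 l * d l + w1 l * e l + f l) = (fun x => (tsum a b s (fun l => w0 l * d l) x +
    tsum a b s (fun l => w1 l * e l) x) + tsum a b s f x).
  by apply/funext => x; rewrite !tsumD.
apply: le_trans (nrmD (L2D (L2_tsum _ _ _ _) (L2_tsum _ _ _ _)) (L2_tsum _ _ _ _)) _; rewrite lerD2r.
apply: le_trans (nrmD (L2_tsum _ _ _ _) (L2_tsum _ _ _ _)) _; rewrite lerD//.
  rewrite -[leRHS]mul1r; apply: nrm_tsum_mul => // l _.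
  by rewrite cmodM ler_wpM2r ?cmod_ge0.
by apply: nrm_tsum_mul => // l _; rewrite cmodM ler_wpM2r ?cmod_ge0.
Qed.

End TrigNorms.

Section Stability.
Context {R : realType} (a b : R).
Hypothesis ab : a < b.
Context (s : seq int).
Hypothesis us : uniq s.
Context (W0 W1 : R -> R[i]) (beta sigma M L : R).
Hypothesis W01 : C1 a b W0 W1.
Hypothesis W0per : W0 a = W0 b.
Hypothesis sigma1 : 1 <= sigma.
Hypothesis L0 : 0 <= L.
Local Notation F := (field W0 beta sigma).
Local Notation F1 := (field1 W0 W1 beta sigma).
Hypothesis F_lip : forall u u1 w w1 : R -> R[i],
  C1 a b u u1 -> C1 a b w w1 -> bounded_by a b (M + 1) u -> bounded_by a b (M + 1) w ->
  bounded_by a b (M + 1) w1 ->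
  nrm a b (fun x => F u x - F w x) <= L * nrm a b (fun x => u x - w x) /\
  nrm a b (fun x => F1 u u1 x - F1 w w1 x) <=
    L * (nrm a b (fun x => u x - w x) + nrm a b (fun x => u1 x - w1 x)).
Context (u u1 : nat -> R -> R[i]) (p0 p1 : R).
Hypothesis u_C1 : forall n, C1 a b (u n) (u1 n).
Hypothesis u_per : forall n, u n a = u n b.
Hypothesis u_sup : forall n, bounded_by a b M (u n).
Hypothesis u1_sup : forall n, bounded_by a b M (u1 n).
Hypothesis u_proj : forall n, nrm a b (fun x => u n x - tsum a b s (fcoef a b (u n)) x) <= p0.
Hypothesis u1_proj : forall n, nrm a b (fun x => u1 n x - tsum a b s (fcoef a b (u1 n)) x) <= p1.
Context (p : nat -> int -> R[i]).
Implicit Types (n : nat) (l : int) (c : int -> R[i]).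

Definition dcoef c l := 'i * (mu a b l)%:C * c l.
Local Notation v n := (tsum a b s (p n)).
Local Notation v1 n := (tsum a b s (dcoef (p n))).
Definition err n l := p n l - fcoef a b (u n) l.
Definition fielderr n l := fcoef a b (F (v n)) l - fcoef a b (F (u n)) l.
Definition err0 n := nrm a b (tsum a b s (err n)).
Definition err1 n := nrm a b (tsum a b s (dcoef (err n))).

Lemma v_C1 n : C1 a b (v n) (v1 n).
Proof. exact: C1_tsum. Qed.

Lemma nrm_v_sub n : nrm a b (fun x => v n x - u n x) <= err0 n + p0.
Proof.
have Lu : L2 a b (u n) by exact: L2_C1 (u_C1 n).
have -> : (fun x => v n x - u n x) = (fun x => tsum a b s (err n) x - (u n x - tsum a b s (fcoef a b (u n)) x)).
  by apply/funext => x; rewrite /err tsumB; ring.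
by apply: le_trans (nrmB (L2_tsum _ _ _ _) (L2B Lu (L2_tsum _ _ _ _))) _; rewrite lerD2l.
Qed.

Lemma nrm_v1_sub n : nrm a b (fun x => v1 n x - u1 n x) <= err1 n + p1.
Proof.
have Lu : L2 a b (u1 n) by exact: L2_C1' (u_C1 n).
have -> : (fun x => v1 n x - u1 n x) =
    (fun x => tsum a b s (dcoef (err n)) x - (u1 n x - tsum a b s (fcoef a b (u1 n)) x)).
  apply/funext => x.
  have -> : tsum a b s (dcoef (err n)) x = tsum a b s (fun l => dcoef (p n) l - fcoef a b (u1 n) l) x.
    rewrite /tsum; apply: eq_bigr => l _; congr (_ * _).
    by rewrite /dcoef /err mulrBr (fcoef_deriv ab l (C1_H1 (u_C1 n)) (u_per n)).
  by rewrite tsumB; ring.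
by apply: le_trans (nrmB (L2_tsum _ _ _ _) (L2B Lu (L2_tsum _ _ _ _))) _; rewrite lerD2l.
Qed.

Lemma v_sup n : sobolev_cst a b * (err0 n + p0 + (err1 n + p1)) <= 1 -> bounded_by a b (M + 1) (v n).
Proof.
move=> h x xab; have hd := C1_H1 (C1B (v_C1 n) (u_C1 n)).
have -> : v n x = u n x + (v n x - u n x) by rewrite addrC subrK.
apply: le_trans (cmodD _ _) _; apply: lerD; first exact: u_sup.
apply: le_trans (sobolev ab hd xab) _; apply: le_trans h.
apply: ler_wpM2l; first exact: ltW (sobolev_cst_gt0 ab).
by apply: lerD; [exact: (nrm_v_sub n)|exact: (nrm_v1_sub n)].
Qed.

(** The first derivative of the field is compared in [L^2] as well, for its coefficients are
    those of the field times [i mu l]. *)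
Lemma fielderr_le n : bounded_by a b (M + 1) (v n) ->
  nrm a b (tsum a b s (fielderr n)) <= L * (err0 n + p0) /\
  nrm a b (tsum a b s (dcoef (fielderr n))) <= L * (err0 n + p0 + (err1 n + p1)).
Proof.
move=> hv; have wk w : bounded_by a b M w -> bounded_by a b (M + 1) w.
  by move=> h x xab; apply: le_trans (h x xab) _; rewrite lerDl.
have [h1 h2] := F_lip (v_C1 n) (u_C1 n) hv (wk _ (u_sup n)) (wk _ (u1_sup n)).
have LFv := L2_field beta W01 sigma1 (v_C1 n); have LFu := L2_field beta W01 sigma1 (u_C1 n).
have LFv1 := L2_C1' (field_C1 beta W01 sigma1 (v_C1 n)).
have LFu1 := L2_C1' (field_C1 beta W01 sigma1 (u_C1 n)).
split.
  have -> : tsum a b s (fielderr n) = tsum a b s (fcoef a b (fun x => F (v n) x - F (u n) x)).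
    by apply: tsum_eq => l _; rewrite (fcoefB l LFv LFu).
  apply: le_trans (nrm_tsum_fcoef ab us (L2B LFv LFu)) _; apply: le_trans h1 _.
  by apply: ler_wpM2l => //; exact: (nrm_v_sub n).
have -> : tsum a b s (dcoef (fielderr n)) = tsum a b s (fcoef a b (fun x => F1 (v n) (v1 n) x - F1 (u n) (u1 n) x)).
  apply: tsum_eq => l _; rewrite (fcoefB l LFv1 LFu1).
  rewrite (fcoef_field1 ab beta W01 W0per sigma1 l (v_C1 n) (tsum_periodic ab _ _)).
  by rewrite (fcoef_field1 ab beta W01 W0per sigma1 l (u_C1 n) (u_per n)) /dcoef /fielderr mulrBr.
apply: le_trans (nrm_tsum_fcoef ab us (L2B LFv1 LFu1)) _; apply: le_trans h2 _.
by apply: ler_wpM2l => //; apply: lerD; [exact: (nrm_v_sub n)|exact: (nrm_v1_sub n)].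
Qed.

Context (tau T : R) (N : nat) (w0 w1 w2 : int -> R[i]) (r : nat -> int -> R[i]) (k0 k1 : R).
Hypothesis tau0 : 0 < tau.
Hypothesis NT : N%:R * tau <= T.
Hypothesis k00 : 0 <= k0.
Hypothesis k10 : 0 <= k1.
Hypothesis w0_le : forall l, cmod (w0 l) <= 1.
Hypothesis w1_le : forall l, cmod (w1 l) <= tau.
Hypothesis w2_le : forall l, cmod (w2 l) <= 2 * tau.
Hypothesis e_start : {in s, forall l, err 0 l = 0}.
Hypothesis e_first : {in s, forall l, (0 < N)%N -> err 1 l = w1 l * fielderr 0 l + r 0%N l}.
Hypothesis e_next : {in s, forall l n, (n.+1 < N)%N ->
  err n.+2 l = w0 l * err n l + w2 l * fielderr n.+1 l + r n.+1 l}.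
Hypothesis r_first : (0 < N)%N -> nrm a b (tsum a b s (r 0%N)) <= k0 /\ nrm a b (tsum a b s (dcoef (r 0%N))) <= k1.
Hypothesis r_next : forall n, (n.+1 < N)%N ->
  nrm a b (tsum a b s (r n.+1)) <= tau * k0 /\ nrm a b (tsum a b s (dcoef (r n.+1))) <= tau * k1.

Lemma err_rec n : (n.+1 < N)%N -> bounded_by a b (M + 1) (v n.+1) ->
  err0 n.+2 <= err0 n + 2 * tau * (L * (err0 n.+1 + p0)) + tau * k0 /\
  err1 n.+2 <= err1 n + 2 * tau * (L * (err0 n.+1 + p0 + (err1 n.+1 + p1))) + tau * k1.
Proof.
move=> nN hv; have [f0 f1] := fielderr_le hv; have [r0 r1] := r_next nN.
have t20 : 0 <= 2 * tau by rewrite mulr_ge0// ltW.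
have nx l : l \in s -> err n.+2 l = w0 l * err n l + w2 l * fielderr n.+1 l + r n.+1 l.
  by move=> ls; exact: e_next.
split.
  apply: le_trans (nrm_tsum3 ab us t20 nx w0_le w2_le) _.
  by rewrite lerD// lerD2l ler_wpM2l.
have nx1 l : l \in s -> dcoef (err n.+2) l =
    w0 l * dcoef (err n) l + w2 l * dcoef (fielderr n.+1) l + dcoef (r n.+1) l.
  by move=> ls; rewrite /dcoef nx//; ring.
apply: le_trans (nrm_tsum3 ab us t20 nx1 w0_le w2_le) _.
by rewrite lerD// lerD2l ler_wpM2l.
Qed.

Lemma err_0 : err0 0 = 0 /\ err1 0 = 0.
Proof.
have z c : {in s, forall l, c l = 0} -> nrm a b (tsum a b s c) = 0.
  move=> c0; apply/eqP; rewrite eq_le nrm_ge0 andbT -[leRHS](mulr0 (Num.sqrt (b - a))).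
  apply: nrm_tsum_le => //; rewrite expr0n /= big_seq big1// => l ls.
  by rewrite c0// cmod0 expr0n.
split; apply: z => // l ls; by rewrite /dcoef e_start// mulr0.
Qed.

Lemma err_1 : (0 < N)%N -> bounded_by a b (M + 1) (v 0) ->
  err0 1 <= tau * (L * p0) + k0 /\ err1 1 <= tau * (L * (p0 + p1)) + k1.
Proof.
move=> N0 hv; have [f0 f1] := fielderr_le hv; have [r0 r1] := r_first N0.
have [z0 z1] := err_0; rewrite z0 z1 !add0r in f0 f1.
have nx l : l \in s -> err 1 l = 0 * 0 + w1 l * fielderr 0 l + r 0%N l.
  by move=> ls; rewrite mul0r add0r; exact: e_first.
have c0 l : cmod ((fun=> 0) l : R[i]) <= 1 by rewrite cmod0.
have nz : nrm a b (tsum a b s (fun=> 0)) = 0.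
  apply/eqP; rewrite eq_le nrm_ge0 andbT -[leRHS](mulr0 (Num.sqrt (b - a))).
  by apply: nrm_tsum_le => //; rewrite expr0n /= big1// => l _; rewrite cmod0 expr0n.
split.
  apply: le_trans (nrm_tsum3 ab us (ltW tau0) nx c0 w1_le) _.
  by rewrite nz add0r lerD// ler_wpM2l// ltW.
have nx1 l : l \in s -> dcoef (err 1) l = 0 * 0 + w1 l * dcoef (fielderr 0) l + dcoef (r 0%N) l.
  by move=> ls; rewrite /dcoef nx//; ring.
apply: le_trans (nrm_tsum3 ab us (ltW tau0) nx1 c0 w1_le) _.
by rewrite nz add0r lerD// ler_wpM2l// ltW.
Qed.

(** The bound [M + 1] on the numerical solution, on which the Lipschitz constant
    depends, is maintained along the recursion by the [H^1] error itself. *)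
Lemma stability : 0 <= p0 -> 0 <= p1 -> tau <= 1 -> 0 <= T ->
  let G := expR (4 * L * T) * ((2 * L * (p0 + p1) + (k0 + k1)) + T * (4 * L * (p0 + p1) + (k0 + k1))) in
  sobolev_cst a b * (G + (p0 + p1)) <= 1 ->
  forall n, (n <= N)%N -> err0 n <= expR (2 * L * T) * ((L * p0 + k0) + T * (2 * L * p0 + k0)) /\
    err0 n + err1 n <= G.
Proof.
move=> p00 p10 tau1 T0 G GS.
have e00 n : 0 <= err0 n := nrm_ge0 _ _ _; have e10 n : 0 <= err1 n := nrm_ge0 _ _ _.
have [z0 z1] := err_0.
have G0 : 0 <= G.
  by apply: mulr_ge0; [exact: expR_ge0|nonneg].
have bv n : err0 n + err1 n <= G -> bounded_by a b (M + 1) (v n).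
  move=> h; apply: v_sup; apply: le_trans GS.
  by apply: ler_wpM2l; [exact: ltW (sobolev_cst_gt0 ab)|exact: err_sum_arith].
have bv0 : bounded_by a b (M + 1) (v 0) by apply: bv; rewrite z0 z1 addr0.
have B n : (n <= N)%N -> err0 n + err1 n <= G.
  apply: (@gronwall R (fun n => err0 n + err1 n) N tau T (4 * L)) => //; try exact: ltW.
  - by nonneg.
  - by nonneg.
  - by nonneg.
  - by rewrite z0 z1 addr0.
  - move=> N0; have [h0 h1] := err_1 N0 bv0.
    by have [] := err_first_arith tau0 tau1 L0 p00 p10 h0 h1.
  move=> m mN /bv hv; have [h0 h1] := err_rec mN hv.
  by have [] := err_next_arith tau0 L0 p10 (e10 m.+1) h0 h1.
move=> n nN; split; last exact: B.
move: n nN; apply: (@gronwall R err0 N tau T (2 * L)) => //; try exact: ltW.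
- by nonneg.
- by nonneg.
- by nonneg.
- by rewrite z0.
- move=> N0; have [h0 h1] := err_1 N0 bv0.
  by have [] := err_first_arith tau0 tau1 L0 p00 p10 h0 h1.
move=> n nN _; have [h0 h1] := err_rec nN (bv _ (B _ (ltnW nN))).
by have [] := err_next_arith tau0 L0 p10 (e10 n.+1) h0 h1.
Qed.

End Stability.

(** * The scheme in Fourier variables *)

Section SchemeCoefficients.
Context {R : realType} (a b : R).
Hypothesis ab : a < b.
Context (V : R -> R) (W0 : R -> R[i]) (beta sigma : R).
Hypothesis VW : ae_eq_on a b (fun x => (V x)%:C) W0.
Context (psi0 : R -> R[i]) (tau : R) (N : nat).
Implicit Types (l : int) (n : nat) (u : R -> R[i]).
Local Notation s := (freqs N).
Local Notation m := (fun l => mu a b l ^+ 2).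
Local Notation v := (sEWI_FS a b V beta sigma psi0 tau N).
Local Notation E1 l := (eit (- m l * (tau - 0))).
Let us : uniq s := freqs_uniq N.

Lemma fcoef_PN u l : l \in s -> fcoef a b (PN a b N u) l = fcoef a b u l.
Proof.
move=> ls; have -> : PN a b N u = tsum a b s (fcoef a b u) by apply/funext => x; rewrite PN_tsum.
by rewrite (fcoef_tsum ab)// ls.
Qed.

Lemma fmult_tsum f u x : fmult a b N f u x = tsum a b s (fun l => f (- m l) * fcoef a b u l) x.
Proof. by rewrite /tsum sum_freqs. Qed.

Lemma fcoef_fmult f u l : l \in s -> fcoef a b (fmult a b N f u) l = f (- m l) * fcoef a b u l.
Proof.
move=> ls; have -> : fmult a b N f u = tsum a b s (fun l => f (- m l) * fcoef a b u l).
  by apply/funext => x; rewrite fmult_tsum.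
by rewrite (fcoef_tsum ab)// ls.
Qed.

Lemma cexp_E1 l : cexp ('i * (tau * - m l)%:C) = E1 l.
Proof. by rewrite cexp_i subr0 mulrC. Qed.

Lemma cexp_E2 l : cexp ('i * (2 * tau * - m l)%:C) = E1 l * E1 l.
Proof. by rewrite cexp_i -eitD subr0; congr eit; ring. Qed.

Lemma phi_sE l : tau%:C * (phi_s (tau * - m l))%:C = (sinc_int (m l) tau)%:C.
Proof.
rewrite -rcM; congr (_%:C); rewrite /phi_s /sinc_int.
have [->|t0] := eqVneq tau 0; first by rewrite !mul0r sin0 mul0r if_same.
rewrite mulf_eq0 (negbTE t0) oppr_eq0 /=; case: eqP => [_|/eqP m0]; first by rewrite mulr1.
by move: (mu a b l ^+ 2) m0 => k m0; rewrite mulrN sinN; field; rewrite t0 m0.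
Qed.

Lemma phi_1E l : tau%:C * phi_1 ('i * (tau * - m l)%:C) = E1 l * eit_int (m l) tau.
Proof.
have i0 : 'i != 0 :> R[i] by rewrite -cmod_eq0 cmod_i oner_eq0.
have c0 r : (r%:C == 0 :> R[i]) = (r == 0) by rewrite -cmod_eq0 cmod_real normr_eq0.
rewrite /phi_1 /eit_int mulf_eq0 (negbTE i0) c0 /= mulf_eq0 oppr_eq0.
have [->|t0] := eqVneq tau 0.
  have -> : (0 : R)%:C = 0 :> R[i] by [].
  rewrite mul0r [0 - 0]subrr !mulr0 eit0 subrr mul0r if_same mulr0//.
case: eqP => [->|/eqP m0] /=; first by rewrite oppr0 mul0r eit0 mulr1 mul1r.
rewrite cexp_E1 rcM rcN.
have -> : eit (m l * (tau - 0)) = conjc (E1 l) by rewrite -eitN -mulNr opprK.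
have tC : tau%:C != 0 :> R[i] by rewrite c0.
have mC : (m l)%:C != 0 :> R[i] by rewrite c0.
have := eit_conj (- m l * (tau - 0)); move: (E1 l) (conjc (E1 l)) => E Ec EE.
have -> : E * ((Ec - 1) / ('i * (m l)%:C)) = (1 - E) / ('i * (m l)%:C) by rewrite mulrA mulrBr EE mulr1.
by move: (mu a b l ^+ 2)%:C tau%:C mC tC => k t k0 t1; field; rewrite i0 t1 k0.
Qed.

Lemma L2_fmult f u : L2 a b (fmult a b N f u).
Proof.
rewrite (_ : fmult a b N f u = tsum a b s (fun l => f (- m l) * fcoef a b u l)); first exact: L2_tsum.
by apply/funext => x; rewrite fmult_tsum.
Qed.

Lemma fcoef_subZ (f1 f2 : R -> R[i]) z l : L2 a b f1 -> L2 a b f2 ->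
  fcoef a b (fun x => f1 x - z * f2 x) l = fcoef a b f1 l - z * fcoef a b f2 l.
Proof. by move=> L1 L2; rewrite (fcoefB l L1 (L2Z z L2)) (fcoefZ z l L2). Qed.

Lemma step_coef u w l : l \in s ->
  fcoef a b (sEWI_step a b V beta sigma tau N u w) l =
  E1 l * E1 l * fcoef a b u l - 2 * 'i * (E1 l * (sinc_int (m l) tau)%:C) * fcoef a b (Bop V beta sigma w) l.
Proof.
move=> ls; pose f1 := fmult a b N (fun d => cexp ('i * (2 * tau * d)%:C)) u.
pose f2 := fmult a b N (fun d => cexp ('i * (tau * d)%:C))
  (fmult a b N (fun d => (phi_s (tau * d))%:C) (PN a b N (Bop V beta sigma w))).
have -> : sEWI_step a b V beta sigma tau N u w = (fun x => f1 x - 2 * 'i * tau%:C * f2 x) by [].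
have L1 : L2 a b f1 by exact: L2_fmult.
have L2 : L2 a b f2 by exact: L2_fmult.
rewrite (fcoef_subZ _ l L1 L2) /f1 /f2 (fcoef_fmult _ u ls) (fcoef_fmult _ (fmult _ _ _ _ _) ls).
rewrite (fcoef_fmult _ (PN _ _ _ _) ls) (fcoef_PN _ ls) cexp_E1 cexp_E2 -phi_sE.
by move: (fcoef a b _ l) (fcoef a b _ l) => x y; ring.
Qed.

Lemma first_coef u l : l \in s ->
  fcoef a b (fun x => fmult a b N (fun d => cexp ('i * (tau * d)%:C)) u x - 'i * tau%:C *
    fmult a b N (fun d => phi_1 ('i * (tau * d)%:C)) (PN a b N (Bop V beta sigma u)) x) l =
  E1 l * fcoef a b u l - 'i * (E1 l * eit_int (m l) tau) * fcoef a b (Bop V beta sigma u) l.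
Proof.
move=> ls; rewrite (fcoef_subZ _ l (L2_fmult _ _) (L2_fmult _ _)).
rewrite (fcoef_fmult _ u ls) (fcoef_fmult _ (PN _ _ _ _) ls) (fcoef_PN _ ls) cexp_E1 -phi_1E.
by move: (fcoef a b _ l) (fcoef a b _ l) => x y; ring.
Qed.

(** Every iterate is a trigonometric polynomial, so its coefficients determine it. *)
Lemma scheme_tsum n : v n = tsum a b s (fcoef a b (v n)).
Proof.
have self c : tsum a b s c = tsum a b s (fcoef a b (tsum a b s c)).
  by apply: tsum_eq => l ls; rewrite (fcoef_tsum ab)// ls.
have fm f z : exists c, fmult a b N f z = tsum a b s c.
  by eexists; apply/funext => x; exact: fmult_tsum.
have [c ->] : exists c, v n = tsum a b s c; last exact: self.
have comb (z : R[i]) f g : (exists c, f = tsum a b s c) -> (exists c, g = tsum a b s c) ->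
    exists c, (fun x => f x - z * g x) = tsum a b s c.
  move=> [c ->] [d ->]; exists (fun l => c l - z * d l).
  by apply/funext => x; rewrite tsumB tsumZ.
case: n => [|[|n]].
- by exists (fcoef a b psi0); apply/funext => x; rewrite -PN_tsum.
- exact: comb (fm _ _) (fm _ _).
- exact: comb (fm _ _) (fm _ _).
Qed.

Lemma fcoef_Bop n l : fcoef a b (Bop V beta sigma (v n)) l =
  fcoef a b (field W0 beta sigma (tsum a b s (fcoef a b (v n)))) l.
Proof.
by rewrite -scheme_tsum; apply: fcoef_ae; apply: aeS VW => x h xab; rewrite BopE (h xab).
Qed.

Context (u : nat -> R -> R[i]) (c g : R -> int -> R[i]).
Hypothesis u0 : ae_eq_on a b (u 0) psi0.
Hypothesis u_c : forall n l, fcoef a b (u n) l = c (n%:R * tau) l.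
Hypothesis u_g : forall n l, fcoef a b (field W0 beta sigma (u n)) l = g (n%:R * tau) l.

(** The multipliers of the error and of the field error in the recursion. Solving the
    defect for the value of the solution at the new time gives the residual its factor
    [exp (- i tau m)]. *)
Definition weight0 l : R[i] := E1 l * E1 l.
Definition weight1 l : R[i] := - ('i * (E1 l * eit_int (m l) tau)).
Definition weight2 l : R[i] := - (2 * 'i * (E1 l * (sinc_int (m l) tau)%:C)).
Definition residual n l : R[i] := - E1 l *
  (if n is 0%N then defect1 m c g tau l else defect2 m c g (n%:R * tau) tau l).

Local Notation e := (err a b u (fun n => fcoef a b (v n))).
Local Notation fe := (fielderr a b s W0 beta sigma u (fun n => fcoef a b (v n))).

Lemma E1_inv l : E1 l * eit (m l * (tau - 0)) = 1.
Proof. by rewrite -eitD mulNr addNr eit0. Qed.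

Lemma err_start : {in s, forall l, e 0%N l = 0}.
Proof.
move=> l ls; by rewrite /err fcoef_PN// (fcoef_ae l u0) subrr.
Qed.

Lemma err_first : {in s, forall l, e 1%N l = weight1 l * fe 0%N l + residual 0 l}.
Proof.
move=> l ls; have e0 := err_start ls.
have -> : e 1%N l = E1 l * fcoef a b (v 0) l - 'i * (E1 l * eit_int (m l) tau) *
    fcoef a b (Bop V beta sigma (v 0)) l - fcoef a b (u 1) l by rewrite -(first_coef (v 0) ls).
rewrite /err /fielderr fcoef_Bop !u_c !u_g mul0r mul1r /residual /defect1 /weight1.
move/eqP: e0; rewrite /err !u_c mul0r subr_eq0 => /eqP ->; have := E1_inv l.
move: (E1 l) (eit (m l * (tau - 0))) (eit_int _ _) (c tau l) (c 0 l) (g 0 l) (fcoef a b (field _ _ _ _) l).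
move=> E Ei Z c1 c0 g0 B EE; rewrite [RHS](_ : _ = E * c0 - 'i * (E * Z) * B - (E * Ei) * c1); last by ring.
by rewrite EE mul1r.
Qed.

Lemma err_next n : {in s, forall l, e n.+2 l = weight0 l * e n l + weight2 l * fe n.+1 l + residual n.+1 l}.
Proof.
move=> l ls; rewrite /err /fielderr; have -> : v n.+2 = sEWI_step a b V beta sigma tau N (v n) (v n.+1) by [].
rewrite step_coef// fcoef_Bop !u_c !u_g /residual /defect2 /weight0 /weight2.
have -> : n.+1%:R * tau + tau = n.+2%:R * tau by rewrite -(natr1 n.+1); ring.
have -> : n.+1%:R * tau - tau = n%:R * tau by rewrite -(natr1 n); ring.
have := E1_inv l.
move: (E1 l) (eit (m l * (tau - 0))) (sinc_int _ _)%:C (c (n.+2%:R * tau) l) (c (n%:R * tau) l)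
  (g (n.+1%:R * tau) l) (fcoef a b (field _ _ _ _) l) (fcoef a b (v n) l).
move=> E Ei S c2 c0 g0 B p EE.
rewrite [RHS](_ : _ = E * E * p - 2 * 'i * (E * S) * B - (E * Ei) * c2); last by ring.
by rewrite EE mul1r.
Qed.

Lemma cmod_eit_int (k r : R) : 0 < r -> cmod (eit_int k r) <= r.
Proof.
move=> r0; have := @sum_mvt R unit [:: tt] (fun=> 1) (fun r _ => eit_int k r) (fun r _ => eit (k * (r - 0))) r 1 r0
   (fun=> ler01) (fun=> cder_ccont (cder_eit_int k)) (fun=> eit_int0 k).
rewrite big_seq1 !mul1r ler_sqr ?nnegrE ?cmod_ge0 ?(ltW r0)//; apply.
  by move=> q _ _; exact: cder_eit_int.
by move=> q _; rewrite big_seq1 cmod_eit expr1n mulr1.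
Qed.

Lemma weight0_le l : cmod (weight0 l) <= 1.
Proof. by rewrite /weight0 -eitD cmod_eit. Qed.

Lemma weight1_le l : 0 < tau -> cmod (weight1 l) <= tau.
Proof. by move=> t0; rewrite /weight1 cmodN 2!cmodM cmod_i cmod_eit !mul1r cmod_eit_int. Qed.

Lemma weight2_le l : 0 < tau -> cmod (weight2 l) <= 2 * tau.
Proof.
move=> t0; rewrite /weight2 cmodN.
have -> : 2 * 'i * (E1 l * (sinc_int (m l) tau)%:C) = (2 : R)%:C * ('i * (E1 l * (sinc_int (m l) tau)%:C)).
  by rewrite rc_nat; ring.
rewrite cmodM cmod_real ger0_norm// ler_wpM2l//.
rewrite cmodM cmod_i mul1r cmodM cmod_eit mul1r cmod_real; exact: abs_sinc_int (ltW t0).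
Qed.

Context (T K : R).
Hypothesis K0 : 0 <= K.
Hypothesis tau0 : 0 < tau.
Hypothesis tau1 : tau <= 1.
Hypothesis d1 : tau <= T -> \sum_(l <- s) cmod (defect1 m c g tau l) ^+ 2 <= K * tau ^+ 4.
Hypothesis md1 : tau <= T -> \sum_(l <- s) m l ^+ 2 * cmod (defect1 m c g tau l) ^+ 2 <= K * tau ^+ 4.
Hypothesis d2 : forall t : R, 0 <= t - tau -> t + tau <= T ->
  \sum_(l <- s) cmod (defect2 m c g t tau l) ^+ 2 <= 10 * K * tau ^+ 6.
Hypothesis md2 : forall t : R, 0 <= t - tau -> t + tau <= T ->
  \sum_(l <- s) m l ^+ 2 * cmod (defect2 m c g t tau l) ^+ 2 <= 16 * K * tau ^+ 4.

Definition residual_cst : R := Num.sqrt (b - a) * Num.sqrt (16 * K).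

Lemma residual_sum (d : int -> R[i]) (q : R) : 0 <= q ->
  \sum_(l <- s) cmod (d l) ^+ 2 <= 16 * K * q ^+ 2 -> nrm a b (tsum a b s d) <= residual_cst * q.
Proof.
move=> q0 h; rewrite /residual_cst -mulrA; apply: nrm_tsum_le => //.
  by rewrite mulr_ge0// sqrtr_ge0.
by rewrite exprMn sqr_sqrtr// mulr_ge0.
Qed.

(** [2 mu^2 <= 1 / tau + tau m^2] with [m = mu^2]. *)
Lemma interpolation (d : int -> R[i]) (A B : R) :
  \sum_(l <- s) cmod (d l) ^+ 2 <= A -> \sum_(l <- s) m l ^+ 2 * cmod (d l) ^+ 2 <= B ->
  \sum_(l <- s) cmod ('i * (mu a b l)%:C * d l) ^+ 2 <= 2^-1 * (tau^-1 * A + tau * B).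
Proof.
move=> hA hB; have t0 : tau != 0 by rewrite gt_eqF.
have ti : 0 <= tau^-1 by rewrite invr_ge0 ltW.
apply: le_trans (ler_wpM2l _ (lerD (ler_wpM2l ti hA) (ler_wpM2l (ltW tau0) hB))); last by rewrite invr_ge0.
rewrite 2!mulr_sumr -big_split /= mulr_sumr; apply: ler_sum => l _.
rewrite 2!cmodM cmod_i mul1r cmod_real exprMn real_normK ?num_real// -subr_ge0.
rewrite (_ : _ - _ = 2^-1 * (tau^-1 * (1 - tau * m l) ^+ 2 * cmod (d l) ^+ 2)); last by field.
have half : 0 <= 2^-1 :> R by rewrite invr_ge0.
by nonneg.
Qed.

Lemma residual_first : tau <= T ->
  nrm a b (tsum a b s (residual 0)) <= residual_cst * tau ^+ 2 /\
  nrm a b (tsum a b s (dcoef a b (residual 0))) <= residual_cst * tau `^ (3 / 2).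
Proof.
move=> tT; have cm l : cmod (residual 0 l) = cmod (defect1 m c g tau l).
  by rewrite /residual cmodM cmodN cmod_eit mul1r.
have h1 := d1 tT; have h2 := md1 tT.
have q2 : (tau `^ (3 / 2)) ^+ 2 = tau ^+ 3.
  by rewrite -powR_mulrn ?powR_ge0// -powRrM divfK// powR_mulrn// ltW.
have E : \sum_(l <- s) cmod (residual 0 l) ^+ 2 <= K * tau ^+ 4.
  by under eq_bigr do rewrite cm.
have mE : \sum_(l <- s) m l ^+ 2 * cmod (residual 0 l) ^+ 2 <= K * tau ^+ 4.
  by under eq_bigr do rewrite cm.
have K4 : 0 <= K * tau ^+ 4 by rewrite mulr_ge0// exprn_ge0// ltW.
have K3 : 0 <= K * tau ^+ 3 by rewrite mulr_ge0// exprn_ge0// ltW.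
split.
  apply: residual_sum; first exact: sqr_ge0.
  by apply: le_trans E _; rewrite -exprM -mulrA; lra.
apply: residual_sum; first exact: powR_ge0.
apply: le_trans (interpolation E mE) _; rewrite q2.
have -> : tau^-1 * (K * tau ^+ 4) = K * tau ^+ 3 by field; rewrite gt_eqF.
have h : tau * (K * tau ^+ 4) <= K * tau ^+ 3.
  rewrite (_ : tau * _ = tau ^+ 2 * (K * tau ^+ 3)); last by ring.
  by rewrite ler_piMl// expr_le1// ltW.
by rewrite -mulrA; lra.
Qed.

Lemma residual_next n : n.+2%:R * tau <= T ->
  nrm a b (tsum a b s (residual n.+1)) <= tau * (residual_cst * tau ^+ 2) /\
  nrm a b (tsum a b s (dcoef a b (residual n.+1))) <= tau * (residual_cst * tau `^ (3 / 2)).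
Proof.
move=> nT; have cm l : cmod (residual n.+1 l) = cmod (defect2 m c g (n.+1%:R * tau) tau l).
  by rewrite /residual cmodM cmodN cmod_eit mul1r.
have t1 : 0 <= n.+1%:R * tau - tau.
  by rewrite -(natr1 n) mulrDl mul1r addrK mulr_ge0// ltW.
have t2 : n.+1%:R * tau + tau <= T by move: nT; rewrite -(natr1 n.+1) mulrDl mul1r.
have h1 := d2 t1 t2; have h2 := md2 t1 t2.
have q2 : (tau `^ (3 / 2)) ^+ 2 = tau ^+ 3.
  by rewrite -powR_mulrn ?powR_ge0// -powRrM divfK// powR_mulrn// ltW.
have E : \sum_(l <- s) cmod (residual n.+1 l) ^+ 2 <= 10 * K * tau ^+ 6.
  by under eq_bigr do rewrite cm.
have mE : \sum_(l <- s) m l ^+ 2 * cmod (residual n.+1 l) ^+ 2 <= 16 * K * tau ^+ 4.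
  by under eq_bigr do rewrite cm.
have K6 : 0 <= K * tau ^+ 6 by rewrite mulr_ge0// exprn_ge0// ltW.
have K5 : 0 <= K * tau ^+ 5 by rewrite mulr_ge0// exprn_ge0// ltW.
have t0 : tau != 0 by rewrite gt_eqF.
split.
  rewrite mulrCA; apply: residual_sum; first by rewrite mulr_ge0 ?sqr_ge0// ltW.
  apply: le_trans E _; rewrite (_ : (tau * tau ^+ 2) ^+ 2 = tau ^+ 6); last by ring.
  by rewrite -!mulrA; lra.
rewrite mulrCA; apply: residual_sum; first by rewrite mulr_ge0 ?powR_ge0// ltW.
apply: le_trans (interpolation E mE) _; rewrite exprMn q2.
rewrite (_ : 2^-1 * _ = 13 * (K * tau ^+ 5)); last by field.
by rewrite (_ : 16 * K * _ = 16 * (K * tau ^+ 5)); [lra|ring].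
Qed.

End SchemeCoefficients.

(** * Convergence *)

Section Projection.
Context {R : realType} (a b : R).
Hypothesis ab : a < b.
Context (U : R -> nat -> R -> R[i]) (K : R).
Hypothesis K0 : 0 <= K.
Hypothesis U_jet : forall t, jet a b 3 (U t).
Hypothesis U_bound : forall t k, (k <= 4)%N -> nrm a b (U t k) <= K.
Implicit Types (t : R) (l : int).

Lemma fcoef_jet t l k : (k <= 4)%N ->
  cmod (fcoef a b (U t k) l) ^+ 2 = mu a b l ^+ k ^+ 2 * cmod (fcoef a b (U t 0%N) l) ^+ 2.
Proof.
elim: k => [_|k IH k4]; first by rewrite expr0 expr1n mul1r.
rewrite (fcoef_deriv ab l (U_H1 U_jet t (k4 : (k <= 3)%N)) (U_per U_jet t (k4 : (k <= 3)%N))).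
rewrite cmodM exprMn (IH (ltnW k4)) cmodM cmod_i mul1r cmod_real real_normK ?num_real//.
by rewrite mulrA -exprMn -exprS.
Qed.

Definition proj_cst : R := Num.sqrt (b - a) * (Num.sqrt (b - a)^-1 * K).

Lemma proj_cst_ge0 : 0 <= proj_cst.
Proof. by rewrite !mulr_ge0 ?sqrtr_ge0. Qed.

Lemma sum_U4 t s : uniq s ->
  \sum_(l <- s) cmod (fcoef a b (U t 4) l) ^+ 2 <= (Num.sqrt (b - a)^-1 * K) ^+ 2.
Proof.
move=> us; have ba : 0 <= (b - a)^-1 by rewrite invr_ge0 subr_ge0 ltW.
have L4 : L2 a b (U t 4) by case: (U_jet t) => _ [].
by rewrite exprMn sqr_sqrtr//; apply: bessel_le => //; exact: U_bound.
Qed.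

Lemma proj_U t M : (0 < M)%N -> let s := freqs M.*2 in let h := (b - a) / M.*2%:R in
  nrm a b (fun x => U t 0%N x - tsum a b s (fcoef a b (U t 0%N)) x) <= proj_cst * h ^+ 4 /\
  nrm a b (fun x => U t 1%N x - tsum a b s (fcoef a b (U t 1%N)) x) <= proj_cst * h ^+ 3.
Proof.
move=> M0 s h.
have c0 : 0 <= Num.sqrt (b - a)^-1 * K by rewrite mulr_ge0 ?sqrtr_ge0.
split; rewrite /proj_cst.
  apply: (proj_err ab (U_C1 U_jet t (isT : (0 < 3)%N)) c0 _ M0) => s' us'.
  apply: le_trans (sum_U4 t us'); apply: ler_sum => l _; by rewrite (fcoef_jet _ _ (isT : (4 <= 4)%N)).
apply: (proj_err ab (U_C1 U_jet t (isT : (1 < 3)%N)) c0 _ M0) => s' us'.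
apply: le_trans (sum_U4 t us'); apply: ler_sum => l _.
rewrite (fcoef_jet _ _ (isT : (4 <= 4)%N)) (fcoef_jet _ _ (isT : (1 <= 4)%N)) mulrA -exprMn -exprD.
by rewrite lexx.
Qed.

End Projection.

(** The Gronwall bound is linear in the projection error [q] and the residual [k]. *)
Lemma growth_arith (R : realType) (E L T q k P A Z c1 c2 : R) :
  0 <= E -> 0 <= L -> 0 <= T -> 0 <= c1 -> 0 <= c2 -> q <= P * Z -> k <= A * Z ->
  E * ((c1 * L * q + k) + T * (c2 * L * q + k)) <= E * ((c1 * L + T * (c2 * L)) * P + (1 + T) * A) * Z.
Proof.
move=> E0 L0 T0 c10 c20 hq hk; rewrite -(mulrA E) ler_wpM2l//.
have a0 : 0 <= c1 * L + T * (c2 * L) by nonneg.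
have b0 : 0 <= 1 + T by nonneg.
have h := lerD (ler_wpM2l a0 hq) (ler_wpM2l b0 hk).
rewrite (_ : _ + T * _ = (c1 * L + T * (c2 * L)) * q + (1 + T) * k); last by ring.
by apply: le_trans h _; rewrite le_eqVlt; apply/orP; left; apply/eqP; ring.
Qed.

Lemma powR32 (R : realType) (x : R) : 0 < x -> x <= 1 ->
  [/\ 0 <= x `^ (3 / 2), x `^ (3 / 2) <= x & x ^+ 2 <= x `^ (3 / 2)].
Proof.
move=> x0 x1; have q0 : 0 <= x `^ (3 / 2) := powR_ge0 _ _.
have q2 : (x `^ (3 / 2)) ^+ 2 = x ^+ 3.
  by rewrite -powR_mulrn ?powR_ge0// -powRrM divfK// powR_mulrn// ltW.
split=> //.
  by rewrite -ler_sqr ?nnegrE ?(ltW x0)// q2 exprS ler_piMl// sqr_ge0.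
by rewrite -ler_sqr ?nnegrE ?sqr_ge0// q2 -exprM (exprS _ 3) ler_piMl// exprn_ge0// ltW.
Qed.

Section Convergence.
Context {R : realType} (a b : R).
Hypothesis ab : a < b.
Context (V : R -> R) (W : nat -> R -> R[i]) (beta sigma : R).
Hypothesis VW : ae_eq_on a b (fun x => (V x)%:C) (W 0%N).
Hypothesis W_jet : jet a b 1 W.
Hypothesis sigma1 : 1 <= sigma.
Context (psi0 : R -> R[i]) (U : R -> nat -> R -> R[i]) (T K : R).
Hypothesis T0 : 0 < T.
Hypothesis K0 : 0 <= K.
Hypothesis U_jet : forall t, jet a b 3 (U t).
Hypothesis U_bound : forall t k, (k <= 4)%N -> nrm a b (U t k) <= K.
Hypothesis U_lip : forall s t k, (k <= 2)%N ->
  nrm a b (fun x => U t k x - U s k x) <= K * `|t - s|.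
Hypothesis U_second : forall t s, 0 <= s -> 0 <= t - s -> t + s <= T ->
  nrm a b (fun x => U (t + s) 0%N x + U (t - s) 0%N x - 2 * U t 0%N x) <= K * s ^+ 2.
Hypothesis U0 : ae_eq_on a b (U 0 0%N) psi0.
Hypothesis U_ode : forall (t : R) l, 0 < t < T ->
  cder (fun t => fcoef a b (U t 0%N) l) t
    (- 'i * ((mu a b l ^+ 2)%:C * fcoef a b (U t 0%N) l + fcoef a b (field (W 0%N) beta sigma (U t 0%N)) l)).

Let W01 : C1 a b (W 0%N) (W 1%N). Proof. by case: W_jet => h _ _; exact: h. Qed.
Let W0per : W 0%N a = W 0%N b. Proof. by case: W_jet => _ _; exact. Qed.

(** The threshold [d] makes the final [H^1] bound so small that, by the Sobolev embedding, the
    numerical solution stays within [1] of the exact one. *)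
Lemma convergence : exists d C : R, [/\ 0 < d, 0 < C & forall (tau : R) (N n : nat),
  0 < tau -> tau < d -> (0 < N)%N -> ~~ odd N -> let h := (b - a) / N%:R in h < d -> n%:R * tau <= T ->
  let v := sEWI_FS a b V beta sigma psi0 tau N n in exists v1, [/\ C1 a b v v1,
    nrm a b (fun x => v x - U (n%:R * tau) 0%N x) <= C * (tau ^+ 2 + h ^+ 4) &
    nrm a b (fun x => v x - U (n%:R * tau) 0%N x) + nrm a b (fun x => v1 x - U (n%:R * tau) 1%N x) <=
      C * (tau `^ (3 / 2) + h ^+ 3)]].
Proof.
pose M := sup_cst a b K.
have M0 : 0 <= M by exact: sup_cst_ge0.
have M10 : 0 <= M + 1 by exact: addr_ge0.
have [L L0 Llip] := field_lip beta W01 sigma1 M10.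
have [K' K'0 est] := coef_estimates ab beta W_jet sigma1 K0 U_jet U_bound U_lip U_second.
pose P := proj_cst a b K; have P0 : 0 <= P by exact: proj_cst_ge0.
pose A := residual_cst a b K'.
have A0 : 0 <= A by rewrite mulr_ge0// sqrtr_ge0.
pose E4 := expR (4 * L * T); pose E2 := expR (2 * L * T).
have E40 : 0 <= E4 by exact: expR_ge0.
have E20 : 0 <= E2 by exact: expR_ge0.
have T0' := ltW T0.
pose D1 := E4 * ((2 * L + T * (4 * L)) * (2 * P) + (1 + T) * (2 * A)).
pose D2 := E2 * ((L + T * (2 * L)) * P + (1 + T) * A).
have D10 : 0 <= D1 by rewrite /D1; nonneg.
have D20 : 0 <= D2 by rewrite /D2; nonneg.
pose S := sobolev_cst a b; have S0 : 0 < S by exact: sobolev_cst_gt0.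
have S0' := ltW S0.
pose D := S * (D1 + 2 * P).
have D0 : 0 <= D by rewrite /D; nonneg.
pose d := (2 * (D + 1))^-1.
have D11 : 0 < 2 * (D + 1) by rewrite mulr_gt0// ltr_wpDl.
have d0 : 0 < d by rewrite invr_gt0.
have d1 : d <= 1 by rewrite invf_le1//; lra.
exists d, (D1 + 2 * P + (D2 + P) + 1); split=> //; first by rewrite ltr_wpDl//; nonneg.
move=> tau N n tau0 taud N0 oddN h hd nT v.
have tau1 : tau <= 1 by exact: le_trans (ltW taud) d1.
have h0 : 0 < h by rewrite divr_gt0 ?subr_gt0// ltr0n.
have h1 : h <= 1 by exact: le_trans (ltW hd) d1.
set X := tau `^ (3 / 2).
have [X0 Xt tX] := powR32 tau0 tau1; rewrite -/X in X0 Xt tX.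
have [h4 h3] : h ^+ 4 <= h ^+ 3 /\ h ^+ 3 <= h.
  split; first by rewrite (exprS _ 3) ler_piMl// exprn_ge0// ltW.
  by rewrite exprSr ler_piMl ?(ltW h0)// expr_le1// ltW.
have h30 : 0 <= h ^+ 3 by rewrite exprn_ge0// ltW.
have h40 : 0 <= h ^+ 4 by rewrite exprn_ge0// ltW.
have t20 : 0 <= tau ^+ 2 by exact: sqr_ge0.
have EN : N = (N./2).*2 by rewrite -[LHS]odd_double_half (negbTE oddN).
have M20 : (0 < N./2)%N by rewrite -double_gt0 -EN.
pose s := freqs N; have us : uniq s by exact: freqs_uniq.
pose c t l := fcoef a b (U t 0%N) l.
pose g t l := fcoef a b (field (W 0%N) beta sigma (U t 0%N)) l.
have [g_lip mg_lip g_second] := est s us.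
have c_cont := coef_cont ab K0 U_jet U_lip.
have b1 := defect1_bound K'0 c_cont U_ode g_lip tau0.
have b2 := mdefect1_bound K'0 c_cont U_ode mg_lip tau0.
have b3 t := @defect2_bound _ _ _ _ _ _ _ _ K'0 c_cont U_ode mg_lip g_second t _ tau0.
have b4 t := @mdefect2_bound _ _ _ _ _ _ _ _ K'0 c_cont U_ode mg_lip t _ tau0.
have rf := residual_first ab K'0 tau0 tau1 b1 b2.
have rn := residual_next ab K'0 tau0 b3 b4.
pose u k := U (k%:R * tau) 0%N; pose u1 k := U (k%:R * tau) 1%N.
pose p k := fcoef a b (sEWI_FS a b V beta sigma psi0 tau N k).
have pr k : nrm a b (fun x => u k x - tsum a b s (fcoef a b (u k)) x) <= P * h ^+ 4 /\
    nrm a b (fun x => u1 k x - tsum a b s (fcoef a b (u1 k)) x) <= P * h ^+ 3.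
  by rewrite /s /h EN; exact: proj_U.
have u_C1 k : C1 a b (u k) (u1 k) by exact: (U_C1 U_jet _ (isT : (0 < 3)%N)).
have u_per k : u k a = u k b by exact: (U_per U_jet _ (isT : (0 <= 3)%N)).
have u_sup k : bounded_by a b M (u k) by exact: (U_sup ab U_jet U_bound _ (isT : (0 <= 3)%N)).
have u1_sup k : bounded_by a b M (u1 k) by exact: (U_sup ab U_jet U_bound _ (isT : (1 <= 3)%N)).
have u00 : ae_eq_on a b (u 0%N) psi0 by rewrite /u mul0r.
have nN m : (m <= n)%N -> m%:R * tau <= T.
  by move=> mn; apply: le_trans nT; rewrite ler_wpM2r ?ler_nat// ltW.
have key := stability ab us W01 W0per sigma1 L0 Llip u_C1 u_per u_sup u1_sup
  (fun k => (pr k).1) (fun k => (pr k).2) tau0 nT (mulr_ge0 A0 t20) (mulr_ge0 A0 X0)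
  (fun l => weight0_le a b tau l) (fun l => weight1_le a b l tau0) (fun l => weight2_le a b l tau0)
  (err_start ab V beta sigma tau u00)
  (fun l ls _ => err_first ab VW u00 (fun k l => erefl : fcoef a b (u k) l = c (k%:R * tau) l)
     (fun k l => erefl : fcoef a b (field (W 0%N) beta sigma (u k)) l = g (k%:R * tau) l) ls)
  (fun l ls k _ => err_next ab VW psi0 (fun k l => erefl : fcoef a b (u k) l = c (k%:R * tau) l)
     (fun k l => erefl : fcoef a b (field (W 0%N) beta sigma (u k)) l = g (k%:R * tau) l) k ls).
have {}key := key
  (fun n0 => rf (eq_ind _ (fun y => y <= T) (nN 1%N n0) _ (mul1r tau)))
  (fun k kn => rn k (nN k.+2 kn)) (mulr_ge0 P0 h40) (mulr_ge0 P0 h30) tau1 T0'.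
pose Z := X + h ^+ 3.
have Z0 : 0 <= Z by exact: addr_ge0.
have hq : P * h ^+ 4 + P * h ^+ 3 <= 2 * P * Z.
  have e1 : P * h ^+ 4 <= P * h ^+ 3 by rewrite ler_wpM2l.
  have e2 : 0 <= P * X by exact: mulr_ge0.
  by rewrite (_ : 2 * P * Z = 2 * (P * X) + 2 * (P * h ^+ 3)); [lra|rewrite /Z; ring].
have hk : A * tau ^+ 2 + A * X <= 2 * A * Z.
  have e1 : A * tau ^+ 2 <= A * X by rewrite ler_wpM2l.
  have e2 : 0 <= A * h ^+ 3 by exact: mulr_ge0.
  by rewrite (_ : 2 * A * Z = 2 * (A * X) + 2 * (A * h ^+ 3)); [lra|rewrite /Z; ring].
have hG := growth_arith E40 L0 T0' (ler0n R 2) (ler0n R 4) hq hk.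
rewrite -/D1 in hG.
have Zd : Z <= 2 * d by rewrite /Z; lra.
have DZ : D * Z <= 1.
  have d2 : 2 * d = (D + 1)^-1 by rewrite /d invfM mulrA mulfV ?mul1r// pnatr_eq0.
  apply: le_trans (ler_wpM2l D0 Zd) _; rewrite d2 ler_pdivrMr ?mul1r ?lerDl//.
  exact: ltr_wpDl.
have small : S * (E4 * (2 * L * (P * h ^+ 4 + P * h ^+ 3) + (A * tau ^+ 2 + A * X) +
    T * (4 * L * (P * h ^+ 4 + P * h ^+ 3) + (A * tau ^+ 2 + A * X))) + (P * h ^+ 4 + P * h ^+ 3)) <= 1.
  apply: le_trans DZ; rewrite /D -(mulrA S) ler_wpM2l// (mulrDl D1).
  exact: lerD hG hq.
have [e0 e1] := key small n (leqnn n).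
have Ev : tsum a b s (p n) = v by rewrite /p -scheme_tsum.
have m0 := nrm_v_sub u_C1 (fun k => (pr k).1) p n.
have m1 := nrm_v1_sub ab u_C1 u_per (fun k => (pr k).2) p n.
rewrite Ev in m0.
exists (tsum a b s (dcoef a b (p n))); split; first by rewrite -Ev; exact: v_C1.
  apply: le_trans m0 _; apply: le_trans (lerD e0 (lexx _)) _.
  have q1 : P * h ^+ 4 <= P * (tau ^+ 2 + h ^+ 4) by rewrite ler_wpM2l// lerDr.
  have k1 : A * tau ^+ 2 <= A * (tau ^+ 2 + h ^+ 4) by rewrite ler_wpM2l// lerDl.
  have g1 := growth_arith E20 L0 T0' (@ler01 R) (ler0n R 2) q1 k1.
  rewrite mul1r -/D2 in g1; apply: le_trans (lerD g1 q1) _.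
  by rewrite -mulrDl ler_wpM2r ?addr_ge0//; lra.
apply: le_trans (lerD m0 m1) _; rewrite addrACA.
apply: le_trans (lerD e1 (lexx _)) _; apply: le_trans (lerD hG hq) _.
by rewrite -mulrDl ler_wpM2r//; lra.
Qed.

End Convergence.

Lemma Hnorm1_le (R : realType) (a b : R) (u d0 d1 : R -> R[i]) :
  is_wderiv a b 0 u d0 -> is_wderiv a b 1 u d1 ->
  (Hnorm a b 1 u <= (nrm a b d0 + nrm a b d1)%:E)%E.
Proof.
move=> w0 w1; pose D k := if k is 0%N then d0 else d1.
have wD k : (k <= 1)%N -> is_wderiv a b k u (D k) by case: k => [|[]].
apply: (@le_trans _ _ (sqrte (\sum_(k < 2) L2norm a b (D k) ^+ 2)%E)).
  by apply: ereal_inf_lbound; exists D.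
rewrite sum_L2norm; last by move=> k /wD[].
have n0 := nrm_ge0 a b d0; have n1 := nrm_ge0 a b d1.
rewrite lee_fin -ler_sqr ?nnegrE ?sqrtr_ge0 ?addr_ge0// sqr_sqrtr; last first.
  by apply: sumr_ge0 => k _; exact: sqr_ge0.
rewrite !big_ord_recl big_ord0 addr0 /= sqrrD -addrA [leRHS]addrCA [leRHS]addrC -addrA lerD2l.
by rewrite lerDl mulrn_wge0// mulr_ge0.
Qed.

Theorem theorem4p1 (R : realType) (a b : R) (hab : a < b)
    (V : R -> R) (hV : Hper a b 2 (fun x => (V x)%:C))
    (beta sigma : R) (hsigma : 1 <= sigma)
    (psi0 : R -> R[i]) (psi : R -> R -> R[i]) (Tmax : \bar R)
    (hpsi : maximal_nlse_solution a b V beta sigma psi0 Tmax psi)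
    (T : R) (hT : 0 < T) (hTmax : (T%:E < Tmax)%E)
    (hC0 : Ck_in (Hper a b 4) (Hnorm a b 4) `[0, T] 0 psi)
    (hC1 : Ck_in (Hm a b 2) (Hnorm a b 2) `[0, T] 1 psi)
    (hC2 : Ck_in (L2 a b) (L2norm a b) `[0, T] 2 psi) :
  exists tau0 h0 C : R, [/\ 0 < tau0, 0 < h0, 0 < C &
    forall (tau : R) (N : nat), 0 < tau -> tau < tau0 ->
      (0 < N)%N -> ~~ odd N ->
      forall h : R, h = (b - a) / N%:R -> h < h0 ->
      forall n : nat, n%:R <= T / tau ->
        let err : R -> R[i] := fun x =>
          psi (n%:R * tau) x - sEWI_FS a b V beta sigma psi0 tau N n x in
        (L2norm a b err <= (C * (tau ^+ 2 + h ^+ 4))%:E)%E /\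
        (Hnorm a b 1 err <= (C * (tau `^ (3 / 2) + h ^+ 3))%:E)%E].
Proof.
have [g [LV _ _]] := hV.1 0%N isT.
have [W [jW wW]] := Hper_jet hab hV.
have VW := wderiv_uniq (wderiv0 LV) (wW 0%N isT).
have [U' [K K0 [jU' wU' bU' lU' sU']]] := solution_data hab hT hC0 hC1 hC2.
(* Freezing the solution outside [[0, T]] keeps all the bounds and makes its coefficients
   continuous on the whole line. *)
pose cl t := Num.max 0 (Num.min T t).
have clI t : 0 <= cl t <= T.
  by rewrite /cl le_max lexx /= ge_max (ltW hT) ge_min lexx.
have clE t : 0 <= t <= T -> cl t = t.
  by move=> /andP[t0 tT]; rewrite /cl (min_idPr tT) (max_idPr t0).
have cl_lip s t : `|cl t - cl s| <= `|t - s|.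
  wlog st : s t / s <= t.
    move=> H; have [st|ts] := leP s t; first exact: H.
    by rewrite distrC (distrC t); apply: H; exact: ltW.
  rewrite [leRHS]ger0_norm ?subr_ge0//.
  rewrite /cl !maxEle !minEle.
  have := hT; case: (leP T s); case: (leP T t); case: (leP 0 s); case: (leP 0 t); case: (leP 0 T) => *;
    rewrite ler_norml; lra.
pose U t := U' (cl t).
have wU t k : 0 <= t <= T -> (k <= 4)%N -> is_wderiv a b k (psi t) (U t k).
  by move=> tI k4; rewrite /U clE//; exact: wU'.
have [nlse _] := hpsi.
have TI t : 0 <= t <= T -> life_span Tmax t.
  by move=> /andP[t0 tT]; split=> //; apply: le_lt_trans hTmax; rewrite lee_fin.
have jU t : jet a b 3 (U t) by apply: jU'; exact: clI.
have bU t k : (k <= 4)%N -> nrm a b (U t k) <= K by move=> k4; apply: bU' => //; exact: clI.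
have lU s t k : (k <= 2)%N -> nrm a b (fun x => U t k x - U s k x) <= K * `|t - s|.
  move=> k2; apply: le_trans (lU' _ _ k (clI s) (clI t) k2) _.
  by rewrite ler_wpM2l.
have sU t s : 0 <= s -> 0 <= t - s -> t + s <= T ->
    nrm a b (fun x => U (t + s) 0%N x + U (t - s) 0%N x - 2 * U t 0%N x) <= K * s ^+ 2.
  move=> s0 ts0 tsT; rewrite /U !clE; first exact: sU'.
  - by lra.
  - by lra.
  - by lra.
have U0 : ae_eq_on a b (U 0 0%N) psi0.
  have I0 : 0 <= (0 : R) <= T by rewrite lexx ltW.
  have w := wU 0 0%N I0 isT; have [Lp _ _] := w; have [_ _ e0] := nlse.
  by apply: aeS2 (wderiv_uniq w (wderiv0 Lp)) e0 => x h1 h2 xI; rewrite (h1 xI) (h2 xI).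
have ode t l : 0 < t < T -> _ := coef_ode hab jW hsigma jU l nlse TI wU VW.
have [d [C [d0 C0 conv]]] := convergence hab VW jW hsigma hT K0 jU bU lU sU U0 ode.
exists d, d, C; split=> // tau N tau0 taud N0 oddN h -> hd n hn err.
have nT : n%:R * tau <= T by rewrite -ler_pdivlMr.
have tI : 0 <= n%:R * tau <= T by rewrite nT mulr_ge0// ltW.
have [v1 [Cv e0 e1]] := conv tau N n tau0 taud N0 oddN hd nT.
have Hv := C1_H1 Cv.
have w0 : is_wderiv a b 0 err (fun x => U (n%:R * tau) 0%N x - sEWI_FS a b V beta sigma psi0 tau N n x).
  by apply: wderivB; [exact: wU|apply: wderiv0; exact: H1_L2 Hv].
have w1 : is_wderiv a b 1 err (fun x => U (n%:R * tau) 1%N x - v1 x).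
  by apply: wderivB; [exact: wU|exact: H1_wderiv].
split.
  have [Le _ _] := w0; rewrite (L2normE Le) lee_fin.
  by rewrite (nrm_ae (wderiv_uniq (wderiv0 Le) w0)) nrm_distC.
apply: le_trans (Hnorm1_le w0 w1) _; rewrite lee_fin.
by rewrite nrm_distC [nrm a b (fun x => U _ 1%N x - _)]nrm_distC.
Qed.
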